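(* Let $\Gamma$ be a finitely generated group and $\mathbf{G}$ a connected complex reductive algebraic group. Let $\Phi$ be the antiholomorphic involution of $\mathfrak{X}_{\mathbf{G}}(\Gamma)$ induced by a real form $G$ of $\mathbf{G}$. Let $\rho\in\mathrm{Hom}(\Gamma,\mathbf{G})$ be a good representation such that $\Phi(\chi_\rho)=\chi_\rho$. Then there exists a real form $G'$ of $\mathbf{G}$ such that $\rho\in\mathrm{Hom}(\Gamma,G')$.
   Context: A real form $G$ of a complex algebraic group $\mathbf{G}$ is a real algebraic subgroup $G\subset\mathbf{G}$ whose inclusion extends to an isomorphism $G\otimes_{\mathbb{R}}\mathbb{C}\simeq\mathbf{G}$; it is the fixed-point set of a unique involutive antiholomorphic (anti-regular) group automorphism $g\mapsto\bar g$ of $\mathbf{G}$. $\mathrm{Hom}(\Gamma,\mathbf{G})$ is the affine variety of group homomorphisms $\Gamma\to\mathbf{G}$ (a closed subvariety of $\mathbf{G}^s$ via images of $s$ generators of $\Gamma$), on which $\mathbf{G}$ acts by conjugation. The character variety is the GIT quotient $\mathfrak{X}_{\mathbf{G}}(\Gamma)=\mathrm{Hom}(\Gamma,\mathbf{G})/\!\!/\mathbf{G}$, whose ring of functions is $\mathbb{C}[\mathrm{Hom}(\Gamma,\mathbf{G})]^{\mathbf{G}}$; the quotient map is written $\rho\mapsto\chi_\rho$. The involution induced by $G$ sends $\chi_\rho$ to $\chi_{\bar\rho}$, where $\bar\rho(\gamma)=\overline{\rho(\gamma)}$. A representation $\rho\in\mathrm{Hom}(\Gamma,\mathbf{G})$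 is good if its $\mathbf{G}$-orbit is closed in $\mathrm{Hom}(\Gamma,\mathbf{G})$ and its stabilizer in $\mathbf{G}$ is the center of $\mathbf{G}$. *)

(* Defs.v *)
(* MathComp; the complex numbers are R[i] for R : realType. *)
From mathcomp Require Import all_boot all_order all_algebra.
From mathcomp Require Import boolp classical_sets reals.
From mathcomp Require Import complex mpoly.

Set Implicit Arguments.
Unset Strict Implicit.
Unset Printing Implicit Defensive.

Import GRing.Theory Num.Theory.
Local Open Scope ring_scope.
Local Open Scope classical_set_scope.

Section Zariski.
Variable R : realType.

(* A variety is a set X of points of a type T, with a coordinate map
   c : T -> C^N that is a closed embedding of the ambient variety; closed
   subsets and regular functions are cut out or induced by polynomials in c. *)

Definition closed_in (T : Type) (N : nat) (c : T -> 'rV[R[i]]_N)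
    (X Y : set T) : Prop :=
  exists S : set {mpoly R[i][N]},
    Y = X `&` [set t | forall p, S p -> p.@[c t 0] = 0].

Definition regular_on (T : Type) (N : nat) (c : T -> 'rV[R[i]]_N)
    (X : set T) (f : T -> R[i]) : Prop :=
  exists p : {mpoly R[i][N]}, forall t, X t -> f t = p.@[c t 0].

Definition connected_in (T : Type) (N : nat) (c : T -> 'rV[R[i]]_N)
    (X : set T) : Prop :=
  forall Y Z : set T, closed_in c X Y -> closed_in c X Z ->
    Y `|` Z = X -> Y `&` Z = set0 -> Y = set0 \/ Z = set0.

End Zariski.

Section AlgebraicGroups.
Variable R : realType.

(* g |-> (g, 1 / det g) identifies GL_n with the closed subvariety
   { (x, t) | t * det x = 1 } of affine space. *)
Definition glcoord (n : nat) (g : 'M[R[i]]_n) : 'rV[R[i]]_(n * n + 1) :=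
  row_mx (mxvec g) (const_mx (\det g)^-1).

Definition GL (n : nat) : set 'M[R[i]]_n := [set g | g \in unitmx].

(* Complex linear algebraic groups: Zariski-closed subgroups of GL_n(C). *)
Record algGroup (n : nat) := AlgGroup {
  ag_set :> 'M[R[i]]_n -> Prop;
  ag_closed : closed_in (@glcoord n) (@GL n) ag_set;
  ag_1 : ag_set 1%:M;
  ag_mul : forall g h, ag_set g -> ag_set h -> ag_set (g *m h);
  ag_inv : forall g, ag_set g -> ag_set (invmx g)
}.

Definition ag_connected (n : nat) (G : algGroup n) : Prop :=
  connected_in (@glcoord n) (ag_set G).

Definition normal_in (n : nat) (G U : algGroup n) : Prop :=
  ag_set U `<=` ag_set G /\ forall g u, G g -> U u -> U (g *m u *m invmx g).

Definition ag_unipotent (n : nat) (U : algGroup n) : Prop :=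
  forall u, U u -> exists k : nat, (u - 1%:M) ^+ k = 0.

(* Triviality of the unipotent radical, i.e. of the largest connected normal
   unipotent closed subgroup. *)
Definition reductive (n : nat) (G : algGroup n) : Prop :=
  forall U : algGroup n, normal_in G U -> ag_connected U -> ag_unipotent U ->
    ag_set U = [set 1%:M].

Definition center (n : nat) (G : algGroup n) : set 'M[R[i]]_n :=
  [set z | G z /\ forall h, G h -> z *m h = h *m z].

Definition alg_hom (m n : nat) (H : algGroup m) (G : algGroup n)
    (phi : 'M[R[i]]_m -> 'M[R[i]]_n) : Prop :=
  [/\ forall h, H h -> G (phi h),
      forall h k, H h -> H k -> phi (h *m k) = phi h *m phi k
    & forall i j, regular_on (@glcoord m) (ag_set H) (fun h => phi h i j)].

Definition alg_iso (m n : nat) (H : algGroup m) (G : algGroup n)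
    (phi : 'M[R[i]]_m -> 'M[R[i]]_n) : Prop :=
  alg_hom H G phi /\
  exists psi : 'M[R[i]]_n -> 'M[R[i]]_m,
    [/\ alg_hom G H psi, forall h, H h -> psi (phi h) = h
      & forall g, G g -> phi (psi g) = g].

Definition defined_over_R (m : nat) (H : algGroup m) : Prop :=
  exists S : set {mpoly R[m * m + 1]},
    ag_set H = @GL m `&`
      [set h | forall p, S p ->
         (map_mpoly (real_complex R) p).@[glcoord h 0] = 0].

Definition real_points (m : nat) (H : algGroup m) : set 'M[R[i]]_m :=
  [set h | H h /\ exists a : 'M[R]_m, h = map_mx (real_complex R) a].

(* A real algebraic group is given by a group H defined over R; its points are
   H(R) and its complexification is H.  G0 is a real form of G when it is
   identified with such a group by a map that extends to an isomorphism from
   the complexification onto G. *)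
Definition real_form (n : nat) (G : algGroup n) (G0 : set 'M[R[i]]_n) : Prop :=
  exists (m : nat) (H : algGroup m) (phi : 'M[R[i]]_m -> 'M[R[i]]_n),
    [/\ defined_over_R H, alg_iso H G phi & G0 = phi @` real_points H].

(* Involutive anti-regular group automorphisms; only the restriction of the
   function to G is meaningful. *)
Record antiInvolution (n : nat) (G : algGroup n) := AntiInvolution {
  ai_fun :> 'M[R[i]]_n -> 'M[R[i]]_n;
  ai_in : forall g, G g -> G (ai_fun g);
  ai_mul : forall g h, G g -> G h -> ai_fun (g *m h) = ai_fun g *m ai_fun h;
  ai_invol : forall g, G g -> ai_fun (ai_fun g) = g;
  ai_antiregular : forall i j,
    regular_on (@glcoord n) (ag_set G) (fun g => ((ai_fun g i j)^*)%C)
}.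

Definition fixed_points (n : nat) (G : algGroup n) (sigma : antiInvolution G) :
    set 'M[R[i]]_n :=
  [set g | G g /\ sigma g = g].

End AlgebraicGroups.

Definition generates (Gam : groupType) (s : nat) (gen : 'I_s -> Gam) : Prop :=
  forall P : set Gam,
    P 1%g -> (forall x y, P x -> P y -> P (x * y)%g) ->
    (forall x, P x -> P (x^-1)%g) -> (forall i, P (gen i)) ->
    forall x, P x.

Section RegularFunctions.
Variable R : realType.

Lemma regular_ext (T : Type) (N : nat) (c : T -> 'rV[R[i]]_N) (X : set T)
    (f g : T -> R[i]) :
  (forall t, X t -> g t = f t) -> regular_on c X f -> regular_on c X g.
Proof. by move=> fg [p pE]; exists p => t Xt; rewrite fg // pE. Qed.

Lemma regular_coord (T : Type) (N : nat) (c : T -> 'rV[R[i]]_N) (X : set T) k :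
  regular_on c X (fun t => c t 0 k).
Proof. by exists 'X_k => t _; rewrite mevalXU. Qed.

Lemma regular_cst (T : Type) (N : nat) (c : T -> 'rV[R[i]]_N) (X : set T) a :
  regular_on c X (fun=> a).
Proof. by exists a%:MP_[N] => t _; rewrite mevalC. Qed.

Lemma regular_mul (T : Type) (N : nat) (c : T -> 'rV[R[i]]_N) (X : set T)
    (f g : T -> R[i]) :
  regular_on c X f -> regular_on c X g -> regular_on c X (fun t => f t * g t).
Proof.
by move=> [p pE] [q qE]; exists (p * q) => t Xt; rewrite mevalM pE // qE.
Qed.

Lemma regular_sum (T : Type) (N : nat) (c : T -> 'rV[R[i]]_N) (X : set T)
    (I : Type) (e : seq I) (f : I -> T -> R[i]) :
  (forall i, regular_on c X (f i)) ->
  regular_on c X (fun t => \sum_(i <- e) f i t).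
Proof.
move=> /boolp.choice[p pE]; exists (\sum_(i <- e) p i) => t Xt.
by rewrite raddf_sum; apply: eq_bigr => i _; exact: pE.
Qed.

Lemma regular_prod (T : Type) (N : nat) (c : T -> 'rV[R[i]]_N) (X : set T)
    (I : Type) (e : seq I) (f : I -> T -> R[i]) :
  (forall i, regular_on c X (f i)) ->
  regular_on c X (fun t => \prod_(i <- e) f i t).
Proof.
move=> /boolp.choice[p pE]; exists (\prod_(i <- e) p i) => t Xt.
by rewrite rmorph_prod; apply: eq_bigr => i _; exact: pE.
Qed.

Lemma regular_det (T : Type) (N : nat) (c : T -> 'rV[R[i]]_N) (X : set T)
    (m : nat) (A : T -> 'M[R[i]]_m) :
  (forall i j, regular_on c X (fun t => A t i j)) ->
  regular_on c X (fun t => \det (A t)).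
Proof.
move=> rA; rewrite /determinant; apply: regular_sum => s.
by apply: regular_mul; [exact: regular_cst | apply: regular_prod => i].
Qed.

Lemma regular_comp (T : Type) (N M : nat) (c : T -> 'rV[R[i]]_N)
    (d : T -> 'rV[R[i]]_M) (p : {mpoly R[i][M]}) (X : set T) :
  (forall j, regular_on c X (fun t => d t 0 j)) ->
  regular_on c X (fun t => p.@[d t 0]).
Proof.
move=> /boolp.choice[q qE]; exists (comp_mpoly [tuple q i | i < M] p) => t Xt.
rewrite comp_mpoly_meval; apply: meval_eq => j.
by rewrite tnth_mktuple qE.
Qed.

Lemma regular_entry n (X : set 'M[R[i]]_n) i j :
  regular_on (@glcoord R n) X (fun g => g i j).
Proof.
apply: regular_ext (regular_coord _ _ (lshift 1 (mxvec_index i j))) => g _.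
by rewrite /glcoord row_mxEl mxvecE.
Qed.

Lemma regular_glcoord_inv n (X : set 'M[R[i]]_n) k :
  (forall g, X g -> g \in unitmx) ->
  regular_on (@glcoord R n) X (fun g => glcoord (invmx g) 0 k).
Proof.
move=> Xu; rewrite -(splitK k); case: (fintype.split k) => l /=; last first.
  apply: (regular_ext (f := fun g => \det g)) => [g _|].
    by rewrite /glcoord row_mxEr mxE det_inv invrK.
  by apply: regular_det => i j; exact: regular_entry.
case/mxvec_indexP: l => i j.
apply: (regular_ext
    (f := fun g => glcoord g 0 (rshift _ ord0) * cofactor g j i)) => [g Xg|].
  by rewrite /glcoord row_mxEl row_mxEr mxvecE /invmx Xu // !mxE.
apply: regular_mul; first exact: regular_coord.
apply: regular_mul; first exact: regular_cst.
apply: regular_det => a b; apply: regular_ext (regular_entry _ (lift j a) (lift i b)).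
by move=> g _; rewrite !mxE.
Qed.

Lemma meval_map_conj N (p : {mpoly R[i][N]}) (v : 'I_N -> R[i]) :
  (map_mpoly (@conjc R) p).@[fun k => ((v k)^*)%C] = ((p.@[v])^*)%C.
Proof.
rewrite [in RHS]mevalE !raddf_sum /=.
apply: eq_bigr => m _; rewrite mevalM mevalC mmap1_id mevalX rmorphM.
by rewrite rmorph_prod; congr (_ * _); apply: eq_bigr => i _; rewrite rmorphXn.
Qed.

End RegularFunctions.

Section CharacterVariety.
Variables (R : realType) (Gam : groupType) (n : nat) (G : algGroup R n).

(* The points of Hom(Gam, G). *)
Record rep := Rep {
  rep_fun :> Gam -> 'M[R[i]]_n;
  rep_in : forall x, G (rep_fun x);
  rep_mul : forall x y, rep_fun (x * y)%g = rep_fun x *m rep_fun y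
}.

Variables (s : nat) (gen : 'I_s -> Gam).

(* The embedding of Hom(Gam, G) in G^s given by the generators. *)
Definition homcoord (r : rep) : 'rV[R[i]]_(s * (n * n + 1)) :=
  mxvec (\matrix_(i < s) glcoord (r (gen i))).

Definition orbit (r : rep) : set rep :=
  [set r' | exists2 g, G g & forall x, r' x = g *m r x *m invmx g].

Definition stabilizer (r : rep) : set 'M[R[i]]_n :=
  [set g | G g /\ forall x, g *m r x *m invmx g = r x].

Definition good (r : rep) : Prop :=
  closed_in homcoord [set: rep] (orbit r) /\ stabilizer r = center G.

(* C[Hom(Gam, G)]^G *)
Record invfun := InvFun {
  if_fun :> rep -> R[i];
  if_regular : regular_on homcoord [set: rep] if_fun;
  if_invariant : forall r r', orbit r r' -> if_fun r' = if_fun r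
}.

(* The points of the affine variety Hom(Gam, G) // G, as the C-algebra
   morphisms from its ring of functions to C. *)
Record charvar := CharVar {
  cv_eval :> invfun -> R[i];
  cv_const : forall (a : R[i]) (f : invfun), (forall r, f r = a) ->
    cv_eval f = a;
  cv_add : forall f g h : invfun, (forall r, h r = f r + g r) ->
    cv_eval h = cv_eval f + cv_eval g;
  cv_mul : forall f g h : invfun, (forall r, h r = f r * g r) ->
    cv_eval h = cv_eval f * cv_eval g
}.

Section Character.
Variable r : rep.
Let ev (f : invfun) : R[i] := f r.
Fact chi_const (a : R[i]) (f : invfun) : (forall r, f r = a) -> ev f = a.
Proof. by move=> /(_ r). Qed.
Fact chi_add (f g h : invfun) :
  (forall r, h r = f r + g r) -> ev h = ev f + ev g.
Proof. by move=> /(_ r). Qed.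
Fact chi_mul (f g h : invfun) :
  (forall r, h r = f r * g r) -> ev h = ev f * ev g.
Proof. by move=> /(_ r). Qed.
Definition chi : charvar := CharVar chi_const chi_add chi_mul.
End Character.

Section Involution.
Variable sigma : antiInvolution G.

Fact rep_bar_in (r : rep) x : G (sigma (r x)).
Proof. exact/ai_in/rep_in. Qed.

Fact rep_bar_mul (r : rep) x y :
  sigma (r (x * y)%g) = sigma (r x) *m sigma (r y).
Proof. by rewrite rep_mul ai_mul //; apply: rep_in. Qed.

Definition rep_bar (r : rep) : rep := Rep (rep_bar_in r) (@rep_bar_mul r).

Lemma ag_unit g : G g -> g \in unitmx.
Proof. by case: (ag_closed G) => S -> []. Qed.

Lemma ai_invmx g : G g -> sigma (invmx g) = invmx (sigma g).
Proof.
move=> Gg; have Gi := ag_inv Gg.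
have s1 : sigma 1%:M = 1%:M.
  have G1 := ag_1 G; have U := ag_unit (ai_in sigma G1).
  have E : sigma 1%:M *m sigma 1%:M = sigma 1%:M by rewrite -ai_mul // mul1mx.
  by rewrite -[LHS](mulKmx U) E mulVmx.
have U := ag_unit (ai_in sigma Gg).
by rewrite -[LHS](mulKmx U) -ai_mul // mulmxV ?s1 ?mulmx1 //; apply: ag_unit.
Qed.

Lemma orbit_bar r r' : orbit r r' -> orbit (rep_bar r) (rep_bar r').
Proof.
case=> g Gg e; exists (sigma g); first exact: ai_in.
move=> x /=; have Gi := ag_inv Gg; have Gx := rep_in r x.
by rewrite e !ai_mul ?ai_invmx //; apply: ag_mul.
Qed.

Lemma sigma_inv_regular i j :
  regular_on (@glcoord R n) (ag_set G)
    (fun g => ((invmx (sigma g) i j)^*)%C).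
Proof.
have [q qE] := ai_antiregular sigma i j.
apply: (regular_ext (f := fun g => q.@[glcoord (invmx g) 0])) => [g Gg|].
  by rewrite -ai_invmx // qE //; apply: ag_inv.
by apply: regular_comp => k; apply: regular_glcoord_inv; apply: ag_unit.
Qed.

Lemma sigma_glcoord_regular k :
  regular_on (@glcoord R n) (ag_set G)
    (fun g => ((glcoord (sigma g) 0 k)^*)%C).
Proof.
rewrite -(splitK k); case: (fintype.split k) => l /=.
  case/mxvec_indexP: l => i j.
  apply: (regular_ext (f := fun g => ((sigma g i j)^*)%C)) => [g _|].
    by rewrite /glcoord row_mxEl mxvecE.
  exact: ai_antiregular.
apply: (regular_ext
    (f := fun g => \det (\matrix_(i, j) ((invmx (sigma g) i j)^*)%C))) => [g _|].
  rewrite /glcoord row_mxEr mxE -det_inv -det_map_mx.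
  by congr (\det _); apply/matrixP => i j; rewrite !mxE.
by apply: regular_det => i j; apply: regular_ext (sigma_inv_regular i j) => g _;
  rewrite mxE.
Qed.

Lemma regular_gen i (f : 'M[R[i]]_n -> R[i]) :
  regular_on (@glcoord R n) (ag_set G) f ->
  regular_on homcoord [set: rep] (fun r => f (r (gen i))).
Proof.
case=> p pE.
apply: (regular_ext (f := fun r : rep => p.@[glcoord (r (gen i)) 0])) => [r _|].
  by rewrite pE //; apply: rep_in.
apply: regular_comp => k.
apply: (regular_ext (f := fun r : rep => homcoord r 0 (mxvec_index i k))) => [r _|].
  by rewrite /homcoord mxvecE mxE.
exact: regular_coord.
Qed.

(* conj \o f \o rep_bar is again an invariant regular function. *)
Definition fbar (f : invfun) (r : rep) : R[i] := ((f (rep_bar r))^*)%C.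

Fact fbar_regular f : regular_on homcoord [set: rep] (fbar f).
Proof.
have [p pE] := if_regular f.
pose d (r : rep) : 'rV[R[i]]_(s * (n * n + 1)) :=
  map_mx (@conjc R) (homcoord (rep_bar r)).
apply: (regular_ext (f := fun r : rep => (map_mpoly (@conjc R) p).@[d r 0])) => [r _|].
  rewrite /fbar pE // -meval_map_conj; apply: meval_eq => k.
  by rewrite mxE.
apply: regular_comp => k; case/mxvec_indexP: k => i k.
apply: (regular_ext
  (f := fun r : rep => ((glcoord (sigma (r (gen i))) 0 k)^*)%C)) => [r _|].
  by rewrite /d mxE /homcoord mxvecE mxE.
exact: (regular_gen i (sigma_glcoord_regular k)).
Qed.

Fact fbar_invariant f r r' : orbit r r' -> fbar f r' = fbar f r.
Proof. by move=> /orbit_bar/(if_invariant f); rewrite /fbar => ->. Qed.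

Definition invfun_bar (f : invfun) : invfun :=
  InvFun (fbar_regular f) (@fbar_invariant f).

(* sigma acts on the ring of functions by the antilinear map f |-> invfun_bar f;
   Phi is the antiholomorphic involution it induces on points. *)
Section Phi.
Variable x : charvar.
Let ev (f : invfun) : R[i] := ((x (invfun_bar f))^*)%C.
Fact Phi_const (a : R[i]) (f : invfun) : (forall r, f r = a) -> ev f = a.
Proof.
move=> fa; rewrite /ev (cv_const x (a := (a^*)%C)) ?conjcK // => r.
by rewrite /= /fbar fa.
Qed.
Fact Phi_add (f g h : invfun) :
  (forall r, h r = f r + g r) -> ev h = ev f + ev g.
Proof.
move=> hE; rewrite /ev -rmorphD /= -(cv_add x (h := invfun_bar h)) // => r.
by rewrite /= /fbar hE rmorphD.
Qed.
Fact Phi_mul (f g h : invfun) :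
  (forall r, h r = f r * g r) -> ev h = ev f * ev g.
Proof.
move=> hE; rewrite /ev -rmorphM /= -(cv_mul x (h := invfun_bar h)) // => r.
by rewrite /= /fbar hE rmorphM.
Qed.
Definition Phi : charvar := CharVar Phi_const Phi_add Phi_mul.
End Phi.

Lemma Phi_chi r : Phi (chi r) = chi (rep_bar r).
Proof.
have cvP (x y : charvar) : cv_eval x = cv_eval y -> x = y.
  case: x y => [a a1 a2 a3] [b b1 b2 b3] /= e; case: _ / e in b1 b2 b3 *.
  by congr CharVar; apply: Prop_irrelevance.
by apply/cvP/funext => f /=; rewrite /fbar conjcK.
Qed.

End Involution.
End CharacterVariety.

(* Main.v *)
(* Since rho and its conjugate bar rho have the same image in the character
   variety and closed orbits, they are conjugate: bar rho = g rho g^-1. Then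
   sigma(g) g stabilizes rho, hence is central, so h |-> g^-1 sigma(h) g is an
   antiregular involution; it fixes rho, and its fixed points form a real form.

   That invariants separate disjoint closed orbits rests on linear reductivity.
   Embed G in SL_(n+1). Elements u of G with tr (u h) = tr h for all h in G form
   a connected unipotent normal subgroup, so triviality of the unipotent radical
   makes the trace form nondegenerate on the span n of the nilpotent elements of
   the Lie algebra, and n is perfect. To find an invariant linear form that does
   not vanish at a fixed vector l of a representation, split the latter along the
   endomorphisms that commute with G and kill l, until they are all nilpotent.
   In particular the Casimir operators are nilpotent, so the trace form of the
   representation vanishes on n, which acts trivially by the theorems of Cartan
   and Engel. Elements of the Lie algebra then act like their semisimple parts,
   by diagonalizable endomorphisms that commute with G and kill l, hence by 0. *)
From HB Require Import structures.
Require Import Defs.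
From mathcomp Require Import all_boot all_order all_algebra.
From mathcomp Require Import boolp classical_sets reals.
From mathcomp Require Import complex mpoly.
From mathcomp Require Import ring zify.

Set Implicit Arguments.
Unset Strict Implicit.
Unset Printing Implicit Defensive.

Import Order.TTheory GRing.Theory Num.Theory.
Local Open Scope ring_scope.

(** * Spectral idempotents *)

(** The Lie algebra is that of the left invariant derivations preserving the ideal of G.
    Connectedness enters on the way back from the Lie algebra to G: a function that vanishes at 1
    and has zero derivatives along G lies in every power of the maximal ideal at 1, modulo the ideal
    of G, hence vanishes near 1 by Krull's theorem. In the other direction the only exponentials are
    polynomial ones, so it is the nilpotent elements that carry the information on the unipotent
    radical. In SL the inverse is the adjugate, and polynomials in the entries suffice.

    The Casimir operators are built from the trace form of the embedding of G. The operator that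
    compares it with the trace form of the representation is nilpotent because its power sums
    vanish, which takes one Casimir operator for each power; self-adjointness then makes it zero.

    Each splitting keeps only the summand that contains l, since a linear form is wanted and not a
    complete decomposition. Finally, fixed points of an antiregular involution become real points
    once g and its twisted conjugate are placed in one block diagonal matrix. *)

Lemma poly_crt (K : fieldType) (rs : seq K) (N : nat) (phi : K -> K) :
  exists Q : {poly K}, forall a, a \in rs -> ('X - a%:P) ^+ N %| Q - (phi a)%:P.
Proof.
suff: exists Q : {poly K},
    forall a, a \in undup rs -> ('X - a%:P) ^+ N %| Q - (phi a)%:P.
  by case=> Q QP; exists Q => a ars; apply: QP; rewrite mem_undup.
elim: (undup rs) (undup_uniq rs) => [_|a s IH /= /andP[as_ us]]; first by exists 0.
have [Q QP] := IH us; pose M := \prod_(b <- s) ('X - b%:P) ^+ N.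
have : coprimep M (('X - a%:P) ^+ N).
  apply: coprimep_expr; rewrite /M; elim: s as_ {IH us QP} M => [|b s IH] as_ M.
    by rewrite big_nil coprime1p.
  rewrite big_cons coprimepMl; move: as_; rewrite inE negb_or => /andP[ab as_].
  rewrite IH // andbT; apply: coprimep_expl.
  by rewrite coprimep_XsubC root_XsubC.
case/Bezout_eq1_coprimepP => -[u v] /= uv.
exists (Q + u * M * ((phi a)%:P - Q)) => b; rewrite inE => /orP[/eqP ->|bs].
  have -> : Q + u * M * ((phi a)%:P - Q) - (phi a)%:P
     = (v * ('X - a%:P) ^+ N) * (Q - (phi a)%:P).
    have -> : u * M = 1 - v * ('X - a%:P) ^+ N by apply/eqP; rewrite eq_sym subr_eq uv.
    by rewrite mulrBl mul1r [_ * (Q - _)]mulrBr [_ * (_ - Q)]mulrBr; ring.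
  by rewrite -mulrA dvdp_mull // dvdp_mulr.
rewrite addrAC dvdp_add ?QP // -mulrA dvdp_mull // dvdp_mulr //.
by rewrite /M (big_rem b) //= dvdp_mulr.
Qed.

Section Spectral.
Variables (K : numClosedFieldType) (n : nat).
Implicit Types x y z : 'M[K]_n.+1.

Lemma idempotent_base (m : nat) (E : 'M[K]_m) :
  E *m E = E -> row_base E *m col_base E = 1%:M.
Proof.
move=> EE; have := EE; rewrite -[in X in X -> _](mulmx_base E) => e.
have e2 : row_base E *m (col_base E *m row_base E) = row_base E.
  apply: (row_full_inj (col_base_full E)); rewrite mulmxA.
  by rewrite -[RHS]e !mulmxA.
by apply: (row_free_inj (row_base_free E)); rewrite -mulmxA e2 mul1mx.
Qed.

Lemma idempotent_tr (m : nat) (E : 'M[K]_m) : E *m E = E -> \tr E = (\rank E)%:R.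
Proof.
move=> /idempotent_base E1.
by rewrite -[in LHS](mulmx_base E) mxtrace_mulC E1 mxtrace1.
Qed.

Lemma idempotent_tr0 (m : nat) (E : 'M[K]_m) : E *m E = E -> \tr E = 0 -> E = 0.
Proof.
by move=> /idempotent_tr-> /eqP; rewrite pnatr_eq0 mxrank_eq0 => /eqP.
Qed.

Lemma char_poly_nilpotent (m k : nat) (x : 'M[K]_m.+1) : x ^+ k = 0 -> char_poly x = 'X^(m.+1).
Proof.
move=> xk; have [r Er] := closed_field_poly_normal (char_poly x).
move: (Er); rewrite (monicP (char_poly_monic x)) scale1r => E.
suff rE : r = nseq m.+1 0.
  by rewrite E rE big_nseq subr0 iter_mulr_1.
have sr : size r = m.+1.
  by have := size_char_poly x; rewrite E size_prod_XsubC => -[].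
rewrite -sr; apply/all_pred1P/allP => a ar /=.
have : root (char_poly x) a by rewrite E root_prod_XsubC.
rewrite -eigenvalue_root_char => /eigenvalueP[v vx v0].
have vk j : v *m x ^+ j = a ^+ j *: v.
  elim: j => [|j IH]; first by rewrite expr0 mulmx1 scale1r.
  by rewrite exprSr mulmxA IH -scalemxAl vx scalerA exprSr.
have := vk k; rewrite xk mulmx0 => /esym/eqP.
by rewrite scaler_eq0 (negPf v0) orbF expf_eq0 => /andP[].
Qed.

Lemma nilpotent_tr0 (m k : nat) (x : 'M[K]_m) : x ^+ k = 0 -> \tr x = 0.
Proof.
case: m x => [|m] x xk; first by rewrite /mxtrace big_ord0.
have := char_poly_trace x (ltn0Sn m).
rewrite (char_poly_nilpotent xk) coefXn /= ltn_eqF // => /esym/eqP.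
by rewrite oppr_eq0 => /eqP.
Qed.

Lemma horner_mx_dvd x (p q : {poly K}) :
  p %| q -> horner_mx x p = 0 -> horner_mx x q = 0.
Proof. by case/dvdpP => r ->; rewrite rmorphM /= => ->; rewrite mulr0. Qed.

Lemma spectral_idempotents x :
  exists (rs : seq K) (P : K -> {poly K}),
    let E a := horner_mx x (P a) in
    [/\ uniq rs, 0 \in rs,
        forall N q, (forall a, a \in rs -> ('X - a%:P) ^+ (n.+1 + N) %| q) ->
          horner_mx x q = 0,
        forall a b, a \in rs -> b \in rs ->
          ('X - b%:P) ^+ n.+1 %| P a - (b == a)%:R%:P
      & \sum_(a <- rs) E a = 1].
Proof.
have [r Er] := closed_field_poly_normal (char_poly x).
rewrite (monicP (char_poly_monic x)) scale1r in Er.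
(* 0 is adjoined to the eigenvalues so that [P a] has no constant term when a <> 0. *)
pose rs := undup (0 :: r).
have [P PP] := boolp.choice (fun a => poly_crt rs n.+1 (fun b => (b == a)%:R)).
have H N q : (forall a, a \in rs -> ('X - a%:P) ^+ (n.+1 + N) %| q) ->
    horner_mx x q = 0.
  move=> dq; apply: (horner_mx_dvd (p := char_poly x)); last first.
    exact: Cayley_Hamilton.
  rewrite Er; have sr : (size r <= n.+1 + N)%N.
    have := size_char_poly x; rewrite Er size_prod_XsubC => -[->].
    exact: leq_addr.
  have : \prod_(a <- rs) ('X - a%:P) ^+ (n.+1 + N) %| q.
    move: (undup_uniq (0 :: r) : uniq rs) dq.
    elim: {PP} rs => [|a s IH /= /andP[as_ us] dq].
      by rewrite big_nil dvd1p.
    rewrite big_cons Gauss_dvdp.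
      by rewrite dq ?mem_head // IH // => b bs; rewrite dq // inE bs orbT.
    apply: coprimep_expl; elim: s as_ {IH us dq} => [|b s IH].
      by rewrite big_nil coprimep1.
    rewrite inE negb_or big_cons coprimepMr => /andP[ab as_]; rewrite IH // andbT.
    by apply: coprimep_expr; rewrite coprimep_XsubC root_XsubC eq_sym.
  apply: dvdp_trans.
  have -> : \prod_(z <- r) ('X - z%:P) =
      \prod_(z <- r) \prod_(a <- rs | a == z) ('X - a%:P).
    apply: eq_big_seq => z zr; rewrite -big_filter.
    rewrite (filter_pred1_uniq (undup_uniq _)) ?big_seq1 //.
    by rewrite mem_undup inE zr orbT.
  rewrite (exchange_big_dep predT) //=.
  elim: {PP dq} rs => [|a s IH]; first by rewrite !big_nil dvdpp.
  rewrite !big_cons; apply: dvdp_mul; last exact: IH.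
  rewrite big_const_seq iter_mulr_1 dvdp_exp2l //.
  exact: leq_trans (count_size _ _) sr.
exists rs, P; split => //.
- exact: undup_uniq.
- by rewrite mem_undup mem_head.
- by move=> a b _ brs; exact: PP.
rewrite -rmorph_sum -[RHS](rmorph1 (horner_mx x)) /=; apply/eqP.
rewrite -subr_eq0 -rmorphB /=; apply/eqP; apply: (H 0%N) => b brs; rewrite addn0.
rewrite (bigD1_seq b) ?undup_uniq //= addrAC.
have -> : 1 = (b == b)%:R%:P :> {poly K} by rewrite eqxx.
apply: dvdp_add; first exact: PP.
apply: (big_ind (fun p => _ %| p)) => [|p q|a ab]; first exact: dvdp0.
  exact: dvdp_add.
by have := PP a b brs; rewrite eq_sym (negPf ab) subr0.
Qed.

(** [E a] is the projection to the generalized eigenspace of a along the others; it is 0 if a is the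
    adjoined 0 and not an eigenvalue. The last clause makes the other projections combinations of
    positive powers of x. *)
Lemma spectralP x :
  exists (rs : seq K) (P : K -> {poly K}),
    let E a := horner_mx x (P a) in
    [/\ uniq rs, \sum_(a <- rs) E a = 1,
        forall a b, a \in rs -> b \in rs -> E a * E b = E a *+ (a == b),
        forall a, a \in rs -> (x - a%:M) ^+ n.+1 * E a = 0
      & forall a, a \in rs -> a != 0 -> (P a).[0] = 0].
Proof.
have [rs [P [urs rs0 H PP sE]]] := spectral_idempotents x.
exists rs, P; split => // [a b ars brs|a ars|a ars a0].
- rewrite -rmorphM -rmorphMn /=; apply/eqP; rewrite -subr_eq0 -rmorphB /=.
  apply/eqP; apply: (H 0%N) => c crs; rewrite addn0.
  have -> : P a * P b - P a *+ (a == b) =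
      (P a - (c == a)%:R%:P) * P b + (c == a)%:R%:P * (P b - (c == b)%:R%:P)
      - (P a - (c == a)%:R%:P) *+ (a == b).
    have e : (c == a)%:R%:P *+ (a == b) =
        (c == a)%:R%:P * (c == b)%:R%:P :> {poly K}.
      case: (c =P a) => [->|_]; last by rewrite !mul0r mul0rn.
      by rewrite mul1r; case: eqP.
    by rewrite mulrnBl e; ring.
  apply: dvdp_sub; last by rewrite -[X in _ %| X]mulr_natr dvdp_mulr ?PP.
  by apply: dvdp_add; [rewrite dvdp_mulr ?PP | rewrite dvdp_mull ?PP].
- have -> : (x - a%:M) ^+ n.+1 = horner_mx x (('X - a%:P) ^+ n.+1).
    by rewrite rmorphXn rmorphB /= horner_mx_X horner_mx_C.
  rewrite -rmorphM /=; apply: (H 0%N) => c crs; rewrite addn0.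
  case: (eqVneq c a) => [->|ca]; first exact: dvdp_mulr.
  by apply: dvdp_mull; have := PP a c ars crs; rewrite (negPf ca) subr0.
have := PP a 0 ars rs0; rewrite eq_sym (negPf a0) [P a - _]subr0.
have d : 'X - (0 : K)%:P %| ('X - (0 : K)%:P) ^+ n.+1 by rewrite exprS dvdp_mulr.
by move/(dvdp_trans d); rewrite dvdp_XsubCl => /eqP.
Qed.

(** For a <> 0, [P a] has no constant term, so the trace of [E a] is a combination of the given
    traces and vanishes. In characteristic 0 the idempotent [E a] is then 0. *)
Lemma tr0_nilpotent x : (forall j, \tr (x ^+ j.+1) = 0) -> x ^+ n.+1 = 0.
Proof.
move=> tr0; have [rs [P [_ sE EE xE P0]]] := spectralP x.
suff E0 a : a \in rs -> a != 0 -> horner_mx x (P a) = 0.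
  rewrite -[LHS]mulr1 -sE mulr_sumr big1_seq // => a /andP[_ ars].
  have [a0|a0] := eqVneq a 0; last by rewrite E0 // mulr0.
  by have := xE a ars; rewrite {1}a0 raddf0 subr0.
move=> ars a0; apply: idempotent_tr0.
  by have := EE a a ars ars; rewrite eqxx.
rewrite -[P a]coefK poly_def rmorph_sum /= raddf_sum big1 // => i _.
rewrite linearZ /= rmorphXn /= horner_mx_X linearZ /=.
case: i => -[|i] /= _; last by rewrite tr0 mulr0.
by rewrite -horner_coef0 P0 // mul0r.
Qed.
End Spectral.

(** * Cartan and Engel theorems for matrices *)

Definition lie (K : pzRingType) (m : nat) (x y : 'M[K]_m) := x *m y - y *m x.

Section LieBracket.
Variables (K : comPzRingType) (m : nat).
Implicit Types x y z : 'M[K]_m.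

Lemma lieDl x y z : lie (x + y) z = lie x z + lie y z.
Proof. by rewrite /lie mulmxDl mulmxDr opprD addrACA. Qed.

Lemma lieDr x y z : lie z (x + y) = lie z x + lie z y.
Proof. by rewrite /lie mulmxDl mulmxDr opprD addrACA. Qed.

Lemma lieZl a x y : lie (a *: x) y = a *: lie x y.
Proof. by rewrite /lie -scalemxAl -scalemxAr scalerBr. Qed.

Lemma lieZr a x y : lie x (a *: y) = a *: lie x y.
Proof. by rewrite /lie -scalemxAl -scalemxAr scalerBr. Qed.

Lemma liexx x : lie x x = 0. Proof. exact: subrr. Qed.

Lemma lieC x y : lie x y = - lie y x. Proof. by rewrite /lie opprB. Qed.
End LieBracket.

Section MatrixSpaces.
Variables (K : fieldType) (p n : nat) (A : 'M[K]_(p, n * n)).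
Implicit Types x y : 'M[K]_n.

Lemma memmxD x y : (x \in A)%MS -> (y \in A)%MS -> (x + y \in A)%MS.
Proof. by rewrite linearD; apply: addmx_sub. Qed.

Lemma memmxZ a x : (x \in A)%MS -> (a *: x \in A)%MS.
Proof. by rewrite linearZ; apply: scalemx_sub. Qed.

Lemma memmxN x : (x \in A)%MS -> (- x \in A)%MS.
Proof. by rewrite -scaleN1r; apply: memmxZ. Qed.

Lemma memmxB x y : (x \in A)%MS -> (y \in A)%MS -> (x - y \in A)%MS.
Proof. by move=> xA yA; apply/memmxD/memmxN. Qed.

Lemma memmx_sum (I : Type) (r : seq I) (P : pred I) (F : I -> 'M[K]_n) :
  (forall i, P i -> (F i \in A)%MS) -> (\sum_(i <- r | P i) F i \in A)%MS.
Proof. by move=> FA; rewrite linear_sum /=; apply: summx_sub. Qed.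
End MatrixSpaces.

Section AdjointAction.
Variables (K : numClosedFieldType) (n : nat).
Implicit Types x y z : 'M[K]_n.+1.
Local Notation N2 := (n.+1 * n.+1)%N.

Definition admx x : 'M[K]_N2 := lin_mulmx x - lin_mulmxr x.

Lemma mul_vec_admx x z : mxvec z *m admx x = mxvec (lie x z).
Proof. by rewrite mulmxBr !mul_vec_lin /= linearB. Qed.

Lemma lin_mulmx_scalar a : lin_mulmx (a%:M : 'M[K]_n.+1) = a%:M :> 'M_N2.
Proof.
apply/row_matrixP => i; rewrite !rowE mul_rV_lin /= mul_scalar_mx linearZ /=.
by rewrite vec_mxK mul_mx_scalar.
Qed.

Lemma lin_mulmxr_scalar a : lin_mulmxr (a%:M : 'M[K]_n.+1) = a%:M :> 'M_N2.
Proof.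
apply/row_matrixP => i; rewrite !rowE mul_rV_lin /= !mul_mx_scalar linearZ /=.
by rewrite vec_mxK.
Qed.

Lemma comm_lin_mulmx x y :
  GRing.comm (lin_mulmx x : 'M_N2) (lin_mulmxr y : 'M_N2).
Proof.
apply/row_matrixP => i; rewrite !rowE -[delta_mx _ _]vec_mxK -!mulmxE.
by rewrite !mulmxA !mul_vec_lin /= mulmxA.
Qed.

(** Left multiplication by x - a and right multiplication by x - b commute, and their difference is
    ad x - (a - b). Each term in the binomial expansion of its 2N-th power has an exponent at least
    N on one side. *)
Lemma admx_nilpotent x (a b : K) (N : nat) z :
  (x - a%:M) ^+ N * z = 0 -> z * (x - b%:M) ^+ N = 0 ->
  mxvec z *m (admx x - (a - b)%:M) ^+ (N + N) = 0.
Proof.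
move=> xz zx; pose L : 'M_N2 := lin_mulmx (x - a%:M).
pose R : 'M_N2 := lin_mulmxr (x - b%:M).
have -> : admx x - (a - b)%:M = L - R.
  rewrite /L /R !linearB /= lin_mulmx_scalar lin_mulmxr_scalar /admx raddfB /=.
  by rewrite [RHS]addrACA -opprD.
have LE i w : mxvec w *m L ^+ i = mxvec ((x - a%:M) ^+ i * w).
  elim: i w => [|i IH] w; first by rewrite !expr0 mulmx1 mul1r.
  by rewrite exprS mulmxA mul_vec_lin IH /= exprSr mulrA.
have RE i w : mxvec w *m R ^+ i = mxvec (w * (x - b%:M) ^+ i).
  elim: i w => [|i IH] w; first by rewrite !expr0 mulmx1 mulr1.
  by rewrite exprS mulmxA mul_vec_lin IH /= exprS -mulrA.
rewrite exprBn_comm; last exact: comm_lin_mulmx.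
rewrite mulmx_sumr big1 // => i _; rewrite -mulr_natr -!mulmxE !mulmxA.
have -> : mxvec z *m (-1) ^+ i = (-1) ^+ i *: mxvec z.
  elim: (nat_of_ord i) => [|j IH]; first by rewrite !expr0 mulmx1 scale1r.
  by rewrite !exprSr mulmxA IH mulmxN mulmx1 mulrN1 scaleNr.
rewrite -!scalemxAl LE RE.
have [iN|Ni] := leqP N i.
  have -> : (x - a%:M) ^+ (N + N - i) * z * (x - b%:M) ^+ i = 0.
    by rewrite -mulrA -(subnKC iN) exprD (mulrA z) zx mul0r mulr0.
  by rewrite linear0 mul0mx scaler0.
have -> : (x - a%:M) ^+ (N + N - i) * z = 0.
  have -> : (N + N - i = N - i + N)%N by rewrite addnC addnBA // ltnW.
  by rewrite exprD -mulrA xz mulr0.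
by rewrite mul0r linear0 mul0mx scaler0.
Qed.

Lemma horner_mx_geigen m (A : 'M[K]_m.+1) (v : 'rV_m.+1) mu c N (q : {poly K}) :
  v *m (A - mu%:M) ^+ N = 0 -> ('X - mu%:P) ^+ N %| q - c%:P ->
  v *m horner_mx A q = c *: v.
Proof.
move=> vA /dvdpP[r rE]; have -> : q = ('X - mu%:P) ^+ N * r + c%:P.
  by rewrite mulrC -rE subrK.
rewrite rmorphD rmorphM rmorphXn rmorphB /= horner_mx_X !horner_mx_C.
by rewrite mulmxDr mulmxA vA mul0mx add0r mul_mx_scalar.
Qed.

(* The matrix y is the complex conjugate of the semisimple part of x, so that
   tr (x y) is the sum of the squared moduli of the eigenvalues of x, while
   ad y is a polynomial without constant term in ad x. *)
Lemma conj_semisimple_part x :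
  exists y, (\tr (x *m y) = 0 -> x ^+ n.+1 = 0) /\
    exists (d : nat) (c : nat -> K), forall z,
      lie y z = \sum_(j < d) c j *: iter j.+1 (lie x) z.
Proof.
have [rs [P [urs sE EE xE P0]]] := spectralP x.
pose E a : 'M[K]_n.+1 := horner_mx x (P a).
pose y : 'M[K]_n.+1 := \sum_(a <- rs) a^* *: E a.
have xEc a : x * E a = E a * x.
  by rewrite /E; apply: comm_mx_horner.
have EyE a : a \in rs -> y * E a = a^* *: E a.
  move=> ars; rewrite /y mulr_suml (bigD1_seq a) //= -scalerAl EE // eqxx.
  rewrite big1_seq ?addr0 // => b /andP[ba brs].
  by rewrite -scalerAl EE // (negPf ba) scaler0.
have yEc a : E a * y = y * E a.
  rewrite /y mulr_sumr mulr_suml; apply: eq_bigr => b _.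
  by rewrite -scalerAl -scalerAr; congr (_ *: _); apply: comm_horner_mx2.
exists y; split.
  have trE a : a \in rs -> \tr (x * (a^* *: E a)) = `|a| ^+ 2 * (\rank (E a))%:R.
    move=> ars; have Ei : E a *m E a = E a by have := EE a a ars ars; rewrite eqxx.
    rewrite -scalerAr linearZ /= -(subrK a%:M x) mulrDl raddfD /= [a%:M * _]mul_scalar_mx.
    rewrite linearZ /= (idempotent_tr Ei) (@nilpotent_tr0 _ _ n.+1) ?add0r.
      by rewrite normCK mulrCA mulrA.
    rewrite exprMn_comm; last by apply: comm_mx_horner; rewrite /comm_mx mulmxBl mulmxBr mul_mx_scalar mul_scalar_mx.
    by rewrite [E a ^+ _]exprS mulrA (xE a ars) mul0r.
  rewrite mulmxE /y mulr_sumr raddf_sum /= (eq_big_seq _ trE) => /eqP.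
  rewrite psumr_eq0 => [/allP h|a _]; last by rewrite mulr_ge0 ?exprn_ge0 ?ler0n.
  rewrite -[LHS]mulr1 -sE mulr_sumr big1_seq // => a /andP[_ ars].
  have [a0|a0] := eqVneq a 0; first by have := xE a ars; rewrite {1}a0 raddf0 subr0.
  have := h a ars; rewrite /= mulf_eq0 expf_eq0 normr_eq0 (negPf a0) /=.
  by rewrite pnatr_eq0 mxrank_eq0 => /eqP; rewrite /E => ->; rewrite mulr0.
(* Q interpolates complex conjugation at the eigenvalues a - b of ad x, to the order of nilpotency
   given by [admx_nilpotent]. Adjoining 0 forces Q(0) = 0, as the value 0 is prescribed there. *)
pose rs2 := 0 :: [seq a - b | a <- rs, b <- rs].
have [Q QP] := poly_crt rs2 (n.+1 + n.+1) (@Num.conj K).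
have QX : 'X %| Q.
  have := QP 0 (mem_head _ _); rewrite !rmorph0 !subr0.
  by apply: dvdp_trans; rewrite addnS exprS dvdp_mulr.
have [Q' Q'E] := dvdpP _ _ QX.
exists (size Q'), (fun j => Q'`_j) => z.
have iterE j w : mxvec w *m admx x ^+ j = mxvec (iter j (lie x) w).
  elim: j w => [|j IH] w; first by rewrite expr0 mulmx1.
  by rewrite exprS mulmxA mul_vec_admx IH -iterSr.
have -> : \sum_(j < size Q') Q'`_j *: iter j.+1 (lie x) z =
    vec_mx (mxvec z *m (horner_mx (admx x) Q : 'M_N2)).
  rewrite Q'E -[in RHS](coefK Q') poly_def mulr_suml rmorph_sum mulmx_sumr.
  rewrite !linear_sum /=; apply: eq_bigr => j _.
  rewrite -scalerAl linearZ /= -exprSr rmorphXn /= horner_mx_X -scalemxAr.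
  by rewrite iterE linearZ /= mxvecK.
have zE : z = \sum_(a <- rs) \sum_(b <- rs) E a * z * E b.
  rewrite -[LHS]mul1r -[LHS]mulr1 -[in LHS]sE !mulr_suml.
  by apply: eq_bigr => a _; rewrite mulr_sumr.
have lieD u : lie y (\sum_(a <- rs) u a) = \sum_(a <- rs) lie y (u a).
  by rewrite /lie mulmx_sumr mulmx_suml sumrB.
rewrite zE lieD !linear_sum mulmx_suml linear_sum /=.
apply: eq_big_seq => a ars; rewrite lieD !linear_sum mulmx_suml linear_sum /=.
apply: eq_big_seq => b brs.
have h1 : (x - a%:M) ^+ n.+1 *m (E a *m z *m E b) = 0.
  have h : (x - a%:M) ^+ n.+1 *m E a = 0 := xE a ars.
  by rewrite !mulmxA h !mul0mx.
have h2 : (E a *m z *m E b) *m (x - b%:M) ^+ n.+1 = 0.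
  have cb : GRing.comm (E b) ((x - b%:M) ^+ n.+1).
    apply: commrX; rewrite /GRing.comm mulrBr mulrBl -xEc; congr (_ - _).
    by rewrite -!mulmxE mul_mx_scalar mul_scalar_mx.
  have h : E b *m (x - b%:M) ^+ n.+1 = 0 := etrans cb (xE b brs).
  by rewrite -mulmxA h mulmx0.
have q : ('X - (a - b)%:P) ^+ (n.+1 + n.+1) %| Q - ((a - b)^*)%:P.
  by apply: QP; rewrite inE; apply/orP; right; apply/allpairsP; exists (a, b).
rewrite (horner_mx_geigen (admx_nilpotent h1 h2) q).
rewrite linearZ /= mxvecK rmorphB scalerBl /lie; congr (_ - _).
  have e : y *m E a = a^* *: E a := EyE a ars.
  have -> : y *m (E a *m z *m E b) = a^* *: (E a *m z *m E b) => //.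
  by rewrite !mulmxA e -!scalemxAl.
have e : E b *m y = b^* *: E b := etrans (yEc b) (EyE b brs).
have -> : E a *m z *m E b *m y = b^* *: (E a *m z *m E b) => //.
by rewrite -mulmxA e scalemxAr.
Qed.
End AdjointAction.

(** A free family of maximal size is chosen among the vectors that satisfy P: the span is described
    by elements that keep the property, even when P is not linear. *)
Lemma basis_from_predicate (K : fieldType) N (P : 'rV[K]_N -> Prop) :
  exists r (B : 'M[K]_(r, N)),
    [/\ row_free B, forall i, P (row i B) & forall v, P v -> (v <= B)%MS].
Proof.
pose Q r := `[< exists B : 'M[K]_(r, N), row_free B /\ forall i, P (row i B) >].
have Q0 : exists r, Q r.
  exists 0; apply/asboolP; exists 0; split; last by case.
  by rewrite /row_free mxrank0.
have Qb r : Q r -> (r <= N)%N.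
  by move=> /asboolP[B [/eqP fB _]]; rewrite -[X in (X <= _)%N]fB rank_leq_col.
case: (ex_maxnP Q0 Qb) => r /asboolP[B [fB PB]] maxr; exists r, B; split => // v Pv.
apply: contraT => nvB; have : Q r.+1.
  apply/asboolP; exists (col_mx v B : 'M_(1 + r, N)); split.
    have e : \rank (v + B)%MS = \rank (col_mx v B) by rewrite addsmxE.
    rewrite /row_free eqn_leq rank_leq_row /= -e.
    have v0 : \rank v = 1%N.
      by rewrite rank_rV; case: eqP nvB => // ->; rewrite sub0mx.
    have : mxrank (v :&: B)%MS = 0%N.
      apply/eqP; rewrite mxrank_eq0 -submx0; apply: contraR nvB => cap.
      have : (\rank (v :&: B)%MS == \rank v)%N.
        rewrite eqn_leq mxrankS ?capmxSl //= v0 lt0n mxrank_eq0.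
        by rewrite -submx0.
      case: (mxrank_leqif_sup (capmxSl v B)) => _ -> vc.
      exact: submx_trans vc (capmxSr _ _).
    have := mxrank_sum_cap v B => + c0; rewrite c0 addn0 => ->.
    by rewrite v0 (eqP fB).
  move=> i; rewrite -(@splitK 1 r i); case: (@fintype.split 1 r i) => j /=.
    by rewrite (ord1 j) (@rowKu _ 1 r) row_id.
  by rewrite (@rowKd _ 1 r).
by move/maxr; rewrite ltnn.
Qed.

Section Engel.
Variables (K : numClosedFieldType) (n : nat).
Implicit Types x y z : 'M[K]_n.+1.
Local Notation N2 := (n.+1 * n.+1)%N.

(** With y attached to x by [conj_semisimple_part], tr ([a, b] y) = - tr (a [y, b]). As [y, b] is a
    polynomial without constant term in ad x applied to b, it stays in A, and the isotropy of A
    gives tr (x y) = 0. *)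
Lemma cartan_nilpotent p (A : 'M[K]_(p, N2)) :
  (forall x y, (x \in A)%MS -> (y \in A)%MS -> (lie x y \in A)%MS) ->
  (forall x y, (x \in A)%MS -> (y \in A)%MS -> \tr (x *m y) = 0) ->
  forall r (a b : 'I_r -> 'M_n.+1),
    (forall i, a i \in A)%MS -> (forall i, b i \in A)%MS ->
  (\sum_i lie (a i) (b i)) ^+ n.+1 = 0.
Proof.
move=> lieA trA r a b aA bA; set x := \sum_i _.
have xA : (x \in A)%MS.
  by rewrite /x linear_sum /=; apply: summx_sub => i _; apply: lieA.
have [y [nil_y [d [c ad_y]]]] := conj_semisimple_part x; apply: nil_y.
rewrite /x mulmx_suml raddf_sum big1 // => i _ /=.
have -> : \tr (lie (a i) (b i) *m y) = - \tr (a i *m lie y (b i)).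
  rewrite /lie mulmxBl mulmxBr !(raddfB (@mxtrace K n.+1)) /= opprB; congr (_ - _).
    by rewrite mulmxA.
  by rewrite -mulmxA mxtrace_mulC mulmxA.
rewrite trA ?oppr0 // ad_y linear_sum /=; apply: summx_sub => j _.
rewrite linearZ /=; apply: scalemx_sub.
elim: (nat_of_ord j) => [|k IH]; first exact: (lieA _ _ xA (bA i)).
by rewrite iterS; exact: (lieA _ _ xA IH).
Qed.

(** The space F^j M of products of j elements of F with arbitrary matrices. Its vanishing says that
    all products of j elements of F are 0, which is the conclusion of Engel's theorem in terms of
    products. *)
Fixpoint left_chain p (F : 'M[K]_(p, N2)) (j : nat) : 'M[K]_N2 :=
  if j is j'.+1 then (F * left_chain F j')%MS else 1%:M.

Lemma left_chain_prod p (F : 'M[K]_(p, N2)) (l : seq 'M[K]_n.+1) z :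
  (forall f, f \in l -> (f \in F)%MS) ->
  ((\prod_(f <- l) f) *m z \in left_chain F (size l))%MS.
Proof.
elim: l => [|f l IH] lF; first by rewrite big_nil submx1.
rewrite big_cons -mulmxE -mulmxA; apply: mem_mulsmx; first by apply: lF; exact: mem_head.
by apply: IH => g gl; apply: lF; rewrite inE gl orbT.
Qed.

Lemma left_chain0_prod p (F : 'M[K]_(p, N2)) N (l : seq 'M[K]_n.+1) :
  left_chain F N = 0 -> (forall f, f \in l -> (f \in F)%MS) -> (N <= size l)%N ->
  \prod_(f <- l) f = 0.
Proof.
move=> F0 lF Nl; rewrite -(cat_take_drop N l) big_cat /=.
have lF' f : f \in take N l -> (f \in F)%MS by move/mem_take; exact: lF.
have := left_chain_prod 1%:M lF'; rewrite size_takel // F0 mulmx1 => /memmx0 ->.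
by rewrite mul0r.
Qed.

Lemma left_chain_stable p (F : 'M[K]_(p, N2)) x j :
  (forall f, (f \in F)%MS -> (lie x f \in F)%MS) ->
  forall z, (z \in left_chain F j)%MS -> (x *m z \in left_chain F j)%MS.
Proof.
move=> xF; elim: j => [|j IH] z /=; first by rewrite !submx1.
case/mulsmxP=> f fF [g gF ->]; rewrite mulmx_sumr linear_sum /=.
apply: summx_sub => k _; have -> : x *m (f k *m g k) = f k *m (x *m g k) + lie x (f k) *m g k.
  by rewrite /lie mulmxBl !mulmxA addrC subrK.
by rewrite linearD; apply: addmx_sub; apply: mem_mulsmx; rewrite ?fF ?gF ?IH ?xF.
Qed.

(* A maximal associatively nilpotent subalgebra F is all of A: otherwise some
   iterated bracket x of an element of A with elements of F normalizes F
   without belonging to it, and F + <x> is again nilpotent. *)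
Lemma engel p (A : 'M[K]_(p, N2)) :
  (forall x y, (x \in A)%MS -> (y \in A)%MS -> (lie x y \in A)%MS) ->
  (forall x, (x \in A)%MS -> x ^+ n.+1 = 0) ->
  exists N, left_chain A N = 0.
Proof.
move=> lieA nilA.
pose good (F : 'M[K]_N2) := [/\ (F <= A)%MS,
  forall x y, (x \in F)%MS -> (y \in F)%MS -> (lie x y \in F)%MS
  & exists N, left_chain F N = 0].
pose Q r := `[< exists F, good F /\ \rank F = r >].
have Q0 : exists r, Q r.
  exists 0%N; apply/asboolP; exists 0; split; last exact: mxrank0.
  split; first exact: sub0mx.
    by move=> x y /memmx0 -> _; rewrite /lie mul0mx mulmx0 subrr linear0 sub0mx.
  by exists 1%N; rewrite /= muls0mx.
have Qb r : Q r -> (r <= N2)%N.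
  by move=> /asboolP[F [_ <-]]; exact: rank_leq_col.
case: (ex_maxnP Q0 Qb) => r /asboolP[F [[FA lieF [N F0]] rF]] maxr.
have [AF|nAF] := boolP (A <= F)%MS.
  exists N; apply/eqP; rewrite -submx0 -F0.
  elim: N {F0} => [|N IH] /=; first exact: submx_refl.
  exact: mulsmxS.
have [y yA nyF] : exists2 y, (y \in A)%MS & ~~ (y \in F)%MS.
  have [i nF] : exists i, ~~ (row i A <= F)%MS by apply/row_subPn.
  by exists (vec_mx (row i A)); rewrite vec_mxK ?row_sub.
have nilF (l : seq 'M_n.+1) : (forall f, f \in l -> (f \in F)%MS) ->
    (N <= size l)%N -> \prod_(f <- l) f = 0 by exact: left_chain0_prod.
have [x [xA nxF xF]] : exists x, [/\ (x \in A)%MS, ~~ (x \in F)%MS &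
    forall f, (f \in F)%MS -> (lie f x \in F)%MS].
  (* [Z k z] holds for k-fold brackets z of y with elements of F: in the expansion of such a
     bracket, 2N factors from F, counting those inside z, leave at least N on one side of y. Hence z
     = 0 once k reaches 2N. *)
  pose Z k z := forall l1 l2 : seq 'M_n.+1,
    (forall f, f \in l1 -> (f \in F)%MS) -> (forall f, f \in l2 -> (f \in F)%MS) ->
    (N + N <= size l1 + size l2 + k)%N ->
    (\prod_(f <- l1) f) * z * (\prod_(f <- l2) f) = 0.
  have Z0 : Z 0%N y.
    move=> l1 l2 l1F l2F; rewrite addn0 => Nl.
    have [h|h] := leqP N (size l1); first by rewrite nilF // !mul0r.
    rewrite (nilF l2) ?mulr0 //; rewrite leqNgt; apply: contraL Nl => h2.
    by rewrite -ltnNge -addnS leq_add // ltnW.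
  have ZS k z f : Z k z -> (f \in F)%MS -> Z k.+1 (lie f z).
    move=> Zz fF l1 l2 l1F l2F Nl; rewrite /lie !mulmxE mulrBr mulrBl.
    have -> : \prod_(f <- l1) f * (f * z) * \prod_(f <- l2) f =
        \prod_(f <- rcons l1 f) f * z * \prod_(f <- l2) f.
      by rewrite -cats1 big_cat big_seq1 /= !mulrA.
    have -> : \prod_(f <- l1) f * (z * f) * \prod_(f <- l2) f =
        \prod_(f <- l1) f * z * \prod_(f <- f :: l2) f.
      by rewrite big_cons /= !mulrA.
    rewrite (Zz (rcons l1 f) l2) ?(Zz l1 (f :: l2)) ?subrr //.
    + by move=> g; rewrite inE => /orP[/eqP->|/l2F].
    + by rewrite /= addnS addSn -addnS.
    + by move=> g; rewrite mem_rcons inE => /orP[/eqP->|/l1F].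
    + by rewrite size_rcons !addSn -addnS.
  have : forall k, (forall z, (z \in A)%MS -> Z (N + N - k)%N z -> ~~ (z \in F)%MS ->
      exists x, [/\ (x \in A)%MS, ~~ (x \in F)%MS &
      forall f, (f \in F)%MS -> (lie f x \in F)%MS]).
    elim=> [|k IH] z zA Zz nzF.
      have := Zz [::] [::]; rewrite subn0 !big_nil mulr1 mul1r /= => z0.
      by move: nzF; rewrite z0 // linear0 sub0mx.
    have [nrm|/existsNP[f /not_implyP[fF /negP nf]]] :=
        pselect (forall f, (f \in F)%MS -> (lie f z \in F)%MS).
      by exists z.
    apply: (IH (lie f z)) nf; first by apply: lieA => //; apply: memmx_subP fF.
    have [kN|Nk] := ltnP k (N + N).
      by have := ZS _ _ _ Zz fF; rewrite -subSn // subSS.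
    move=> l1 l2 l1F l2F h; have := ZS _ _ _ Zz fF l1 l2 l1F l2F; apply.
    have k0 : (N + N - k = 0)%N by apply/eqP; rewrite subn_eq0.
    by rewrite (leq_trans h) // leq_add2l k0.
  move/(_ (N + N)%N y yA); rewrite subnn; exact.
have xF' f : (f \in F)%MS -> (lie x f \in F)%MS.
  by move=> /xF h; rewrite /lie -opprB linearN /= eqmx_opp.
pose F' := (F + mxvec x)%MS.
have F'P w : (w \in F')%MS -> exists2 f, (f \in F)%MS & exists c, w = f + c *: x.
  case/memmx_addsP => -[f g] /= [fF /sub_rVP[c gc] ->]; exists f => //; exists c.
  by congr (_ + _); apply: (can_inj mxvecK); rewrite gc linearZ.
have F'F w j : (w \in F')%MS -> forall z, (z \in left_chain F j)%MS ->
    (w *m z \in left_chain F j)%MS.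
  case/F'P => f fF [c ->] z zj; rewrite mulmxDl linearD /= -scalemxAl linearZ /=.
  apply: addmx_sub; last by apply: scalemx_sub; apply: left_chain_stable.
  by apply: left_chain_stable => // g gF; apply: lieF.
(* [V k] is F^(j+1) M + x^k F^j M. A factor of F + <x> carries [V k] into [V k.+1], because x
   normalizes F and so preserves both chains. Since x^(n+1) = 0, every n+1 factors of F + <x> gain
   one factor of F. *)
have step M0 j : (left_chain F' M0 <= left_chain F j)%MS ->
    (left_chain F' (n.+1 + M0) <= left_chain F j.+1)%MS.
  move=> h0; pose V k := (left_chain F j.+1 + left_chain F j *m lin_mulmx (x ^+ k))%MS.
  suff h : forall k, (left_chain F' (k + M0) <= V k)%MS.
    apply: (submx_trans (h n.+1)); rewrite /V nilA // linear0 mulmx0.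
    by rewrite addsmx_sub submx_refl sub0mx.
  have linE : forall k z, (z \in left_chain F j *m lin_mulmx (x ^+ k))%MS ->
      exists2 v, (v \in left_chain F j)%MS & z = x ^+ k *m v.
    move=> k z; case/submxP => u zE; exists (vec_mx (u *m left_chain F j)).
      by rewrite vec_mxK submxMl.
    apply: (can_inj mxvecK); rewrite zE mulmxA -[u *m _]vec_mxK mul_vec_lin /=.
    by rewrite vec_mxK.
  elim=> [|k IH] /=.
    apply: submx_trans h0 _; rewrite /V expr0.
    apply: submx_trans _ (addsmxSr _ _).
    have -> : lin_mulmx (1 : 'M[K]_n.+1) = 1%:M :> 'M_N2 by exact: lin_mulmx_scalar.
    by rewrite mulmx1.
  apply/mulsmx_subP => w z wF' /(submx_trans)/(_ IH) /memmx_addsP[[u v] /= [uj]].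
  case/linE => v' v'j -> ->; rewrite mulmxDr linearD; apply: addmx_sub.
    by apply: submx_trans (addsmxSl _ _); apply: F'F.
  have xk : (x ^+ k *m v' \in left_chain F j)%MS.
    elim: (k) => [|i IHi]; first by rewrite expr0 mul1mx.
    by rewrite exprS -mulmxE -mulmxA; apply: left_chain_stable.
  case: (F'P _ wF') => f fF [c ->]; rewrite mulmxDl linearD; apply: addmx_sub.
    by apply: submx_trans (addsmxSl _ _); apply: mem_mulsmx.
  rewrite -scalemxAl linearZ; apply: scalemx_sub.
  apply: submx_trans (addsmxSr _ _).
  rewrite mulmxA mulmxE -exprS.
  by have := submxMr (lin_mulmx (x ^+ k.+1)) v'j; rewrite mul_vec_lin.
have : Q (\rank F').
  apply/asboolP; exists F'; split => //; split.
  - by rewrite addsmx_sub FA.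
  - move=> w z /F'P[f fF [c ->]] /F'P[g gF [d ->]].
    rewrite lieDl !lieDr !lieZl !lieZr liexx !scaler0 addr0.
    apply: submx_trans (addsmxSl _ _).
    by apply: memmxD; [apply: memmxD; [exact: lieF|apply/memmxZ/xF]|apply/memmxZ/xF'].
  exists (n.+1 * N)%N; apply/eqP; rewrite -submx0 -F0.
  elim: (N) => [|j IH]; first by rewrite [X in left_chain _ X]muln0 submx_refl.
  by rewrite [X in left_chain _ X]mulnS; apply: step.
move/maxr; rewrite -rF leqNgt => /negP[].
have := mxrank_leqif_sup (addsmxSl F (mxvec x)); case => le_r eq_r.
rewrite ltn_neqAle le_r andbT eq_r addsmx_sub submx_refl /=; exact: nxF.
Qed.
End Engel.

(** * Invariant vector fields and the Lie algebra of a matrix group *)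

Lemma mpoly_ring_ind (R : comNzRingType) (n : nat) (P : {mpoly R[n]} -> Prop) :
  (forall c, P c%:MP) -> (forall i, P 'X_i) ->
  (forall p q, P p -> P q -> P (p + q)) -> (forall p q, P p -> P q -> P (p * q)) ->
  forall p, P p.
Proof.
move=> PC PX PD PM p; rewrite (mpolyE p).
have P0 : P 0 by rewrite -mpolyC0.
elim: (msupp p) => [|u s IH]; first by rewrite big_nil.
rewrite big_cons; apply: (PD) => //; rewrite -mul_mpolyC; apply: (PM) => //.
rewrite mpolyXE_id; apply: (big_ind P) => [|p' q' Pp Pq|i _]; [by rewrite -mpolyC1|exact: PM|].
by elim: (u i) => [|j IHj]; rewrite ?expr0 -?mpolyC1 // exprS; apply: PM.
Qed.

Section GenericMatrix.
Variables (K : fieldType) (m' : nat).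
Local Notation m := m'.+1.
Local Notation MP := {mpoly K[m * m]}.
Implicit Types (p q : MP) (X Y g h : 'M[K]_m).

Definition genmx_var : 'M[MP]_m := \matrix_(i, j) 'X_(mxvec_index i j).
Local Notation Gx := genmx_var.
Definition cmx X : 'M[MP]_m := map_mx (@mpolyC _ K) X.
Definition ev g p : K := p.@[mxvec g 0].
HB.instance Definition _ g := GRing.RMorphism.copy (ev g) (@meval _ K (mxvec g 0)).

Lemma mpoly_entry_ind (P : MP -> Prop) :
  (forall c, P c%:MP) -> (forall i j, P (Gx i j)) ->
  (forall p q, P p -> P q -> P (p + q)) -> (forall p q, P p -> P q -> P (p * q)) ->
  forall p, P p.
Proof.
move=> PC PX PD PM; apply: mpoly_ring_ind => // k.
by case/mxvec_indexP: k => i j; have := PX i j; rewrite mxE.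
Qed.

Lemma evD g : {morph ev g : p q / p + q}. Proof. exact: mevalD. Qed.
Lemma evB g : {morph ev g : p q / p - q}. Proof. exact: mevalB. Qed.
Lemma evM g : {morph ev g : p q / p * q}. Proof. exact: mevalM. Qed.
Lemma evC g c : ev g c%:MP = c. Proof. exact: mevalC. Qed.
Lemma ev0 g : ev g 0 = 0. Proof. exact: meval0. Qed.
Lemma evZ g c p : ev g (c *: p) = c * ev g p. Proof. exact: mevalZ. Qed.
Lemma ev_sum g (I : Type) (r : seq I) (Q : pred I) (F : I -> MP) :
  ev g (\sum_(i <- r | Q i) F i) = \sum_(i <- r | Q i) ev g (F i).
Proof. by rewrite /ev raddf_sum. Qed.
Lemma evX g i j : ev g (Gx i j) = g i j.
Proof. by rewrite /ev mxE mevalXU mxvecE. Qed.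
Lemma ev_mul (a b c : nat) g (A : 'M[MP]_(a, b)) (B : 'M[MP]_(b, c)) :
  map_mx (ev g) (A *m B) = map_mx (ev g) A *m map_mx (ev g) B.
Proof.
apply/matrixP => i j; rewrite !mxE ev_sum; apply: eq_bigr => l _.
by rewrite evM !mxE.
Qed.
Lemma ev_cmx g X : map_mx (ev g) (cmx X) = X.
Proof. by apply/matrixP => i j; rewrite !mxE evC. Qed.
Lemma ev_Gx g : map_mx (ev g) Gx = g.
Proof. by apply/matrixP => i j; rewrite mxE evX. Qed.
Lemma cmxM X Y : cmx (X *m Y) = cmx X *m cmx Y.
Proof. exact: map_mxM. Qed.

Lemma cmxE X i j : cmx X i j = (X i j)%:MP. Proof. by rewrite mxE. Qed.
Lemma GxE i j : Gx i j = 'X_(mxvec_index i j). Proof. by rewrite mxE. Qed.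
Lemma cmx1 : cmx 1%:M = 1%:M. Proof. exact: map_mx1. Qed.

(* The left invariant vector field with value X at the identity. *)
Definition der X p : MP := \sum_k p^`M(k) * (mxvec (Gx *m cmx X)) 0 k.

Fact der_linear X : linear (der X).
Proof.
move=> a p q; rewrite /der scaler_sumr -big_split /=; apply: eq_bigr => k _.
by rewrite mderivD mderivZ mulrDl -scalerAl.
Qed.
HB.instance Definition _ X :=
  GRing.isLinear.Build K MP MP _ (der X) (der_linear X).

Lemma derD X : {morph der X : p q / p + q}. Proof. exact: linearD. Qed.

Lemma derC X c : der X c%:MP = 0.
Proof. by rewrite /der big1 // => k _; rewrite mderivC mul0r. Qed.

Lemma derM X p q : der X (p * q) = der X p * q + p * der X q.
Proof.
rewrite /der mulr_suml mulr_sumr -big_split /=; apply: eq_bigr => k _.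
by rewrite mderivM; ring.
Qed.

Lemma mderivXU (n : nat) (i j : 'I_n) : ('X_i)^`M(j) = (i == j)%:R :> {mpoly K[n]}.
Proof.
rewrite mderivX mnm1E; case: eqP => [->|_]; last by rewrite scale0r.
by rewrite -[X in (X - _)%MM]add0m addmK mpolyX0 scale1r.
Qed.

Lemma derGx X i j : der X (Gx i j) = (Gx *m cmx X) i j.
Proof.
rewrite /der mxE (bigD1 (mxvec_index i j)) //= mderivXU eqxx mul1r mxvecE.
by rewrite big1 ?addr0 // => k ki; rewrite mderivXU eq_sym (negPf ki) mul0r.
Qed.

Lemma der_mul X (a b c : nat) (A : 'M[MP]_(a, b)) (B : 'M[MP]_(b, c)) :
  map_mx (der X) (A *m B) = map_mx (der X) A *m B + A *m map_mx (der X) B.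
Proof.
apply/matrixP => i j; rewrite !mxE linear_sum /= -big_split /=.
by apply: eq_bigr => l _; rewrite derM !mxE.
Qed.
Lemma der_cmx X Y : map_mx (der X) (cmx Y) = 0.
Proof. by apply/matrixP => i j; rewrite !mxE derC. Qed.
Lemma der_Gx X : map_mx (der X) Gx = Gx *m cmx X.
Proof. by apply/matrixP => i j; rewrite mxE derGx. Qed.

Lemma der_is_additive p X Y : der (X + Y) p = der X p + der Y p.
Proof.
rewrite /der -big_split /=; apply: eq_bigr => k _.
by rewrite -mulrDr /cmx map_mxD mulmxDr linearD /= mxE.
Qed.

Lemma der_scale p a X : der (a *: X) p = a *: der X p.
Proof.
rewrite /der scaler_sumr; apply: eq_bigr => k _.
by rewrite /cmx map_mxZ -scalemxAr linearZ /= mxE mul_mpolyC scalerAr.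
Qed.

Lemma der_lie X Y p : der X (der Y p) - der Y (der X p) = der (lie X Y) p.
Proof.
elim/mpoly_entry_ind: p => [c|i j|p q IHp IHq|p q IHp IHq].
- by rewrite !derC !linear0 addr0.
- have e Z W : der Z (der W (Gx i j)) = (Gx *m cmx (Z *m W)) i j.
    have := der_mul Z Gx (cmx W); rewrite der_cmx mulmx0 addr0 der_Gx -mulmxA -cmxM.
    by move/matrixP => /(_ i j); rewrite [LHS]mxE -(derGx W).
  by rewrite !e derGx /lie /cmx map_mxB mulmxBr [RHS]mxE [X in _ = _ + X]mxE.
- have dD Z W : der Z (der W (p + q)) = der Z (der W p) + der Z (der W q).
    by rewrite -(derD Z); congr (der Z _); exact: derD.
  apply: (etrans (congr2 (fun a b => a - b) (dD X Y) (dD Y X))).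
  apply: (etrans _ (esym (derD (lie X Y) p q))).
  move: IHp IHq; move: (der X (der Y p)) (der Y (der X p)) (der X (der Y q)) (der Y (der X q)).
  move: (der (lie X Y) p) (der (lie X Y) q) => a b c d e f <- <-.
  by rewrite opprD addrACA.
rewrite !derM !derD !derM -IHp -IHq.
move: (der X (der Y p)) (der Y (der X p)) (der X (der Y q)) (der Y (der X q)).
move: (der X p) (der Y p) (der X q) (der Y q) => a b c d e f g h.
rewrite !mulrBl !mulrBr; ring.
Qed.

Definition ltr h p : MP := p \mPo [tuple (mxvec (cmx h *m Gx)) 0 k | k < m * m].
Definition rtr h p : MP := p \mPo [tuple (mxvec (Gx *m cmx h)) 0 k | k < m * m].

Lemma ev_ltr g h p : ev g (ltr h p) = ev (h *m g) p.
Proof.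
rewrite /ev comp_mpoly_meval; apply: meval_eq => k; rewrite tnth_mktuple.
case/mxvec_indexP: k => i j; rewrite !mxvecE.
have := ev_mul g (cmx h) Gx; rewrite ev_cmx ev_Gx.
by move/matrixP => /(_ i j) <-; rewrite [RHS]mxE.
Qed.

Lemma ev_rtr g h p : ev g (rtr h p) = ev (g *m h) p.
Proof.
rewrite /ev comp_mpoly_meval; apply: meval_eq => k; rewrite tnth_mktuple.
case/mxvec_indexP: k => i j; rewrite !mxvecE.
have := ev_mul g Gx (cmx h); rewrite ev_cmx ev_Gx.
by move/matrixP => /(_ i j) <-; rewrite [RHS]mxE.
Qed.

Lemma ltrM h : {morph ltr h : p q / p * q}. Proof. exact: rmorphM. Qed.
Lemma rtrM h : {morph rtr h : p q / p * q}. Proof. exact: rmorphM. Qed.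
Lemma ltrD h : {morph ltr h : p q / p + q}. Proof. exact: raddfD. Qed.
Lemma rtrD h : {morph rtr h : p q / p + q}. Proof. exact: raddfD. Qed.
Lemma ltrC h c : ltr h c%:MP = c%:MP. Proof. exact: comp_mpolyC. Qed.
Lemma rtrC h c : rtr h c%:MP = c%:MP. Proof. exact: comp_mpolyC. Qed.
Lemma ltr0 h : ltr h 0 = 0. Proof. exact: raddf0. Qed.
Lemma rtr0 h : rtr h 0 = 0. Proof. exact: raddf0. Qed.
Lemma ltr_Gx h : map_mx (ltr h) Gx = cmx h *m Gx.
Proof.
apply/matrixP => i j; rewrite mxE /ltr mxE comp_mpolyXU.
by rewrite -tnth_nth tnth_mktuple mxvecE.
Qed.
Lemma rtr_Gx h : map_mx (rtr h) Gx = Gx *m cmx h.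
Proof.
apply/matrixP => i j; rewrite mxE /rtr mxE comp_mpolyXU.
by rewrite -tnth_nth tnth_mktuple mxvecE.
Qed.
Lemma ltr_mul h (a b c : nat) (A : 'M[MP]_(a, b)) (B : 'M[MP]_(b, c)) :
  map_mx (ltr h) (A *m B) = map_mx (ltr h) A *m map_mx (ltr h) B.
Proof.
apply/matrixP => i j; rewrite !mxE /ltr raddf_sum; apply: eq_bigr => l _.
by rewrite !mxE; exact: rmorphM.
Qed.
Lemma rtr_mul h (a b c : nat) (A : 'M[MP]_(a, b)) (B : 'M[MP]_(b, c)) :
  map_mx (rtr h) (A *m B) = map_mx (rtr h) A *m map_mx (rtr h) B.
Proof.
apply/matrixP => i j; rewrite !mxE /rtr raddf_sum; apply: eq_bigr => l _.
by rewrite !mxE; exact: rmorphM.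
Qed.
Lemma ltr_cmx h X : map_mx (ltr h) (cmx X) = cmx X.
Proof. by apply/matrixP => i j; rewrite !mxE ltrC. Qed.
Lemma rtr_cmx h X : map_mx (rtr h) (cmx X) = cmx X.
Proof. by apply/matrixP => i j; rewrite !mxE rtrC. Qed.

Lemma rtr_GxE h i j : rtr h (Gx i j) = (Gx *m cmx h) i j.
Proof. by rewrite -rtr_Gx [RHS]mxE. Qed.
Lemma rtr_mulE h (a b c : nat) (A : 'M[MP]_(a, b)) (B : 'M[MP]_(b, c)) i j :
  rtr h ((A *m B) i j) = (map_mx (rtr h) A *m map_mx (rtr h) B) i j.
Proof. by rewrite -rtr_mul [RHS]mxE. Qed.
Lemma der_mulE X (a b c : nat) (A : 'M[MP]_(a, b)) (B : 'M[MP]_(b, c)) i j :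
  der X ((A *m B) i j) =
    (map_mx (der X) A *m B + A *m map_mx (der X) B) i j.
Proof. by rewrite -der_mul [RHS]mxE. Qed.

Lemma der_ltr h X p : der X (ltr h p) = ltr h (der X p).
Proof.
elim/mpoly_entry_ind: p => [c|i j|p q IHp IHq|p q IHp IHq].
- by rewrite ltrC !derC ltr0.
- have := der_mul X (cmx h) Gx; rewrite -ltr_Gx der_cmx mul0mx add0r der_Gx mulmxA.
  rewrite -ltr_Gx -(ltr_cmx h X) -ltr_mul -der_Gx.
  by move/matrixP => /(_ i j); rewrite !mxE.
- by rewrite ltrD !derD ltrD IHp IHq.
by rewrite ltrM !derM ltrD !ltrM IHp IHq.
Qed.

Lemma der_rtr h h' X p : h *m h' = 1%:M ->
  rtr h (der X (rtr h' p)) = der (h *m X *m h') p.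
Proof.
move=> hh'; have rh p' : rtr h (rtr h' p') = p'.
  elim/mpoly_entry_ind: p' => [c|i j|p' q IHp IHq|p' q IHp IHq].
  - by rewrite !rtrC.
  - by rewrite rtr_GxE rtr_mulE rtr_cmx rtr_Gx -mulmxA -cmxM hh' cmx1 mulmx1.
  - by rewrite !rtrD IHp IHq.
  by rewrite !rtrM IHp IHq.
elim/mpoly_entry_ind: p => [c|i j|p q IHp IHq|p q IHp IHq].
- by rewrite rtrC !derC rtr0.
- rewrite rtr_GxE der_mulE der_cmx mulmx0 addr0 der_Gx -mulmxA -cmxM.
  by rewrite rtr_mulE rtr_cmx rtr_Gx derGx -[in LHS]mulmxA -cmxM mulmxA.
- by rewrite rtrD !derD rtrD IHp IHq.
by rewrite rtrM !derM rtrD !rtrM IHp IHq !rh.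
Qed.
End GenericMatrix.

Section PolyAct.
Variables (K : fieldType) (V : lmodType K) (D : {linear V -> V}).

(** The value of Q at the endomorphism D of a space of any dimension; the derivations below act on
    the whole polynomial ring. *)
Definition poly_act (Q : {poly K}) (v : V) : V :=
  \sum_(j < size Q) Q`_j *: iter j D v.

Lemma poly_act_widen (Q : {poly K}) N v : (size Q <= N)%N ->
  poly_act Q v = \sum_(j < N) Q`_j *: iter j D v.
Proof.
move=> QN; rewrite /poly_act (big_ord_widen N (fun j => Q`_j *: iter j D v) QN).
rewrite big_mkcond /=; apply: eq_bigr => j _; case: ltnP => // Qj.
by rewrite nth_default ?scale0r.
Qed.

Lemma iter_linearP j a u v : iter j D (a *: u + v) = a *: iter j D u + iter j D v.
Proof. by elim: j => //= j ->; rewrite linearP. Qed.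

Lemma poly_actP Q a u v :
  poly_act Q (a *: u + v) = a *: poly_act Q u + poly_act Q v.
Proof.
rewrite /poly_act scaler_sumr -big_split /=; apply: eq_bigr => j _.
by rewrite iter_linearP scalerDr !scalerA mulrC.
Qed.

Lemma poly_actDr Q u v : poly_act Q (u + v) = poly_act Q u + poly_act Q v.
Proof. by have := poly_actP Q 1 u v; rewrite !scale1r. Qed.

Lemma poly_act0r Q : poly_act Q 0 = 0.
Proof. by have := poly_actDr Q 0 0; rewrite addr0 -{1}[poly_act Q 0]addr0 => /addrI. Qed.

Lemma poly_actD P Q v : poly_act (P + Q) v = poly_act P v + poly_act Q v.
Proof.
pose N := maxn (size P) (size Q).
rewrite (poly_act_widen _ (leq_maxl _ _ : size P <= N)%N).
rewrite (poly_act_widen _ (leq_maxr _ _ : size Q <= N)%N).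
rewrite (poly_act_widen _ (size_polyD P Q)) -big_split /=.
by apply: eq_bigr => j _; rewrite coefD scalerDl.
Qed.

Lemma poly_actC c v : poly_act c%:P v = c *: v.
Proof.
rewrite (poly_act_widen _ (size_polyC_leq1 c)) big_ord_recl big_ord0 addr0 /=.
by rewrite coefC.
Qed.

Lemma poly_actMX Q v : poly_act (Q * 'X) v = poly_act Q (D v).
Proof.
have sQ : (size (Q * 'X)%R <= (size Q).+1)%N.
  by rewrite (leq_trans (size_polyMleq _ _)) // size_polyX addn2.
rewrite (poly_act_widen _ sQ) big_ord_recl coefMX /= scale0r add0r.
by apply: eq_bigr => j _; rewrite coefMX /= -iterSr.
Qed.

Lemma poly_actM P Q v : poly_act (P * Q) v = poly_act P (poly_act Q v).
Proof.
elim/poly_ind: P v => [|P c IH] v.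
  by rewrite mul0r -polyC0 !poly_actC !scale0r.
have comm R w : D (poly_act R w) = poly_act R (D w).
  elim/poly_ind: R w => [|R d IHR] w.
    by rewrite -polyC0 !poly_actC !scale0r linear0.
  by rewrite !poly_actD !poly_actMX !poly_actC linearD linearZ /= IHR.
rewrite mulrDl !poly_actD !poly_actC mulrAC !poly_actMX IH comm; congr (_ + _).
elim/poly_ind: Q v {IH} => [|Q d IHQ] v.
  by rewrite mulr0 -polyC0 !poly_actC !scale0r scaler0.
rewrite mulrDr mulrA !poly_actD !poly_actMX IHQ -polyCM !poly_actC.
by rewrite scalerDr scalerA.
Qed.

Lemma poly_act_eigen a Q v : D v = a *: v -> poly_act Q v = Q.[a] *: v.
Proof.
move=> Dv; elim/poly_ind: Q => [|Q c IH].
  by rewrite -polyC0 poly_actC hornerC.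
rewrite poly_actD poly_actMX poly_actC Dv hornerMXaddC scalerDl -scalerA.
by have := poly_actP Q a v 0; rewrite poly_act0r !addr0 => ->; rewrite IH scalerA mulrC -scalerA.
Qed.

Lemma poly_act_geigen a c N Q v : poly_act (('X - a%:P) ^+ N) v = 0 ->
  ('X - a%:P) ^+ N %| Q - c%:P -> poly_act Q v = c *: v.
Proof.
move=> v0 /dvdpP[R RE]; rewrite -[Q](subrK c%:P) RE poly_actD poly_actC.
by rewrite poly_actM v0 poly_act0r add0r.
Qed.
End PolyAct.

Section LieAlgebra.
Variables (K : numClosedFieldType) (m' : nat).
Local Notation m := m'.+1.
Local Notation MP := {mpoly K[m * m]}.
Local Notation Gx := (genmx_var K m').
Implicit Types (p q : MP) (X Y g h : 'M[K]_m).

Definition vanishes (G : 'M[K]_m -> Prop) p := forall g, G g -> ev g p = 0.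

(** Closed subgroups of SL_m. As the determinant is 1, the polynomials in the entries already give
    all regular functions. *)
Record lin_group (G : 'M[K]_m -> Prop) : Prop := LinGroup {
  lg1 : G 1%:M;
  lgM : forall g h, G g -> G h -> G (g *m h);
  lgV : forall g, G g -> G (invmx g);
  lg_det : forall g, G g -> \det g = 1;
  lg_closed : forall g, (forall p, vanishes G p -> ev g p = 0) -> G g
}.

Variables (G : 'M[K]_m -> Prop) (lgG : lin_group G).

Lemma lg_unit g : G g -> g \in unitmx.
Proof. by move=> Gg; rewrite unitmxE (lg_det lgG Gg) unitr1. Qed.

Lemma lg_adj g : G g -> \adj g = invmx g.
Proof. by move=> Gg; rewrite /invmx lg_unit // (lg_det lgG Gg) invr1 scale1r. Qed.

Lemma vanishes0 : vanishes G 0. Proof. by move=> g _; rewrite ev0. Qed.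
Lemma vanishesD p q : vanishes G p -> vanishes G q -> vanishes G (p + q).
Proof. by move=> vp vq g Gg; rewrite evD vp // vq // addr0. Qed.
Lemma vanishesZ a p : vanishes G p -> vanishes G (a *: p).
Proof. by move=> vp g Gg; rewrite evZ vp // mulr0. Qed.
Lemma vanishesB p q : vanishes G p -> vanishes G q -> vanishes G (p - q).
Proof. by move=> vp vq g Gg; rewrite evB vp // vq // subr0. Qed.
Lemma vanishesMr p q : vanishes G q -> vanishes G (p * q).
Proof. by move=> vq g Gg; rewrite evM vq // mulr0. Qed.
Lemma vanishes_sum (I : Type) (r : seq I) (P : pred I) (F : I -> MP) :
  (forall i, P i -> vanishes G (F i)) -> vanishes G (\sum_(i <- r | P i) F i).
Proof. by move=> vF g Gg; rewrite ev_sum big1 // => i Pi; exact: vF. Qed.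
Lemma vanishes_ltr h p : G h -> vanishes G p -> vanishes G (ltr h p).
Proof. by move=> Gh vp g Gg; rewrite ev_ltr vp //; apply: (lgM lgG). Qed.
Lemma vanishes_rtr h p : G h -> vanishes G p -> vanishes G (rtr h p).
Proof. by move=> Gh vp g Gg; rewrite ev_rtr vp //; apply: (lgM lgG). Qed.

Definition lieG X := forall p, vanishes G p -> vanishes G (der X p).

(** By left invariance, the derivative of p at g is the derivative at 1 of the translate of p by g,
    and translates by G stay in the ideal. *)
Lemma lieG_at1 X :
  (forall p, vanishes G p -> ev 1%:M (der X p) = 0) -> lieG X.
Proof.
move=> X1 p vp g Gg; have := X1 _ (vanishes_ltr Gg vp).
by rewrite der_ltr ev_ltr mulmx1.
Qed.

Lemma lieGD X Y : lieG X -> lieG Y -> lieG (X + Y).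
Proof. by move=> lX lY p vp; rewrite der_is_additive; apply: vanishesD; [apply: lX|apply: lY]. Qed.

Lemma lieGZ a X : lieG X -> lieG (a *: X).
Proof. by move=> lX p vp; rewrite der_scale; apply/vanishesZ/lX. Qed.

Lemma lieGB X Y : lieG X -> lieG Y -> lieG (X - Y).
Proof. by move=> lX lY; rewrite -scaleN1r; apply/lieGD/lieGZ. Qed.

Lemma lieG_lie X Y : lieG X -> lieG Y -> lieG (lie X Y).
Proof.
by move=> lX lY p vp; rewrite -der_lie; apply: vanishesB; [apply/lX/lY|apply/lY/lX].
Qed.

Lemma lieG_conj g X : G g -> lieG X -> lieG (g *m X *m invmx g).
Proof.
move=> Gg lX p vp; rewrite -(der_rtr _ _ (mulmxV (lg_unit Gg))).
by apply/vanishes_rtr/lX/vanishes_rtr => //; apply: (lgV lgG).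
Qed.

Lemma deriv_mmap (v : 'I_(m * m) -> {poly K}) p :
  (mmap (@polyC K) v p)^`() =
    \sum_k mmap (@polyC K) v p^`M(k) * (v k)^`().
Proof.
elim/mpoly_ring_ind: p => [c|i|p q IHp IHq|p q IHp IHq].
- rewrite mmapC derivC big1 // => k _.
  by rewrite mderivC mmap0 mul0r.
- rewrite mmapX mmap1U (bigD1 i) //= mderivXU eqxx rmorph1 mul1r big1 ?addr0 //.
  by move=> k ki; rewrite mderivXU eq_sym (negPf ki) mmap0 mul0r.
- rewrite mmapD derivD IHp IHq -big_split /=; apply: eq_bigr => k _.
  by rewrite mderivD mmapD mulrDl.
rewrite rmorphM derivM IHp IHq mulr_suml mulr_sumr -big_split /=.
apply: eq_bigr => k _; rewrite mderivM mmapD !rmorphM /= mulrDl; congr (_ + _); ring.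
Qed.

Definition exp_nilp X : 'M[K]_m := \sum_(j < m) (j`!%:R)^-1 *: X ^+ j.

(* Along e(t) = exp(tX), the derivative of p(e(t)) is (der X p)(e(t)), so that
   all the derivatives of p(e(t)) at t = 0 vanish when p does on G. *)
Lemma exp_nilp_in X : lieG X -> X ^+ m = 0 -> G (exp_nilp X).
Proof.
move=> lX Xm; pose e : 'M[{poly K}]_m :=
  \sum_(j < m) ((j`!%:R)^-1 *: 'X^j) *: map_mx polyC (X ^+ j).
pose v k := mxvec e 0 k; pose F p := mmap (@polyC K) v p.
have XS j : X ^+ j *m X = X ^+ j.+1 by rewrite exprSr.
have e_deriv : map_mx (@deriv K) e = e *m map_mx polyC X.
  have -> : map_mx (@deriv K) e =
      \sum_(j < m) ((j`!%:R)^-1 *: 'X^j)^`() *: map_mx polyC (X ^+ j).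
    apply/matrixP => i l; rewrite mxE !summxE linear_sum; apply: eq_bigr => j _.
    by rewrite !mxE [LHS]derivM derivC mulr0 addr0.
  rewrite big_ord_recl /= expr0 alg_polyC derivC scale0r add0r.
  rewrite /e mulmx_suml big_ord_recr /=.
  rewrite -[X in _ + X]scalemxAl -map_mxM XS Xm map_mx0 scaler0 addr0.
  apply: eq_bigr => j _; rewrite -scalemxAl -map_mxM XS.
  congr (_ *: _); rewrite linearZ /= /bump leq0n add1n derivXn factS natrM.
  rewrite -scaler_nat scalerA invfM mulrAC mulVf ?mul1r //.
  by rewrite pnatr_eq0.
have F_deriv p : (F p)^`() = F (der X p).
  rewrite deriv_mmap /F /der raddf_sum /=; apply: eq_bigr => k _.
  rewrite rmorphM; congr (_ * _); case/mxvec_indexP: k => i j.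
  rewrite /v mxvecE; have := e_deriv => /matrixP/(_ i j); rewrite mxE => ->.
  rewrite mxvecE !mxE raddf_sum /=; apply: eq_bigr => l _; rewrite rmorphM /=.
  rewrite cmxE GxE mmapC mmapX mmap1U mxvecE.
  by congr (_ * _); rewrite mxE.
have F_eval p (a : K) :
    (F p).[a] = ev (\sum_(j < m) ((j`!%:R)^-1 * a ^+ j) *: X ^+ j) p.
  rewrite /F; elim/mpoly_ring_ind: p => [c|k|p q IHp IHq|p q IHp IHq].
  - by rewrite mmapC hornerC evC.
  - rewrite mmapX mmap1U /ev mevalXU; case/mxvec_indexP: k => i j.
    rewrite /v !mxvecE /e !summxE horner_sum; apply: eq_bigr => l _.
    by rewrite !mxE hornerM hornerZ hornerXn hornerC.
  - by rewrite mmapD hornerD IHp IHq evD.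
  by rewrite rmorphM hornerM IHp IHq evM.
apply: (lg_closed lgG) => p vp.
have vanD j : vanishes G (iter j (der X) p) by elim: j => //= j; exact: lX.
have Fj j : (F p)^`(j) = F (iter j (der X) p).
  by elim: j => [|j IH]; [|rewrite derivnS IH F_deriv].
have F0 : F p = 0.
  apply/polyP => j; rewrite coef0; have := congr1 (horner^~ 0) (Fj j).
  rewrite /= F_eval big_ord_recl big1 => [|l _]; last first.
    by rewrite exprS mul0r mulr0 scale0r.
  rewrite fact0 invr1 !expr0 mul1r scale1r addr0 (vanD j _ (lg1 lgG)).
  rewrite horner_coef0 coef_derivn addn0 ffactnn => /eqP.
  by rewrite mulrn_eq0 -leqn0 leqNgt fact_gt0 => /eqP.
have := F_eval p 1; rewrite F0 horner0 => /esym.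
suff -> : \sum_(j < m) ((j`!%:R)^-1 * 1 ^+ j) *: X ^+ j = exp_nilp X by [].
by apply: eq_bigr => j _; rewrite expr1n mulr1.
Qed.

(** The condition g Y g^-1 in A is polynomial in g, with the adjugate for the inverse, and its
    derivative at 1 along X is [X, Y] in A. The derivative of the adjugate is - X because that of
    the determinant, constant on G, is 0. *)
Lemma lieG_stabilizes r (A : 'M[K]_(r, m * m)) X Y :
  (forall g Z, G g -> (Z \in A)%MS -> (g *m Z *m invmx g \in A)%MS) ->
  lieG X -> (Y \in A)%MS -> (lie X Y \in A)%MS.
Proof.
move=> stabA lX YA.
have det_der : ev 1%:M (der X (\det Gx)) = 0.
  have v : vanishes G (\det Gx - 1%:MP).
    move=> g Gg; rewrite evB evC -det_map_mx ev_Gx.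
    by rewrite (lg_det lgG Gg) subrr.
  have := lX _ v; move=> /(_ _ (lg1 lgG)).
  by rewrite linearB /= derC subr0.
have der_adj : map_mx (ev 1%:M) (map_mx (der X) (\adj Gx)) = - X.
  have := congr1 (map_mx (ev 1%:M) \o map_mx (der X)) (mul_mx_adj Gx).
  rewrite /= der_mul map_mxD !ev_mul der_Gx ev_mul !ev_Gx ev_cmx map_mx_adj ev_Gx.
  rewrite mul1mx adj1 mulmx1 mul1mx => e; apply/eqP; rewrite -addr_eq0 addrC e.
  apply/eqP/matrixP => i j; rewrite !mxE raddfMn /= [LHS]raddfMn /=.
  by rewrite det_der mul0rn.
pose H := Gx *m cmx Y *m \adj Gx.
pose B : 'M[MP]_(m * m) := map_mx (@mpolyC _ K) (cokermx A).
have vH j : vanishes G ((mxvec H *m B) 0 j).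
  move=> g Gg.
  have -> : ev g ((mxvec H *m B) 0 j) = (mxvec (g *m Y *m invmx g) *m cokermx A) 0 j.
    have BE : map_mx (ev g) B = cokermx A by apply/matrixP => a b; rewrite !mxE evC.
    have HE : map_mx (ev g) H = g *m Y *m invmx g.
      by rewrite /H !ev_mul map_mx_adj ev_Gx ev_cmx lg_adj.
    by rewrite -HE -BE -map_mxvec -ev_mul [RHS]mxE.
  by have := stabA _ _ Gg YA; rewrite submxE => /eqP ->; rewrite mxE.
have derH : map_mx (ev 1%:M) (map_mx (der X) (mxvec H *m B)) =
    mxvec (lie X Y) *m cokermx A.
  rewrite der_mul (_ : map_mx (der X) B = 0) ?mulmx0 ?addr0; last first.
    by apply/matrixP => a b; rewrite !mxE derC.
  rewrite ev_mul; congr (_ *m _); last first.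
    by apply/matrixP => a b; rewrite !mxE evC.
  rewrite !map_mxvec /H !der_mul der_cmx mulmx0 addr0 der_Gx.
  rewrite map_mxD !ev_mul der_adj map_mx_adj !ev_Gx !ev_cmx adj1 !mul1mx mulmx1.
  by rewrite mulmxN.
rewrite submxE -derH; apply/eqP/rowP => j; rewrite [RHS]mxE.
have := lX _ (vH j) _ (lg1 lgG); move=> e; rewrite [LHS]mxE [X in ev _ X]mxE.
exact: e.
Qed.

(* On polynomials, der S is diagonalizable and der N locally nilpotent when S
   is diagonalizable and N nilpotent, so der S is locally a polynomial in
   der (S + N) when S and N commute. *)
Lemma der_semisimple (rs : seq K) (E : K -> 'M[K]_m) S :
  \sum_(a <- rs) E a = 1%:M -> (forall a, a \in rs -> S *m E a = a *: E a) ->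
  forall p, exists s : seq (K * MP),
    p = \sum_(t <- s) t.2 /\ forall t, t \in s -> der S t.2 = t.1 *: t.2.
Proof.
move=> sE SE; apply: mpoly_entry_ind => [c|i j|p q [s [-> sP]] [t [-> tP]]|p q [s [-> sP]] [t [-> tP]]].
- exists [:: (0, c%:MP)]; rewrite big_seq1; split=> // t; rewrite inE => /eqP-> /=.
  by rewrite derC scale0r.
- exists [seq (a, (Gx *m cmx (E a)) i j) | a <- rs]; split.
    rewrite big_map -summxE -mulmx_sumr.
    have -> : \sum_(a <- rs) cmx (E a) = cmx (\sum_(a <- rs) E a).
      by apply/matrixP => k l; rewrite summxE cmxE summxE rmorph_sum; apply: eq_bigr => a _; rewrite cmxE.
    by rewrite sE cmx1 mulmx1.
  move=> t /mapP[a ars ->] /=.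
  rewrite der_mulE der_cmx mulmx0 addr0 der_Gx -mulmxA -cmxM SE //.
  rewrite !mxE scaler_sumr; apply: eq_bigr => k _.
  by rewrite !cmxE [(a *: E a) k j]mxE mpolyCM mulrCA mul_mpolyC.
- exists (s ++ t); rewrite big_cat; split => // u; rewrite mem_cat => /orP[/sP|/tP] //.
exists [seq (u.1 + v.1, u.2 * v.2) | u <- s, v <- t]; split.
  by rewrite big_allpairs_dep mulr_suml; apply: eq_bigr => u _; rewrite mulr_sumr.
move=> w /allpairsP[[u v] /= [/sP us /tP vt ->]] /=.
by rewrite derM us vt -scalerAl -scalerAr scalerDl.
Qed.

(** The entries of the generic matrix are killed by the m-th iterate, and by the Leibniz rule the
    orders of two factors add up. *)
Lemma der_locally_nilpotent X : X ^+ m = 0 ->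
  forall p, exists M, iter M (der X) p = 0.
Proof.
move=> Xm; have it0 k : iter k (der X) 0 = 0.
  by elim: k => //= k ->; rewrite linear0.
have itD k p q : iter k (der X) (p + q) = iter k (der X) p + iter k (der X) q.
  by elim: k => //= k ->; rewrite derD.
have itle k l p : (k <= l)%N -> iter k (der X) p = 0 -> iter l (der X) p = 0.
  by move=> /subnK <- p0; rewrite iterD p0 it0.
apply: mpoly_entry_ind => [c|i j|p q [M pM] [N qN]|p q [M pM] [N qN]].
- by exists 1%N; rewrite /= derC.
- exists m; suff -> k : iter k (der X) (Gx i j) = (Gx *m cmx (X ^+ k)) i j.
    rewrite Xm; have -> : cmx (0 : 'M[K]_m) = 0 by apply/matrixP => a b; rewrite cmxE !mxE mpolyC0.
    by rewrite mulmx0 mxE.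
  elim: k => [|k IH]; first by rewrite expr0 cmx1 mulmx1.
  rewrite iterS IH der_mulE der_cmx mulmx0 addr0 der_Gx -mulmxA -cmxM.
  by rewrite (exprS X k).
- exists (maxn M N); rewrite itD (itle M _ p (leq_maxl M N) pM).
  by rewrite (itle N _ q (leq_maxr M N) qN) addr0.
exists (M + N)%N.
have [k] := ubnP (M + N); elim: k M N p q pM qN => // k IH M N p q pM qN Mk.
case: M => [|M] in pM Mk *; first by rewrite -[p]/(iter 0 (der X) p) pM mul0r it0.
case: N => [|N] in qN Mk *; first by rewrite -[q]/(iter 0 (der X) q) qN mulr0 it0.
rewrite addSn iterSr derM itD (IH M N.+1) ?add0r; first last.
- by rewrite -ltnS -addSn.
- exact: qN.
- by rewrite -iterSr.
rewrite -addSnnS (IH M.+1 N) //; first by rewrite -iterSr.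
by rewrite -ltnS -addnS.
Qed.
End LieAlgebra.

(** * Jordan decomposition inside the Lie algebra *)

Section Jordan.
Variables (K : numClosedFieldType) (m' : nat).
Local Notation m := m'.+1.
Local Notation MP := {mpoly K[m * m]}.
Variables (G : 'M[K]_m -> Prop) (lgG : lin_group G).

(** On any given p, [der S] coincides with a polynomial in [der X], depending on p, so it preserves
    the ideal of G as [der X] does. *)
Lemma lieG_jordan X : lieG G X ->
  exists (rs : seq K) (E : K -> 'M[K]_m) (S : 'M[K]_m),
    [/\ uniq rs, \sum_(a <- rs) E a = 1%:M,
        forall a b, a \in rs -> b \in rs -> E a *m E b = E a *+ (a == b),
        S = \sum_(a <- rs) a *: E a
      & [/\ lieG G S, lieG G (X - S) & (X - S) ^+ m = 0]].
Proof.
move=> lX; have [rs [P [urs sE EE XE _]]] := spectralP X.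
pose E a : 'M[K]_m := horner_mx X (P a); pose S := \sum_(a <- rs) a *: E a.
have EE' a b : a \in rs -> b \in rs -> E a *m E b = E a *+ (a == b).
  exact: EE.
have SE a : a \in rs -> S *m E a = a *: E a.
  move=> ars; rewrite /S mulmx_suml (bigD1_seq a) //= -scalemxAl EE' // eqxx.
  rewrite big1_seq ?addr0 // => b /andP[ba brs].
  by rewrite -scalemxAl EE' // (negPf ba) scaler0.
have XEc a : X *m E a = E a *m X by apply: comm_mx_horner.
have XS : X *m S = S *m X.
  rewrite mulmx_sumr mulmx_suml; apply: eq_bigr => a _.
  by rewrite -scalemxAl -scalemxAr XEc.
have [N ND] : exists N, N = X - S by exists (X - S).
have N0 : N ^+ m = 0.
  have NE a k : a \in rs -> N ^+ k *m E a = (X - a%:M) ^+ k *m E a.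
    move=> ars; elim: k => [|k IH]; first by rewrite !expr0.
    have c1 : (X - a%:M) *m N = N *m (X - a%:M).
      rewrite mulmxBl mulmxBr mul_scalar_mx mul_mx_scalar; congr (_ - _).
      by rewrite ND mulmxBr mulmxBl XS.
    have c2 : (X - a%:M) *m N ^+ k = N ^+ k *m (X - a%:M).
      by have /commrX : GRing.comm (X - a%:M) N := c1; exact.
    have n1 : N *m E a = (X - a%:M) *m E a.
      by rewrite ND !mulmxBl SE // mul_scalar_mx.
    have c3 : N *m N ^+ k = N ^+ k *m N by exact: (commrX k (erefl (N * N))).
    rewrite !exprS -!mulmxE -!mulmxA -IH [RHS]mulmxA c2 -[RHS]mulmxA -n1.
    by rewrite !mulmxA c3.
  rewrite -[LHS]mulmx1 -[1%:M]sE mulmx_sumr big1_seq // => a /andP[_ ars].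
  by rewrite NE //; exact: XE.
have lS : lieG G S.
  move=> p vp; have [s [pE sP]] := der_semisimple sE SE p.
  have [M MP_] := boolp.choice (der_locally_nilpotent N0).
  pose N1 := (\sum_(t <- s) M t.2)%N.
  have [Q QP] := poly_crt [seq t.1 | t <- s] N1 id.
  have SN q : der S (der N q) = der N (der S q).
    apply/eqP; rewrite -subr_eq0 der_lie (_ : lie S N = 0).
      by have := der_scale q 0 0; rewrite !scale0r => ->.
    by rewrite /lie ND mulmxBr mulmxBl XS subrr.
  have dX q : der X q = der S q + der N q.
    by rewrite -der_is_additive ND addrC subrK.
  have actN a k q : der S q = a *: q ->
      poly_act (der X) (('X - a%:P) ^+ k) q = iter k (der N) q /\
      der S (iter k (der N) q) = a *: iter k (der N) q.
    move=> Sq; elim: k => [|k [IH1 IH2]].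
      by rewrite expr0 -polyC1 poly_actC scale1r.
    rewrite exprS poly_actM IH1 /= SN IH2 linearZ /=; split=> //.
    rewrite poly_actD -['X]mul1r -polyC1 poly_actMX -polyCN !poly_actC scale1r.
    by rewrite /= dX IH2 scaleNr addrAC subrr add0r.
  have -> : der S p = poly_act (der X) Q p.
    rewrite {1 2}pE linear_sum /=.
    have pa_sum (s' : seq (K * MP)) : poly_act (der X) Q (\sum_(t <- s') t.2) =
        \sum_(t <- s') poly_act (der X) Q t.2 :> MP.
      elim: s' => [|t s' IH]; first by rewrite !big_nil poly_act0r.
      by rewrite !big_cons poly_actDr IH.
    rewrite pa_sum.
    apply: eq_big_seq => t ts; rewrite (sP _ ts); apply/esym.
    apply: (@poly_act_geigen _ _ _ t.1 t.1 N1); last by apply/QP/map_f.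
    have [-> _] := actN t.1 N1 t.2 (sP _ ts).
    have -> : N1 = ((N1 - M t.2) + M t.2)%N.
      by rewrite subnK // /N1 (big_rem t) //= leq_addr.
    rewrite iterD MP_; elim: (N1 - M t.2)%N => //= k ->; exact: linear0.
  rewrite /poly_act; apply: vanishes_sum => j _; apply: vanishesZ.
  by elim: (nat_of_ord j) => //= k; exact: lX.
exists rs, E, S; split; [exact: urs | exact: sE | exact: EE' | reflexivity | split].
- exact: lS.
- exact: lieGB lX lS.
by rewrite -ND.
Qed.
End Jordan.

(** * Noetherian rings and locally constant functions *)

Section Noetherian.
Variable (R : comNzRingType).
Implicit Types (a : nat -> R) (x y : R).

Definition in_ideal a n x := exists c : nat -> R, x = \sum_(i < n) c i * a i.

(** The chain condition in terms of sequences of elements: some term lies in the ideal generated by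
    the previous ones. *)
Definition noetherian := forall a, exists n, in_ideal a n (a n).

Lemma in_idealD a n x y : in_ideal a n x -> in_ideal a n y -> in_ideal a n (x + y).
Proof.
move=> [c ->] [d ->]; exists (fun i => c i + d i); rewrite -big_split /=.
by apply: eq_bigr => i _; rewrite mulrDl.
Qed.

Lemma in_idealM a n x y : in_ideal a n y -> in_ideal a n (x * y).
Proof.
move=> [c ->]; exists (fun i => x * c i); rewrite mulr_sumr.
by apply: eq_bigr => i _; rewrite mulrA.
Qed.

Lemma in_ideal0 a n : in_ideal a n 0.
Proof. by exists (fun=> 0); rewrite big1 // => i _; rewrite mul0r. Qed.

Lemma in_ideal_sum a n (I : Type) (r : seq I) (P : pred I) (F : I -> R) :
  (forall i, P i -> in_ideal a n (F i)) -> in_ideal a n (\sum_(i <- r | P i) F i).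
Proof.
by move=> IF; apply: (big_ind (in_ideal a n)); [exact: in_ideal0 | exact: in_idealD | exact: IF].
Qed.

Lemma in_ideal_gen a n i : (i < n)%N -> in_ideal a n (a i).
Proof.
move=> ltin; exists (fun j => (j == i)%:R); rewrite (bigD1 (Ordinal ltin)) //=.
rewrite eqxx mul1r big1 ?addr0 // => j /negPf ji.
by have -> : (j == i :> nat) = false; [exact: ji | rewrite mul0r].
Qed.

(* An ideal is described by its sequences of generators; P is closed under the
   formation of ideals. *)
Lemma in_ideal_ind (P : R -> Prop) a n x :
  P 0 -> (forall x y, P x -> P y -> P (x + y)) -> (forall x y, P y -> P (x * y)) ->
  (forall i, (i < n)%N -> P (a i)) -> in_ideal a n x -> P x.
Proof.
move=> P0 PD PM Pa [c ->]; apply: (big_ind P) => // i _.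
by apply: PM; apply: Pa.
Qed.

(** Otherwise dependent choice yields an increasing sequence of members of [F], each with a witness
    in the next one but not in itself; these witnesses violate the chain condition. *)
Lemma noetherian_maximal (F : (R -> Prop) -> Prop) (J0 : R -> Prop) :
  noetherian ->
  (forall J, F J -> [/\ J 0, forall x y, J x -> J y -> J (x + y)
                      & forall x y, J y -> J (x * y)]) ->
  F J0 -> exists J, [/\ F J, forall x, J0 x -> J x
    & forall J', F J' -> (forall x, J x -> J' x) -> forall x, J' x -> J x].
Proof.
move=> noethR Fid FJ0; apply: contrapT => nomax.
pose T := {J : R -> Prop | F J /\ forall x, J0 x -> J x}.
have next (J : T) : exists Jx : T * R,
    [/\ forall x, proj1_sig J x -> proj1_sig Jx.1 x, proj1_sig Jx.1 Jx.2 & ~ proj1_sig J Jx.2].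
  case: J => J [FJ JJ0] /=; apply: contrapT => nJ; apply: nomax.
  exists J; split=> // J' FJ' JJ' x J'x; apply: contrapT => nJx; apply: nJ.
  have h : F J' /\ forall x, J0 x -> J' x by split=> // z /JJ0/JJ'.
  by exists (exist _ J' h : T, x).
have [f fP] := boolp.choice next.
pose J n : T := iter n (fun J => (f J).1) (exist _ J0 (conj FJ0 (fun x (h : J0 x) => h))).
pose a n := (f (J n)).2.
have Jmono n k x : proj1_sig (J n) x -> proj1_sig (J (k + n)%N) x.
  by move=> Jx; elim: k => //= k IH; have [h _ _] := fP (J (k + n)%N); apply: h.
have [n an] := noethR a; have [_ _ nJ] := fP (J n); apply: nJ.
have [J_0 J_D J_M] := Fid _ (proj1 (proj2_sig (J n))).
apply: (in_ideal_ind J_0 J_D J_M _ an) => i ltin.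
have [_ h _] := fP (J i); rewrite -(subnK ltin).
exact: (Jmono i.+1 (n - i.+1)%N).
Qed.
End Noetherian.

Lemma noetherian_surj (R S : comNzRingType) (phi : {rmorphism R -> S}) :
  (forall y, exists x, phi x = y) -> noetherian R -> noetherian S.
Proof.
move=> /boolp.choice[psi psiK] noethR a; have [n [c e]] := noethR (psi \o a).
exists n, (phi \o c); rewrite -[LHS]psiK [psi _]e rmorph_sum.
by apply: eq_bigr => i _; rewrite rmorphM /= psiK.
Qed.

Lemma noetherian_field (F : fieldType) : noetherian F.
Proof.
move=> a; have [[i ai]|an0] := pselect (exists i, a i != 0).
  exists i.+1; rewrite -[a i.+1](mulfVK ai).
  exact/in_idealM/in_ideal_gen.
exists 0%N; suff -> : a 0%N = 0 by exact: in_ideal0.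
by apply/eqP; apply: contrapT => /negP a0; apply: an0; exists 0%N.
Qed.

(* Hilbert's basis theorem: otherwise choose inductively g n of least degree
   outside the ideal generated by the previous ones; a relation between the
   leading coefficients lowers the degree of some g n. *)
Lemma noetherian_poly (R : comNzRingType) : noetherian R -> noetherian {poly R}.
Proof.
move=> noethR f; apply: contrapT => nf.
pose I (p : {poly R}) := exists n, in_ideal f n p.
have monoI n k p : in_ideal f n p -> in_ideal f (n + k)%N p.
  case=> c ->; apply: in_ideal_sum => i _; apply/in_idealM/in_ideal_gen.
  by rewrite (leq_trans (ltn_ord i)) // leq_addr.
have ID p q : I p -> I q -> I (p + q).
  move=> [i pi] [j qj]; exists (i + j)%N.
  by apply: in_idealD; [exact: monoI|rewrite addnC; exact: monoI].
have IM p q : I q -> I (p * q) by move=> [i qi]; exists i; exact: in_idealM.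
have nfg (g : nat -> {poly R}) n : (forall i, (i < n)%N -> I (g i)) ->
    exists p, I p /\ ~ in_ideal g n p.
  move=> gI; have [N gN] : exists N, forall i, (i < n)%N -> in_ideal f N (g i).
    elim: n gI => [|n IH] gI; first by exists 0%N.
    have [|N gN] := IH; first by move=> i ltin; apply: gI; rewrite ltnW.
    have [k gk] := gI n (ltnSn n); exists (N + k)%N => i.
    rewrite ltnS leq_eqVlt => /orP[/eqP->|/gN/monoI//].
    by rewrite addnC; exact: monoI.
  exists (f N); split; first by exists N.+1; exact: in_ideal_gen.
  move=> fN; apply: nf; exists N.
  apply: (in_ideal_ind _ _ _ gN fN); first exact: in_ideal0.
    by move=> x y; exact: in_idealD.
  by move=> x y; exact: in_idealM.
have step (s : seq {poly R}) : exists p, (forall q, q \in s -> I q) ->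
    [/\ I p, ~ in_ideal (nth 0 s) (size s) p
      & forall q, I q -> ~ in_ideal (nth 0 s) (size s) q -> (size p <= size q)%N].
  have [sI|nsI] := pselect (forall q, q \in s -> I q); last by exists 0.
  have [i lti|p [Ip np]] := @nfg (nth 0 s) (size s); first by apply/sI/mem_nth.
  pose Q k := `[< exists q, [/\ I q, ~ in_ideal (nth 0 s) (size s) q & size q = k] >].
  have exQ : exists k, Q k by exists (size p); apply/asboolP; exists p.
  case: (ex_minnP exQ) => k /asboolP[q [Iq nq sq]] mink; exists q => _; split=> // r Ir nr.
  by rewrite sq; apply: mink; apply/asboolP; exists r.
have [nxt nxtP] := boolp.choice step.
pose s n := iter n (fun s => rcons s (nxt s)) [::].
have size_s n : size (s n) = n by elim: n => //= n IH; rewrite size_rcons IH.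
pose g n := nxt (s n).
have nth_s n i : (i < n)%N -> (s n)`_i = g i.
  elim: n => // n IH; rewrite ltnS /= nth_rcons size_s leq_eqVlt => /orP[/eqP->|lti].
    by rewrite ltnn eqxx.
  by rewrite lti IH.
have sI n q : q \in s n -> I q.
  elim: n q => // n IH q /=; rewrite mem_rcons inE => /orP[/eqP->|/IH //].
  by have [] := nxtP (s n) IH.
have gP n : [/\ I (g n), ~ in_ideal g n (g n)
    & forall q, I q -> ~ in_ideal g n q -> (size (g n) <= size q)%N].
  have [Ig ng ming] := nxtP (s n) (sI n).
  have eqI q : in_ideal g n q <-> in_ideal (nth 0 (s n)) (size (s n)) q.
    rewrite size_s; split=> -[c ->]; exists c; apply: eq_bigr => i _; by rewrite nth_s.
  by split=> // [/eqI //|q Iq nq]; apply: ming => // /eqI.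
have [n [c e]] := noethR (fun n => lead_coef (g n)).
have [Ig ng ming] := gP n.
have ledeg i : (i < n)%N -> (size (g i) <= size (g n))%N.
  move=> lti; have [_ _ mini] := gP i; apply: mini => // -[d gd]; apply: ng.
  rewrite gd; apply: in_ideal_sum => j _; apply/in_idealM/in_ideal_gen.
  exact: leq_trans (ltn_ord j) (ltnW lti).
pose r := \sum_(i < n) (c i)%:P * 'X^(size (g n) - size (g i)) * g i.
have Gr : in_ideal g n r by exists (fun i => (c i)%:P * 'X^(size (g n) - size (g i))).
have nq : ~ in_ideal g n (g n - r).
  by move=> h; apply: ng; rewrite -(subrK r (g n)); exact: in_idealD.
have Iq : I (g n - r).
  apply: (ID) => //; rewrite -mulN1r; apply: (IM).
  apply: (in_ideal_ind _ ID IM _ Gr); first by exists 0%N; exact: in_ideal0.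
  by move=> i _; have [] := gP i.
have g_gt0 k : (0 < size (g k))%N.
  have [_ nk _] := gP k; rewrite lt0n size_poly_eq0; apply/eqP => g0; apply: nk.
  by rewrite g0; exact: in_ideal0.
have := ming _ Iq nq; rewrite leqNgt => /negP[].
have r_coef j : ((size (g n)).-1 <= j)%N ->
    r`_j = \sum_(i < n) c i * (g i)`_(j - (size (g n) - size (g i))).
  move=> lej; rewrite coef_sum; apply: eq_bigr => i _.
  rewrite -mulrA coefCM coefXnM ltnNge (leq_trans _ lej) //.
  by have := g_gt0 i; lia.
rewrite -[X in (_ < X)%N](prednK (g_gt0 n)) ltnS; apply/leq_sizeP => j lej.
rewrite coefB r_coef //; apply/eqP; rewrite subr_eq0; move: lej.
rewrite leq_eqVlt => /orP[/eqP <-|ltj].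
  rewrite -[(g n)`__]/(lead_coef (g n)) e; apply/eqP/eq_bigr => i _; congr (_ * _).
  rewrite lead_coefE; congr (_`_ _); have := ledeg i (ltn_ord i).
  move: (g_gt0 n) (g_gt0 i); lia.
rewrite nth_default; last by rewrite -(prednK (g_gt0 n)).
rewrite big1 // => i _; rewrite nth_default ?mulr0 //.
have := ledeg i (ltn_ord i); move: ltj (g_gt0 n) (g_gt0 i).
by move: (size (g n)) (size (g i)) => u v; lia.
Qed.

Lemma noetherian_mpoly (F : fieldType) (n : nat) : noetherian {mpoly F[n]}.
Proof.
elim: n => [|n IH].
  apply: (@noetherian_surj F _ (@mpolyC 0 F)); last exact: noetherian_field.
  apply: mpoly_ring_ind => [c|[]//|p q [c <-] [d <-]|p q [c <-] [d <-]].
  - by exists c.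
  - by exists (c + d); rewrite rmorphD.
  by exists (c * d); rewrite rmorphM.
pose phi := horner_morph (fun x : {mpoly F[n]} => mulrC ('X_(ord_max : 'I_n.+1)) (mwiden x)).
apply: (@noetherian_surj _ _ phi); last exact: noetherian_poly.
apply: mpoly_ring_ind => [c|i|p q [c <-] [d <-]|p q [c <-] [d <-]].
- by exists (c%:MP)%:P; rewrite /phi /= horner_morphC /= mwidenC.
- case: (unliftP ord_max i) => [j ->|->]; last by exists 'X; exact: horner_morphX.
  exists ('X_j)%:P; rewrite /phi /= horner_morphC /= mwidenX mnmwiden1; congr 'X_[U_(_)].
  by apply: val_inj; rewrite /= /bump leqNgt ltn_ord.
- by exists (c + d); rewrite rmorphD.
by exists (c * d); rewrite rmorphM.
Qed.

(** * Functions with zero derivatives along the group *)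

Section LocallyConstant.
Variables (K : numClosedFieldType) (m' : nat).
Local Notation m := m'.+1.
Local Notation N := (m * m)%N.
Local Notation MP := {mpoly K[N]}.
Implicit Types (p q : MP).
Local Notation I1 := (1%:M : 'M[K]_m).

Definition xvar (l : 'I_N) : MP := 'X_l - (mxvec I1 0 l)%:MP.

(* Membership in the k-th power of the maximal ideal of the identity. *)
Fixpoint mpow (k : nat) p : Prop :=
  if k is k'.+1 then
    exists q : 'I_N -> MP, (forall l, mpow k' (q l)) /\ p = \sum_l xvar l * q l
  else True.

Arguments mpow : simpl never.

Lemma mpow_zero k : mpow k 0.
Proof.
elim: k => // k IH; exists (fun=> 0); split=> //.
by rewrite big1 // => l _; rewrite mulr0.
Qed.

Lemma mpowD k p q : mpow k p -> mpow k q -> mpow k (p + q).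
Proof.
elim: k p q => // k IH _ _ [p [kp ->]] [q [kq ->]]; exists (fun l => p l + q l).
by split=> [l|]; [exact: (IH _ _ (kp l) (kq l)) | rewrite -big_split; apply: eq_bigr => l _; rewrite mulrDr].
Qed.

Lemma mpowMl k p q : mpow k q -> mpow k (p * q).
Proof.
elim: k q => // k IH _ [q [kq ->]]; exists (fun l => p * q l).
by split=> [l|]; [exact: (IH _ (kq l)) | rewrite mulr_sumr; apply: eq_bigr => l _; rewrite mulrCA].
Qed.

Lemma mpowZ k a p : mpow k p -> mpow k (a *: p).
Proof. by rewrite -mul_mpolyC; exact: mpowMl. Qed.

Lemma mpow_sum k (J : Type) (r : seq J) (P : pred J) (F : J -> MP) :
  (forall j, P j -> mpow k (F j)) -> mpow k (\sum_(j <- r | P j) F j).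
Proof. by move=> kF; apply: (big_ind (mpow k)); [exact: mpow_zero|exact: mpowD|]. Qed.

Lemma mpowS k p : mpow k.+1 p -> mpow k p.
Proof.
elim: k p => // k IH _ [q [kq ->]]; exists q; split=> // l; exact: IH.
Qed.

Lemma mpowM j k p q : mpow j p -> mpow k q -> mpow (j + k) (p * q).
Proof.
elim: j p => [|j IH] p; first by move=> _; exact: mpowMl.
move=> [r [jr ->]] kq; rewrite addSn; exists (fun l => r l * q).
by split=> [l|]; [exact: IH (jr l) kq | rewrite mulr_suml; apply: eq_bigr => l _; rewrite mulrA].
Qed.

Lemma mpow_xvar l : mpow 1 (xvar l).
Proof.
exists (fun k => (k == l)%:R); split=> //; rewrite (bigD1 l) //= eqxx mulr1.
by rewrite big1 ?addr0 // => k /negPf->; rewrite mulr0.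
Qed.

Definition grad p : 'rV[K]_N := \row_l ev I1 p^`M(l).
Definition linpart p : MP := \sum_l grad p 0 l *: xvar l.

Lemma mpow_linpart p : mpow 1 (linpart p).
Proof. by apply: mpow_sum => l _; apply/mpowZ/mpow_xvar. Qed.

Lemma taylor2 p : mpow 2 (p - (ev I1 p)%:MP - linpart p).
Proof.
elim/mpoly_ring_ind: p => [c|i|p q IHp IHq|p q IHp IHq].
- rewrite evC subrr sub0r /linpart big1 ?oppr0; first exact: mpow_zero.
  by move=> l _; rewrite mxE mderivC ev0 scale0r.
- rewrite /linpart (bigD1 i) //= mxE mderivXU eqxx -[true%:R]/1 [ev I1 1]rmorph1 scale1r /xvar.
  rewrite [ev _ _]mevalXU big1 ?addr0 ?subrr. exact: (mpow_zero 2).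
  by move=> l li; rewrite mxE mderivXU eq_sym (negPf li) ev0 scale0r.
- have -> : p + q - (ev I1 (p + q))%:MP - linpart (p + q) =
     (p - (ev I1 p)%:MP - linpart p) + (q - (ev I1 q)%:MP - linpart q).
    have -> : linpart (p + q) = linpart p + linpart q.
      rewrite /linpart -big_split /=; apply: eq_bigr => l _.
      by rewrite !mxE mderivD evD scalerDl.
    by rewrite evD mpolyCD; ring.
  exact: mpowD.
have -> : p * q - (ev I1 (p * q))%:MP - linpart (p * q) =
   q * (p - (ev I1 p)%:MP - linpart p) +
   (ev I1 p)%:MP * (q - (ev I1 q)%:MP - linpart q) +
   linpart p * ((q - (ev I1 q)%:MP - linpart q) + linpart q).
  have -> : linpart (p * q) = (ev I1 p)%:MP * linpart q + (ev I1 q)%:MP * linpart p.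
    rewrite /linpart !mulr_sumr -big_split /=; apply: eq_bigr => l _.
    rewrite !mxE mderivM evD !evM !mul_mpolyC !scalerA -scalerDl; congr (_ *: _); ring.
  by rewrite evM mpolyCM; ring.
apply: mpowD; first by apply: mpowD; exact: mpowMl.
apply: (@mpowM 1 1); first exact: mpow_linpart.
by apply: mpowD; [exact: mpowS | exact: mpow_linpart].
Qed.

Lemma mpow1P p : ev I1 p = 0 -> mpow 1 p.
Proof.
move=> p0; have := taylor2 p; rewrite p0 mpolyC0 subr0 => /mpowS h.
by rewrite -(subrK (linpart p) p); apply: mpowD => //; exact: mpow_linpart.
Qed.

Variables (G : 'M[K]_m -> Prop) (lgG : lin_group G).

(** Polynomials whose restriction to G lies in the k-th power of the maximal ideal of G at 1. *)
Definition mpowG k p := exists a b, [/\ p = a + b, mpow k a & vanishes G b].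

Lemma mpowGD k p q : mpowG k p -> mpowG k q -> mpowG k (p + q).
Proof.
move=> [a [b [-> ka vb]]] [c [d [-> kc vd]]]; exists (a + c), (b + d).
by split; [rewrite addrACA | exact: mpowD | exact: vanishesD].
Qed.

Lemma mpowGM j k p q : mpow j p -> mpowG k q -> mpowG (j + k) (p * q).
Proof.
move=> jp [c [d [-> kc vd]]]; exists (p * c), (p * d).
by split; [rewrite mulrDr | exact: mpowM | exact: vanishesMr].
Qed.

Lemma mpow_mpowG k p : mpow k p -> mpowG k p.
Proof. by exists p, 0; rewrite addr0; split=> //; exact: vanishes0. Qed.

Lemma mpowG_sum k (J : Type) (r : seq J) (P : pred J) (F : J -> MP) :
  (forall j, P j -> mpowG k (F j)) -> mpowG k (\sum_(j <- r | P j) F j).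
Proof.
move=> kF; apply: (big_ind (mpowG k)) => //; last exact: mpowGD.
exact/mpow_mpowG/mpow_zero.
Qed.

Lemma ev1_der X p : ev I1 (der X p) = (mxvec X *m (grad p)^T) 0 0.
Proof.
rewrite /der ev_sum mxE; apply: eq_bigr => k _; rewrite evM !mxE mulrC; congr (_ * _).
case/mxvec_indexP: k => i j; rewrite !mxvecE.
have /matrixP/(_ i j) := ev_mul I1 (genmx_var K m') (cmx X).
by rewrite ev_Gx ev_cmx mul1mx mxE.
Qed.

(* The space of gradients at the identity of the equations of G is the
   annihilator of the Lie algebra of G. *)
Lemma lieG_space : exists (g : 'M[K]_N),
  (forall X, (X \in g)%MS <-> lieG G X) /\
  forall d : 'cV[K]_N, g *m d = 0 -> exists p, vanishes G p /\ grad p = d^T.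
Proof.
have [r [B [fB gB Bg]]] := basis_from_predicate (fun v => exists p, vanishes G p /\ v = grad p).
exists (kermx B^T); split=> [X|d gd].
  split=> [/sub_kermxP XB|lX].
    apply: (lieG_at1 lgG) => p vp; rewrite ev1_der.
    have /submxP[u ->] : (grad p <= B)%MS by apply: Bg; exists p.
    by rewrite trmx_mul mulmxA XB mul0mx mxE.
  apply/sub_kermxP/rowP => i; rewrite [RHS]mxE.
  have [p [vp pE]] := gB i; have := lX _ vp _ (lg1 lgG).
  by rewrite ev1_der -pE => <-; rewrite !mxE; apply: eq_bigr => k _; rewrite !mxE.
(* Double annihilator: d is orthogonal to the orthogonal of the row space of B, and the ranks show
   that this forces it into that row space. *)
have dB : (d^T <= B)%MS.
  pose C := kermx (kermx B^T)^T.
  have BC : (B <= C)%MS.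
    by apply/sub_kermxP; rewrite -[LHS]trmxK trmx_mul trmxK mulmx_ker trmx0.
  have : (C <= B)%MS.
    case: (mxrank_leqif_sup BC) => _ <-; rewrite eqn_leq mxrankS //=.
    by rewrite !mxrank_ker mxrank_tr mxrank_ker mxrank_tr subKn // rank_leq_col.
  apply: submx_trans; apply/sub_kermxP.
  by rewrite -trmx_mul gd trmx0.
have [P PP] := boolp.choice gB; case/submxP: dB => u uE.
exists (\sum_i u 0 i *: P i); split.
  by apply: vanishes_sum => i _; apply: vanishesZ; case: (PP i).
rewrite uE; apply/rowP => l; rewrite !mxE (raddf_sum (mderiv l)) /= ev_sum; apply: eq_bigr => i _.
rewrite linearZ /= evZ; congr (_ * _); have [_ /rowP/(_ l)] := PP i.
by rewrite !mxE.
Qed.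

(* Along the Euler field E = sum_j c_j der X_j, where c_j is the j-th coordinate
   of the projection of g - 1 to the Lie algebra, homogeneous parts of degree k
   at the identity are multiplied by k. *)
Lemma flat_infinite_order p :
  (forall X, lieG G X -> vanishes G (der X p)) -> ev I1 p = 0 ->
  forall k, mpowG k p.
Proof.
move=> flat p0; have [g [gP gdual]] := lieG_space.
pose X j := vec_mx (row j g).
have lX j : lieG G (X j) by apply/gP; rewrite vec_mxK row_sub.
pose c j := \sum_l pinvmx g l j *: xvar l.
have c1 j : mpow 1 (c j) by apply: mpow_sum => l _; apply/mpowZ/mpow_xvar.
pose E q := \sum_j c j * der (X j) q.
have ED q r : E (q + r) = E q + E r.
  by rewrite /E -big_split; apply: eq_bigr => j _; rewrite derD mulrDr.
have EM q r : E (q * r) = E q * r + q * E r.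
  rewrite /E mulr_suml mulr_sumr -big_split; apply: eq_bigr => j _ /=.
  by rewrite derM mulrDr mulrA mulrCA.
have Ev q : vanishes G q -> vanishes G (E q).
  by move=> vq; apply: vanishes_sum => j _; apply/vanishesMr/lX.
(* The field E fixes the coordinate x_l to first order along G: what the projection to the Lie
   algebra removes from x_l is annihilated by the Lie algebra, hence by [gdual] is the linear part
   of an equation of G. *)
have Exvar l : mpowG 2 (E (xvar l) - xvar l).
  have -> : E (xvar l) - xvar l =
      \sum_j c j * (der (X j) (xvar l) - (mxvec (X j) 0 l)%:MP)
      - (xvar l - \sum_j mxvec (X j) 0 l *: c j).
    have aux (x y u v : MP) : x = u + v -> x - y = u - (y - v) by move=> ->; ring.
    apply: aux; rewrite -big_split; apply: eq_bigr => j _ /=.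
    by rewrite mulrBr -mul_mpolyC [_ * c j]mulrC subrK.
  apply: mpowGD.
    apply/mpow_mpowG/mpow_sum => j _; apply: (@mpowM 1 1) => //; apply: mpow1P.
    rewrite evB evC ev1_der mxE (bigD1 l) //= big1 => [|k kl].
      rewrite !mxE /xvar mderivB mderivXU eqxx mderivC subr0 -[true%:R]/1.
      by rewrite [ev I1 1]rmorph1 mulr1 addr0 subrr.
    by rewrite !mxE /xvar mderivB mderivXU eq_sym (negPf kl) mderivC subr0 ev0 mulr0.
  pose d : 'cV[K]_N := col l (1%:M - pinvmx g *m g).
  have gd : g *m d = 0.
    by rewrite /d colE mulmxA mulmxBr mulmx1 mulmxA mulmxKpV ?submx_refl // subrr mul0mx.
  have [q [vq qd]] := gdual d gd.
  have e : xvar l - \sum_j mxvec (X j) 0 l *: c j = linpart q.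
    have -> : \sum_j mxvec (X j) 0 l *: c j = \sum_k (pinvmx g *m g) k l *: xvar k.
      rewrite /c; under eq_bigr => j _ do rewrite scaler_sumr.
      rewrite exchange_big; apply: eq_bigr => k _ /=.
      rewrite mxE scaler_suml; apply: eq_bigr => j _.
      by rewrite scalerA vec_mxK mxE mulrC.
    have -> : xvar l = \sum_k (1%:M : 'M[K]_N) k l *: xvar k.
      rewrite (bigD1 l) //= mxE eqxx scale1r big1 ?addr0 // => k /negPf kl.
      by rewrite mxE kl scale0r.
    rewrite -sumrB; apply: eq_bigr => k _; rewrite qd !mxE -scalerBl; congr (_ *: _).
  exists (q - (ev I1 q)%:MP - linpart q), (- q); split; last first.
  - by move=> h Gh; rewrite -sub0r evB ev0 vq // subr0.
  - exact: taylor2.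
  rewrite e (vq _ (lg1 lgG)) mpolyC0 subr0; by rewrite addrAC subrr sub0r.
have euler k q : mpow k q -> mpowG k.+1 (E q - k%:R *: q).
  elim: k q => [|k IH] q.
    move=> _; rewrite scale0r subr0; apply: mpowG_sum => j _.
    by rewrite -[1%N]addn0; apply: mpowGM; [exact: c1 | exact: mpow_mpowG].
  move=> [r [kr ->]].
  have -> : E (\sum_l xvar l * r l) - k.+1%:R *: \sum_l xvar l * r l =
      \sum_l (r l * (E (xvar l) - xvar l) + xvar l * (E (r l) - k%:R *: r l)).
    have -> : E (\sum_l xvar l * r l) = \sum_l E (xvar l * r l).
      apply: (big_morph E ED); rewrite /E big1 // => j _.
      by rewrite linear0 mulr0.
    have aux (x s ex es : MP) : ex * s + x * es - k.+1%:R *: (x * s) =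
        s * (ex - x) + x * (es - k%:R *: s).
      rewrite !scaler_nat mulrS [x * (es - _)]mulrBr mulrnAr.
      by move: (x * s *+ k) => z; ring.
    by rewrite scaler_sumr -sumrB; apply: eq_bigr => l _; rewrite EM aux.
  apply: mpowG_sum => l _; apply: mpowGD.
    by rewrite -[k.+2]addn2; apply: mpowGM; [exact: kr | exact: Exvar].
  by rewrite -[k.+2]add1n; apply: mpowGM; [exact: mpow_xvar | exact: IH (kr l)].
(* As p is flat, E p vanishes on G, whereas E multiplies m^k by k modulo m^(k+1). So k p, and then
   p, lies one power deeper. Division requires k > 0; membership in m itself comes from p(1) = 0. *)
elim=> [|k [a [b [pE ka vb]]]].
  exact: mpow_mpowG.
case: k ka => [|k] ka; first by apply/mpow_mpowG/mpow1P.
have k0 : k.+1%:R != 0 :> K by rewrite pnatr_eq0.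
have [r [s [e1 kr vs]]] := euler _ _ ka.
exists (- (k.+1%:R)^-1 *: r), (b + (k.+1%:R)^-1 *: (E a - s)); split.
- have {1}-> : p = (k.+1%:R)^-1 *: (k.+1%:R *: a) + b.
    by rewrite scalerA mulVf // scale1r.
  have -> : k.+1%:R *: a = E a - (r + s) by rewrite -e1 opprB addrC subrK.
  by rewrite scaleNr -!mul_mpolyC; move: (E a) (_%:MP) => x y; ring.
- exact: mpowZ.
apply: vanishesD => //; apply: vanishesZ; apply: vanishesB => //.
have -> : E a = E p - E b by rewrite pE ED addrK.
by apply: vanishesB; [apply: vanishes_sum => j _; apply/vanishesMr/flat | exact: Ev].
Qed.

(* Krull's intersection theorem: for an ideal J maximal among those meeting the
   ideal of p in m p, every x in m has a power in J, so J contains m^k. *)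
Lemma krull p : (forall k, mpowG k p) ->
  exists a, ev I1 a = 0 /\ vanishes G (p - a * p).
Proof.
move=> pk; pose T q := exists a, ev I1 a = 0 /\ vanishes G (q - a * p).
pose F (J : MP -> Prop) := [/\ [/\ J 0, forall x y, J x -> J y -> J (x + y)
  & forall x y, J y -> J (x * y)], forall x, vanishes G x -> J x
  & forall b, J (b * p) -> T (b * p)].
have FT : F T.
  split=> //; first split.
  - by exists 0; rewrite ev0 mul0r subr0; split=> //; exact: vanishes0.
  - move=> x y [a [a0 va]] [b [b0 vb]]; exists (a + b); rewrite evD a0 b0 addr0; split=> //.
    have -> : x + y - (a + b) * p = (x - a * p) + (y - b * p) by ring.
    exact: vanishesD.
  - move=> x y [a [a0 va]]; exists (x * a); rewrite evM a0 mulr0; split=> //.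
    have -> : x * y - x * a * p = x * (y - a * p) by ring.
    exact: vanishesMr.
  by move=> x vx; exists 0; rewrite ev0 mul0r subr0.
have noethMP := @noetherian_mpoly K N.
have [//|J [[[J0 JD JM] IJ FJ] TJ maxJ]] := noetherian_maximal noethMP _ FT.
  by move=> J' [h _ _].
have Jpow x : ev I1 x = 0 -> exists i, J (x ^+ i).
  (* The quotient ideals (J : x^i) increase with i, so the chain condition provides an i where they
     stop growing. *)
  move=> x0; have [i Ji] : exists i, forall y, J (x ^+ i.+1 * y) -> J (x ^+ i * y).
    apply: contrapT => nst; have nst' i : exists y, J (x ^+ i.+1 * y) /\ ~ J (x ^+ i * y).
      apply: contrapT => ny; apply: nst; exists i => y Jy.
      by apply: contrapT => nJy; apply: ny; exists y.
    have [y yP] := boolp.choice nst'; have [n yn] := noethMP y.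
    have [_] := yP n; apply.
    have [c ->] := yn; rewrite mulr_sumr; apply: (big_ind J) => // j _.
    rewrite mulrCA; apply: (JM); have [+ _] := yP j.
    have -> : x ^+ n = x ^+ (n - j.+1) * x ^+ j.+1 by rewrite -exprD subnK.
    by rewrite -mulrA; exact: JM.
  (* By the choice of i, J + (x^i) still meets the ideal of p inside m p: if b p = r + x^i a,
     multiplying by x gives an element of J, so x^(i+1) a and then x^i a lie in J. Maximality puts
     x^i in J. *)
  exists i; pose J' q := exists r a, J r /\ q = r + x ^+ i * a.
  apply: (maxJ J'); last by exists 0, 1; rewrite add0r mulr1.
    split; first split.
    - by exists 0, 0; rewrite mulr0 addr0.
    - move=> _ _ [r [a [Jr ->]]] [s [b [Js ->]]]; exists (r + s), (a + b).
      by split; [exact: JD | rewrite mulrDr addrACA].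
    - move=> z _ [r [a [Jr ->]]]; exists (z * r), (z * a).
      by split; [exact: JM | rewrite mulrDr mulrCA].
    - by move=> z vz; exists z, 0; rewrite mulr0 addr0; split=> //; exact: IJ.
    move=> b [r [a [Jr e]]]; apply: FJ; rewrite e; apply: (JD) => //; apply: Ji.
    have -> : x ^+ i.+1 * a = x * (b * p) + (- x) * r.
      by rewrite e exprS; ring.
    apply: (JD); last exact: JM.
    apply: TJ; exists (x * b); rewrite evM x0 mul0r; split=> //.
    by rewrite mulrA subrr; exact: vanishes0.
  by move=> z Jz; exists z, 0; rewrite mulr0 addr0.
have xvar0 l : ev I1 (xvar l) = 0 by rewrite /xvar evB evC [ev _ _]mevalXU subrr.
have [e eP] := boolp.choice (fun l => Jpow (xvar l) (xvar0 l)).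
pose c := (\sum_l e l)%N.
have Jc l : J (xvar l ^+ c).
  rewrite /c (bigD1 l) //= addnC exprD; apply: JM; exact: eP.
(* Pigeonhole: a monomial of degree at least N c in the N variables [xvar l] contains some [xvar l]
   to the power c, which lies in J. The exponents f collect the factors already extracted from q. *)
have Jm j q (f : 'I_N -> nat) : mpow j q -> (N * c <= \sum_l f l + j)%N ->
    J (\prod_l xvar l ^+ f l * q).
  elim: j q f => [|j IH] q f jq.
    rewrite addn0 => Nc; have [l cl] : exists l, (c <= f l)%N.
      apply: contrapT => nl; move: Nc; rewrite leqNgt => /negP; apply.
      have N0 : (0 < N)%N by [].
      have : (\sum_l (f l).+1 <= N * c)%N.
        rewrite -[X in (_ <= X * _)%N]card_ord -sum_nat_const; apply: leq_sum => l _.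
        by rewrite ltnNge; apply/negP => h; apply: nl; exists l.
      under eq_bigr => l _ do rewrite -addn1.
      by rewrite big_split /= sum1_card card_ord; apply: leq_trans; rewrite -ltn_subLR ?subnn.
    rewrite (bigD1 l) //= -(subnK cl) exprD; move: (\prod_(_ | _) _) => R.
    have -> : xvar l ^+ (f l - c) * xvar l ^+ c * R * q =
        (xvar l ^+ (f l - c) * R * q) * xvar l ^+ c by ring.
    exact: JM.
  case: jq => r [jr ->] Nc; rewrite mulr_sumr; apply: (big_ind J) => // l _.
  have := IH (r l) (fun k => (f k + (k == l))%N) (jr l).
  have -> : \prod_k xvar k ^+ (f k + (k == l)) = \prod_k xvar k ^+ f k * xvar l.
    rewrite (bigD1 l) //= [in RHS](bigD1 l) //= eqxx addn1 exprSr -!mulrA; congr (_ * _).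
    rewrite mulrC; congr (_ * _); apply: eq_bigr => k /negPf->.
    by rewrite addn0.
  rewrite mulrA; apply; apply: leq_trans Nc _.
  rewrite big_split /= -addnA leq_add2l (bigD1 l) //= eqxx add1n.
  by rewrite -addn1 addnC leq_add2r leq_addr.
have [a [b [pE ka vb]]] := pk (N * c)%N.
have Jp : J p.
  rewrite pE; apply: (JD); last exact: IJ.
  have e0 : \prod_(l < N) xvar l ^+ 0 = 1 by rewrite big1.
  by have := Jm _ _ (fun=> 0%N) ka; rewrite e0 mul1r; apply; exact: leq_addl.
by have := FJ 1; rewrite mul1r => /(_ Jp).
Qed.

Definition zariski_connected := forall S1 S2 : MP -> Prop,
  (forall g, G g -> (forall p, S1 p -> ev g p = 0) \/ (forall p, S2 p -> ev g p = 0)) ->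
  (forall g, G g -> (forall p, S1 p -> ev g p = 0) -> ~ forall p, S2 p -> ev g p = 0) ->
  (forall g p, G g -> S1 p -> ev g p = 0) \/ (forall g p, G g -> S2 p -> ev g p = 0).

(** Krull's theorem, translated to a zero h of p, provides a function equal to 1 at h whose product
    with p vanishes on G. Thus the zeros of p, cut out by [S1], and the points of G where p is
    nonzero, cut out by these functions in [S2], are both closed in G, and 1 is a zero. *)
Lemma flat_vanishes p : zariski_connected ->
  (forall X, lieG G X -> vanishes G (der X p)) -> ev I1 p = 0 -> vanishes G p.
Proof.
move=> conn flat p0.
have loc h : exists a, G h ->
    ev I1 a = 0 /\ vanishes G ((1 - a) * (ltr h p - (ev h p)%:MP)).
  have [Gh|nGh] := pselect (G h); last by exists 0.
  pose q := ltr h p - (ev h p)%:MP.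
  have [|] := @krull q.
    apply: flat_infinite_order => [X lX|].
      by rewrite linearB /= derC subr0 der_ltr; apply: (vanishes_ltr lgG) => //; exact: flat.
    by rewrite evB evC ev_ltr mulmx1 subrr.
  by move=> a [a0 va]; exists a => _; rewrite mulrBl mul1r.
have [a aP] := boolp.choice loc.
pose S1 q := q = p.
pose S2 q := exists h, [/\ G h, ev h p = 0 & q = ltr (invmx h) (1 - a h)].
case: (conn S1 S2) => [g Gg|g Gg S1g S2g|h|h].
- have [gp|gp] := eqVneq (ev g p) 0; first by left => q ->.
  right=> q [h [Gh hp ->]]; have [_ /(_ (invmx h *m g))] := aP h Gh.
  rewrite evM evB evC ev_ltr mulKVmx ?(lg_unit lgG) // hp subr0 ev_ltr => /(_ _)/eqP.
  by rewrite mulf_eq0 (negPf gp) orbF => /(_ _)/eqP; apply; apply: (lgM lgG) => //; exact: (lgV lgG).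
- have := S2g (ltr (invmx g) (1 - a g)); rewrite ev_ltr mulVmx ?(lg_unit lgG) //.
  have [a0 _] := aP g Gg; rewrite evB a0 [ev I1 1]rmorph1 subr0 => h.
  have /eqP : 1 = 0 :> K by apply: h; exists g; split=> //; exact: (S1g p erefl).
  by rewrite oner_eq0.
- by move=> g Gg; exact: (h g p Gg erefl).
have := h I1 (ltr (invmx I1) (1 - a I1)) (lg1 lgG); rewrite ev_ltr invmx1 mulmx1.
have [a0 _] := aP I1 (lg1 lgG); rewrite evB a0 [ev I1 1]rmorph1 subr0 => h'.
have /eqP : 1 = 0 :> K.
  by apply: h'; exists I1; rewrite invmx1; split=> //; exact: (lg1 lgG).
by rewrite oner_eq0.
Qed.
End LocallyConstant.

(** * The span of the nilpotent elements *)

Lemma nilpotent_bound (K : numClosedFieldType) n (x : 'M[K]_n.+1) k :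
  x ^+ k = 0 -> x ^+ n.+1 = 0.
Proof.
move=> xk; have := Cayley_Hamilton x.
by rewrite (char_poly_nilpotent xk) rmorphXn /= horner_mx_X.
Qed.

Section NilpotentIdeals.
Variables (K : numClosedFieldType) (m' : nat).
Local Notation m := m'.+1.
Local Notation N := (m * m)%N.
Variables (G : 'M[K]_m -> Prop) (lgG : lin_group G).
Hypothesis traceG : forall u, G u -> (forall h, G h -> \tr (u *m h) = \tr h) -> u = 1%:M.

Definition ad_stable r (A : 'M[K]_(r, N)) := forall g Z,
  G g -> (Z \in A)%MS -> (g *m Z *m invmx g \in A)%MS.

(** Moving every h to the right conjugates the factors X inside the ideal A, so a power of X^(j+1) h
    is a product of many elements of A times a power of h, hence 0. All traces tr (X^(j+1) h) vanish
    and exp X has the same trace pairing with G as 1. By [traceG] exp X = 1, and descending on the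
    order of nilpotency gives X = 0. *)
Lemma nil_ideal0 r (A : 'M[K]_(r, N)) L :
  (forall X, (X \in A)%MS -> lieG G X) -> ad_stable A -> left_chain A L = 0 ->
  forall X, (X \in A)%MS -> X = 0.
Proof.
move=> lA sA A0 X XA.
have nX : X ^+ m = 0.
  apply: (@nilpotent_bound _ _ _ L).
  have := left_chain0_prod (l := nseq L X) A0; rewrite big_nseq size_nseq => h.
  rewrite -[LHS]/(X ^+ L) -iter_mulr_1; apply: h => // f.
  by move/nseqP => [->].
have trXh j h : G h -> \tr (X ^+ j.+1 *m h) = 0.
  move=> Gh; have uh := lg_unit lgG Gh.
  have pow i : exists l : seq 'M[K]_m, [/\ forall f, f \in l -> (f \in A)%MS,
      (i <= size l)%N & (X ^+ j.+1 *m h) ^+ i = (\prod_(f <- l) f) *m h ^+ i].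
    elim: i => [|i [l [lA' il e]]]; first by exists [::]; rewrite big_nil !expr0 mul1mx.
    exists (nseq j.+1 X ++ [seq h *m f *m invmx h | f <- l]); split.
    - move=> f; rewrite mem_cat => /orP[/nseqP[->]//|/mapP[f' /lA' f'A ->]].
      exact: sA.
    - by rewrite size_cat size_nseq size_map addSn ltnS (leq_trans il) // leq_addl.
    have -> : \prod_(f <- nseq j.+1 X ++ [seq h *m f *m invmx h | f <- l]) f =
        X ^+ j.+1 *m \prod_(f <- l) (h *m f *m invmx h).
      by rewrite big_cat big_map big_nseq iter_mulr_1.
    rewrite [LHS]exprS e.
    have -> : \prod_(f <- l) (h *m f *m invmx h) = h *m (\prod_(f <- l) f) *m invmx h.
      elim: (l) => [|f l' IH]; first by rewrite !big_nil mulmx1 mulmxV.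
      rewrite !big_cons IH -!mulmxE !mulmxA; congr (_ *m _ *m _).
      by rewrite mulmxKV.
    rewrite (exprS h i) -!mulmxE !mulmxA; congr (_ *m _).
    by rewrite mulmxKV.
  have [l [lA' Ll e]] := pow L; apply: (@nilpotent_tr0 _ _ L).
  by rewrite e (left_chain0_prod A0) // mul0mx.
have eX1 : exp_nilp X = 1%:M.
  apply: traceG => [|h Gh]; first by apply: (exp_nilp_in lgG) => //; exact: lA.
  rewrite /exp_nilp mulmx_suml raddf_sum big_ord_recl /= fact0 invr1 scale1r expr0 mul1mx.
  rewrite big1 ?addr0 // => j _; rewrite -scalemxAl linearZ /=.
  by rewrite [X in \tr (_ ^+ X *m _)]/= trXh ?mulr0.
have tail0 : \sum_(j < m') ((lift ord0 j)`!%:R)^-1 *: X ^+ (lift ord0 j) = 0.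
  have := eX1; rewrite /exp_nilp big_ord_recl /= fact0 invr1 scale1r expr0.
  by move/eqP; rewrite -subr_eq0 addrC addKr => /eqP.
have desc k : X ^+ k.+2 = 0 -> X ^+ k.+1 = 0.
  move=> Xk; have := congr1 (mulmx (X ^+ k)) tail0; rewrite mulmx0 mulmx_sumr.
  case: (m') X nX Xk {A XA A0 lA sA trXh eX1 tail0} => [|m''] Y nY Yk.
    by rewrite exprS -[Y]expr1 nY mul0r.
  rewrite big_ord_recl big1 => [|j _].
    by rewrite /= invr1 scale1r expr1 addr0 exprSr.
  rewrite -scalemxAr /= /bump /= !add1n mulmxE -exprD !addnS.
  have -> : (k + j).+2 = (j + k.+2)%N by rewrite !addnS addnC.
  by rewrite exprD Yk mulr0 scaler0.
have : forall k, X ^+ k.+1 = 0 -> X = 0.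
  by elim=> [|k IH]; [rewrite expr1 | move/desc].
by move=> /(_ m'); apply.
Qed.

Lemma engel_ideal0 r (A : 'M[K]_(r, N)) :
  (forall X, (X \in A)%MS -> lieG G X) -> ad_stable A ->
  (forall x y, (x \in A)%MS -> (y \in A)%MS -> (lie x y \in A)%MS) ->
  (forall x, (x \in A)%MS -> x ^+ m = 0) ->
  forall X, (X \in A)%MS -> X = 0.
Proof.
move=> lA sA cA nA; have [L AL] := engel cA nA; exact: nil_ideal0 AL.
Qed.

Lemma mx_space_ind r (A : 'M[K]_(r, N)) (P : 'M[K]_m -> Prop) :
  P 0 -> (forall x y, P x -> P y -> P (x + y)) -> (forall a x, P x -> P (a *: x)) ->
  (forall i, P (vec_mx (row i A))) -> forall x, (x \in A)%MS -> P x.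
Proof.
move=> P0 PD PZ PA x /submxP[u xu].
have -> : x = \sum_i u 0 i *: vec_mx (row i A).
  apply: (can_inj mxvecK); rewrite xu mulmx_sum_row linear_sum; apply: eq_bigr => i _.
  by rewrite linearZ /= vec_mxK.
by apply: (big_ind P) => // i _; apply: PZ.
Qed.

Lemma mx_space_sub r1 r2 (A1 : 'M[K]_(r1, N)) (A2 : 'M[K]_(r2, N)) :
  (forall x : 'M_m, (x \in A1)%MS -> (x \in A2)%MS) -> (A1 <= A2)%MS.
Proof.
move=> A12; apply/row_subP => i; rewrite -[row i A1]vec_mxK; apply: A12.
by rewrite vec_mxK row_sub.
Qed.

(** The basis vectors are themselves nilpotent, so that linear statements on the span are checked on
    nilpotent elements only. *)
Lemma nilpotent_basis : exists r (B : 'M[K]_(r, N)),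
  [/\ row_free B,
      forall i, lieG G (vec_mx (row i B)) /\ (vec_mx (row i B)) ^+ m = 0
    & forall X, lieG G X -> X ^+ m = 0 -> (X \in B)%MS].
Proof.
have [r [B [fB PB BP]]] := basis_from_predicate (fun v =>
  lieG G (vec_mx v) /\ (vec_mx v : 'M[K]_m) ^+ m = 0).
by exists r, B; split=> // X lX nX; apply: BP; rewrite mxvecK.
Qed.

Variables (r : nat) (B : 'M[K]_(r, N)).
Hypothesis fB : row_free B.
Hypothesis nilB : forall i, lieG G (vec_mx (row i B)) /\ (vec_mx (row i B)) ^+ m = 0.
Hypothesis Bnil : forall X, lieG G X -> X ^+ m = 0 -> (X \in B)%MS.

Lemma lieG_B X : (X \in B)%MS -> lieG G X.
Proof.
apply: mx_space_ind => [|x y lx ly|a x lx|i].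
- by move=> p vp g Gg; have := der_scale p 0 0; rewrite !scale0r => ->; rewrite ev0.
- exact: lieGD.
- exact: lieGZ.
by have [] := nilB i.
Qed.

Lemma ad_stable_gen r' (A : 'M[K]_(r', N)) :
  (forall g i, G g -> (g *m vec_mx (row i A) *m invmx g \in A)%MS) -> ad_stable A.
Proof.
move=> sA g Z Gg; apply: (@mx_space_ind _ A (fun Z => (g *m Z *m invmx g \in A)%MS)) => [|x y xA yA|a x xA|i].
- by rewrite mulmx0 mul0mx linear0 sub0mx.
- by rewrite mulmxDr mulmxDl; exact: memmxD.
- by rewrite -scalemxAr -scalemxAl; exact: memmxZ.
exact: sA.
Qed.

Lemma expr_conj g (Z : 'M[K]_m) k : g \in unitmx ->
  (g *m Z *m invmx g) ^+ k = g *m Z ^+ k *m invmx g.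
Proof.
move=> ug; elim: k => [|k IH]; first by rewrite !expr0 mulmx1 mulmxV.
by rewrite !exprS IH -!mulmxE !mulmxA mulmxKV.
Qed.

Lemma lie_conj g (Y Z : 'M[K]_m) : g \in unitmx ->
  g *m lie Y Z *m invmx g = lie (g *m Y *m invmx g) (g *m Z *m invmx g).
Proof.
by move=> ug; rewrite /lie mulmxBr mulmxBl !mulmxA !(mulmxKV ug).
Qed.

Lemma tr_conj g (Z : 'M[K]_m) : g \in unitmx -> \tr (g *m Z *m invmx g) = \tr Z.
Proof. by move=> ug; rewrite mxtrace_mulC mulmxA mulVmx // mul1mx. Qed.

Lemma ad_stable_B : ad_stable B.
Proof.
apply: ad_stable_gen => g i Gg; have [li ni] := nilB i.
apply: Bnil; first exact: lieG_conj.
by rewrite expr_conj ?(lg_unit lgG) // ni mulmx0 mul0mx.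
Qed.

Lemma bracket_space r1 r2 (A1 : 'M[K]_(r1, N)) (A2 : 'M[K]_(r2, N)) :
  ad_stable A1 -> ad_stable A2 -> exists s (C : 'M[K]_(s, N)),
  [/\ row_free C, ad_stable C,
      forall x y, (x \in A1)%MS -> (y \in A2)%MS -> (lie x y \in C)%MS
    & forall x, (x \in C)%MS -> exists (a b : 'I_s -> 'M[K]_m),
       [/\ forall i, (a i \in A1)%MS, forall i, (b i \in A2)%MS &
           x = \sum_i lie (a i) (b i)]].
Proof.
move=> s1 s2; have [s [C [fC PC CP]]] := basis_from_predicate (fun v =>
  exists x y, [/\ (x \in A1)%MS, (y \in A2)%MS & v = mxvec (lie x y)]).
exists s, C; split=> //.
- apply: ad_stable_gen => g i Gg; have [x [y [xA yA ->]]] := PC i.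
  rewrite mxvecK lie_conj ?(lg_unit lgG) //; apply: CP.
  by exists (g *m x *m invmx g), (g *m y *m invmx g); split; [exact: s1|exact: s2|].
- by move=> x y xA yA; apply: CP; exists x, y.
move=> x /submxP[u xu]; have [a aP] := boolp.choice PC; have [b bP] := boolp.choice aP.
exists (fun i => u 0 i *: a i), b; split=> [i|i|].
- by apply: memmxZ; have [] := bP i.
- by have [] := bP i.
apply: (can_inj mxvecK); rewrite xu mulmx_sum_row linear_sum; apply: eq_bigr => i _.
by rewrite lieZl linearZ /=; have [_ _ ->] := bP i.
Qed.

(** For a nilpotent y that commutes with x, the product x y is nilpotent. *)
Lemma tr_comm_B0 x : (forall y, (y \in B)%MS -> lie x y = 0) ->
  forall y, (y \in B)%MS -> \tr (x *m y) = 0.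
Proof.
move=> cx; apply: mx_space_ind => [|y z hy hz|a y hy|i].
- by rewrite mulmx0 raddf0.
- by rewrite mulmxDr raddfD /= hy hz addr0.
- by rewrite -scalemxAr linearZ /= hy mulr0.
have [_ ni] := nilB i; set y := vec_mx _ in ni *.
have : lie x y = 0 by apply: cx; rewrite vec_mxK row_sub.
move=> /eqP; rewrite subr_eq0 => /eqP xy; apply: (@nilpotent_tr0 _ _ m).
by rewrite mulmxE exprMn_comm // ni mulr0.
Qed.

(** Three ideals are killed in turn by [engel_ideal0]. [A, A] is nilpotent by Cartan's criterion, so
    A is abelian. For z a sum of brackets [a, b] in [A, n], tr z^(j+1) is a sum of terms tr ([a, b]
    z^j), which vanish since a commutes with z; so A is central in n. Finally, for z in A, tr (z^j
    z) = 0 because z^j commutes with n, so A consists of nilpotent elements. *)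
Lemma isotropic_ideal0 r' (A : 'M[K]_(r', N)) :
  (A <= B)%MS -> ad_stable A ->
  (forall x y, (x \in A)%MS -> (y \in A)%MS -> \tr (x *m y) = 0) ->
  forall x, (x \in A)%MS -> x = 0.
Proof.
move=> AB sA trA.
have AB' x : (x \in A)%MS -> (x \in B)%MS by move/submx_trans; apply.
have lA x : (x \in A)%MS -> lieG G x by move/AB'/lieG_B.
have idA x y : lieG G x -> (y \in A)%MS -> (lie x y \in A)%MS.
  by move=> lx yA; apply: (lieG_stabilizes lgG).
have idA' x y : (x \in A)%MS -> lieG G y -> (lie x y \in A)%MS.
  by move=> xA ly; rewrite lieC; apply/memmxN/idA.
have abA x y : (x \in A)%MS -> (y \in A)%MS -> lie x y = 0.
  have [s [C [_ sC CP C_P]]] := bracket_space sA sA.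
  have CA z : (z \in C)%MS -> (z \in A)%MS.
    by move=> /C_P[a [b [aA bA ->]]]; apply: memmx_sum => i _; apply: idA => //; exact: lA.
  move=> xA yA; apply: (engel_ideal0 (A := C)) (CP _ _ xA yA) => //.
  - by move=> z /CA/lA.
  - by move=> z w /CA zA /CA wA; exact: CP.
  move=> z /C_P[a [b [aA bA ->]]]; apply: (@cartan_nilpotent _ _ _ A) => //.
  by move=> u v uA vA; apply: idA => //; exact: lA.
have cA x y : (x \in A)%MS -> (y \in B)%MS -> lie x y = 0.
  have [s [C [_ sC CP C_P]]] := bracket_space sA ad_stable_B.
  have CA z : (z \in C)%MS -> (z \in A)%MS.
    move=> /C_P[a [b [aA bA ->]]]; apply: memmx_sum => i _.
    by apply: idA' => //; exact: lieG_B.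
  move=> xA yB; apply: (engel_ideal0 (A := C)) (CP _ _ xA yB) => //.
  - by move=> z /CA/lA.
  - by move=> z w /CA zA /CA wA; rewrite abA // linear0 sub0mx.
  move=> z zC; have zA := CA _ zC; have [a [b [aA bA zE]]] := C_P _ zC.
  apply: tr0_nilpotent => j; rewrite exprS {1}zE -mulmxE mulmx_suml raddf_sum big1 // => i _.
  have ca : a i *m z ^+ j = z ^+ j *m a i.
    have /eqP := abA _ _ (aA i) zA; rewrite subr_eq0 => /eqP c.
    exact: (commrX j (c : GRing.comm (a i) z)).
  rewrite /= /lie mulmxBl raddfB /= -[b i *m a i *m _]mulmxA ca.
  by rewrite [b i *m (_ *m _)]mulmxA [X in _ - X]mxtrace_mulC mulmxA subrr.
move=> x xA; apply: (engel_ideal0 (A := A)) xA => //.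
  by move=> z w zA wA; rewrite abA // linear0 sub0mx.
move=> z zA; apply: tr0_nilpotent => j; rewrite exprSr -mulmxE.
apply: tr_comm_B0 (AB' _ zA) => y yB.
have /eqP := cA _ _ zA yB; rewrite subr_eq0 => /eqP c.
apply/eqP; rewrite subr_eq0; apply/eqP.
by have /commrX c' : GRing.comm y z by []; exact: (esym (c' j)).
Qed.

Lemma predicate_space (P : 'M[K]_m -> Prop) : P 0 ->
  (forall x y, P x -> P y -> P (x + y)) -> (forall a x, P x -> P (a *: x)) ->
  exists s (A : 'M[K]_(s, N)), forall x, (x \in A)%MS <-> P x.
Proof.
move=> P0 PD PZ.
have [s [A [_ PA AP]]] := basis_from_predicate (fun v => P (vec_mx v)).
exists s, A => x; split=> [|Px]; last by apply: AP; rewrite mxvecK.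
exact: mx_space_ind.
Qed.

(** The radical of the trace form on n is an isotropic ideal. *)
Lemma trace_form_nondegenerate x : (x \in B)%MS ->
  (forall y, (y \in B)%MS -> \tr (x *m y) = 0) -> x = 0.
Proof.
move=> xB trx; pose P z := (z \in B)%MS /\ forall y, (y \in B)%MS -> \tr (z *m y) = 0.
have [|z w [zB hz] [wB hw]|a z [zB hz]|s [A AP]] := @predicate_space P.
- by rewrite /P linear0 sub0mx; split=> // y _; rewrite mul0mx raddf0.
- split; first exact: memmxD.
  by move=> y yB; rewrite mulmxDl raddfD /= hz // hw // addr0.
- split; first exact: memmxZ.
  by move=> y yB; rewrite -scalemxAl linearZ /= hz // mulr0.
apply: (@isotropic_ideal0 _ A); last by apply/AP.
- by apply: mx_space_sub => z /AP[].
- move=> g z Gg /AP[zB hz]; apply/AP; split; first exact: ad_stable_B.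
  have ug := lg_unit lgG Gg; have Gi := lgV lgG Gg.
  move=> y yB; rewrite -(tr_conj _ (lg_unit lgG Gi)) invmxK.
  have := hz _ (ad_stable_B Gi yB); rewrite invmxK => e; rewrite -[RHS]e.
  by rewrite !mulmxA mulVmx // mul1mx -!mulmxA.
by move=> z w /AP[zB hz] /AP[wB _]; exact: hz.
Qed.

(** If z in n is orthogonal to [n, n], then tr ([z, y] w) = tr (z [y, w]) = 0, so z commutes with n
    by nondegeneracy, is orthogonal to n by [tr_comm_B0], and vanishes. The pairing of n with [n, n]
    thus bounds the dimension of n by that of [n, n]. *)
Lemma nilpotent_span_perfect x : (x \in B)%MS -> exists s (a b : 'I_s -> 'M[K]_m),
  [/\ forall i, (a i \in B)%MS, forall i, (b i \in B)%MS & x = \sum_i lie (a i) (b i)].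
Proof.
have [s [C [fC sC CP C_P]]] := bracket_space ad_stable_B ad_stable_B.
have lieB y z : (y \in B)%MS -> (z \in B)%MS -> (lie y z \in B)%MS.
  by move=> yB zB; apply: (lieG_stabilizes lgG ad_stable_B) => //; exact: lieG_B.
have CB : (C <= B)%MS.
  apply: mx_space_sub => z /C_P[a [b [aB bB ->]]].
  by apply: memmx_sum => i _; exact: lieB.
suff BC : (B <= C)%MS.
  by move=> /submx_trans/(_ BC)/C_P[a [b h]]; exists s, a, b.
case: (mxrank_leqif_sup CB) => le_r <-.
rewrite eqn_leq le_r (eqP fB) (eqP fC) /=.
pose M : 'M[K]_(r, s) := \matrix_(i, j) \tr (vec_mx (row i B) *m vec_mx (row j C)).
suff fM : row_free M by rewrite -(eqP fM) rank_leq_col.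
rewrite -kermx_eq0; apply/rowV0P => u /sub_kermxP uM.
pose z := vec_mx (u *m B).
have zB : (z \in B)%MS by rewrite vec_mxK submxMl.
have zC : forall w, (w \in C)%MS -> \tr (z *m w) = 0.
  apply: mx_space_ind => [|w1 w2 h1 h2|a w1 h1|j].
  - by rewrite mulmx0 raddf0.
  - by rewrite mulmxDr raddfD /= h1 h2 addr0.
  - by rewrite -scalemxAr linearZ /= h1 mulr0.
  have := congr1 (fun A : 'rV_s => A 0 j) uM; rewrite !mxE => e; rewrite -[RHS]e.
  rewrite /z mulmx_sum_row linear_sum mulmx_suml raddf_sum; apply: eq_bigr => i _ /=.
  by rewrite linearZ /= -scalemxAl linearZ /= mxE.
have z0 : z = 0.
  apply: trace_form_nondegenerate => // y yB; apply: (tr_comm_B0 _ yB) => {}y {}yB.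
  apply: trace_form_nondegenerate; first exact: lieB.
  move=> w wB; have := zC _ (CP _ _ yB wB); rewrite /lie mulmxBr mulmxBl !raddfB /= => <-.
  by rewrite mulmxA; congr (_ - _); rewrite -mulmxA mxtrace_mulC -mulmxA.
apply: (row_free_inj fB); rewrite mul0mx; apply: (can_inj vec_mxK).
by rewrite -/z z0 linear0.
Qed.
End NilpotentIdeals.

(** * Linear reductivity *)

Section Representations.
Variables (K : numClosedFieldType) (m' : nat).
Local Notation m := m'.+1.
Local Notation N := (m * m)%N.
Local Notation MP := {mpoly K[N]}.
Local Notation Gx := (genmx_var K m').
Local Notation I1 := (1%:M : 'M[K]_m).
Variables (G : 'M[K]_m -> Prop) (lgG : lin_group G).

Definition inv_poly (p : MP) : MP := p \mPo [tuple mxvec (\adj Gx) 0 l | l < N].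

Lemma ev_inv_poly g p : G g -> ev g (inv_poly p) = ev (invmx g) p.
Proof.
move=> Gg; rewrite /ev comp_mpoly_meval; apply: meval_eq => l.
rewrite tnth_mktuple -(lg_adj lgG Gg); case/mxvec_indexP: l => i j; rewrite !mxvecE.
have := map_mx_adj (ev g) Gx; rewrite ev_Gx => /matrixP/(_ i j); by rewrite mxE.
Qed.

Section OneRepresentation.
Variables (k : nat) (pi : 'M[MP]_k).
Definition rep_at g : 'M[K]_k := map_mx (ev g) pi.

Record regular_rep : Prop := RegularRep {
  rr1 : rep_at 1%:M = 1%:M;
  rrM : forall g h, G g -> G h -> rep_at (g *m h) = rep_at g *m rep_at h
}.
Hypothesis rpi : regular_rep.
Implicit Types (X Y g h : 'M[K]_m).

Lemma rr_invr g : G g -> rep_at g *m rep_at (invmx g) = 1%:M.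
Proof.
by move=> Gg; rewrite -(rrM rpi) ?mulmxV ?(lg_unit lgG) ?(rr1 rpi) //; exact: (lgV lgG).
Qed.

Lemma rr_invl g : G g -> rep_at (invmx g) *m rep_at g = 1%:M.
Proof.
by move=> Gg; rewrite -(rrM rpi) ?mulVmx ?(lg_unit lgG) ?(rr1 rpi) //; exact: (lgV lgG).
Qed.

Definition drep X : 'M[K]_k := map_mx (ev I1) (map_mx (der X) pi).

Lemma drepE X a b : drep X a b = ev I1 (der X (pi a b)).
Proof. by rewrite mxE [X in ev _ X]mxE. Qed.

(** Elements of the Lie algebra differentiate functions on G, so identities of [pi] that hold on G
    only may be differentiated. *)
Lemma ev_eq_der X p q g : lieG G X -> G g ->
  (forall h, G h -> ev h p = ev h q) -> ev g (der X p) = ev g (der X q).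
Proof.
move=> lX Gg e; apply/eqP; rewrite -subr_eq0 -evB -linearB; apply/eqP.
by apply: (lX (p - q)) => // h Gh; rewrite evB e // subrr.
Qed.

Lemma ev_der_rep X g : lieG G X -> G g ->
  map_mx (ev g) (map_mx (der X) pi) = rep_at g *m drep X.
Proof.
move=> lX Gg; apply/matrixP => a b; rewrite [LHS]mxE [X in ev g X]mxE.
have <- : ev I1 (ltr g (der X (pi a b))) = ev g (der X (pi a b)).
  by rewrite ev_ltr mulmx1.
rewrite -der_ltr (@ev_eq_der _ _ (\sum_c ev g (pi a c) *: pi c b) _ lX (lg1 lgG)).
  rewrite linear_sum ev_sum mxE; apply: eq_bigr => c _.
  by rewrite linearZ evZ !mxE.
move=> h Gh; rewrite ev_ltr ev_sum; have /matrixP/(_ a b) := rrM rpi Gg Gh.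
by rewrite !mxE => ->; apply: eq_bigr => c _; rewrite evZ !mxE.
Qed.

Lemma ev_der_repE X g a b : lieG G X -> G g ->
  ev g (der X (pi a b)) = (rep_at g *m drep X) a b.
Proof. by move=> lX Gg; rewrite -ev_der_rep // [RHS]mxE [X in _ = ev _ X]mxE. Qed.

Lemma drepD X Y : drep (X + Y) = drep X + drep Y.
Proof.
apply/matrixP => a b; rewrite [RHS]mxE; apply: (etrans (drepE _ _ _)).
by rewrite der_is_additive evD; congr (_ + _); exact: (esym (drepE _ _ _)).
Qed.

Lemma drepZ c X : drep (c *: X) = c *: drep X.
Proof.
apply/matrixP => a b; rewrite [RHS]mxE; apply: (etrans (drepE _ _ _)).
by rewrite der_scale evZ; congr (_ * _); exact: (esym (drepE _ _ _)).
Qed.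

Lemma drep_sum (I : Type) (r : seq I) (F : I -> 'M[K]_m) :
  drep (\sum_(i <- r) F i) = \sum_(i <- r) drep (F i).
Proof.
apply: (big_morph drep drepD); have := drepZ 0 0; by rewrite !scale0r.
Qed.

Lemma ev_der_der X Y g a b : lieG G X -> lieG G Y -> G g ->
  ev g (der X (der Y (pi a b))) = (rep_at g *m drep X *m drep Y) a b.
Proof.
move=> lX lY Gg.
rewrite (@ev_eq_der _ _ (\sum_c drep Y c b *: pi a c) _ lX Gg).
  rewrite linear_sum ev_sum mxE; apply: eq_bigr => c _.
  rewrite linearZ evZ mulrC; congr (_ * _).
  exact: ev_der_repE.
move=> h Gh; apply: (etrans (ev_der_repE _ _ lY Gh)); rewrite mxE ev_sum.
by apply: eq_bigr => c _; rewrite evZ mulrC; congr (_ * _); rewrite mxE.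
Qed.

Lemma drep_lie X Y : lieG G X -> lieG G Y -> drep (lie X Y) = lie (drep X) (drep Y).
Proof.
have e1 (A : 'M_k) : rep_at I1 *m A = A by rewrite (rr1 rpi) mul1mx.
move=> lX lY; apply/matrixP => a b; apply: (etrans (drepE _ _ _)).
rewrite -der_lie evB [RHS]mxE [X in _ = _ + X]mxE; congr (_ - _).
  by apply: (etrans (ev_der_der _ _ lX lY (lg1 lgG))); rewrite e1.
by apply: (etrans (ev_der_der _ _ lY lX (lg1 lgG))); rewrite e1.
Qed.

Lemma drep_conj X g : lieG G X -> G g ->
  rep_at g *m drep X *m rep_at (invmx g) = drep (g *m X *m invmx g).
Proof.
move=> lX Gg; apply/matrixP => a b; apply/esym/(etrans (drepE _ _ _)).
have Gi := lgV lgG Gg.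
rewrite -(der_rtr _ _ (mulmxV (lg_unit lgG Gg))) ev_rtr mul1mx.
rewrite (@ev_eq_der _ _ (\sum_c rep_at (invmx g) c b *: pi a c) _ lX Gg).
  rewrite linear_sum ev_sum [RHS]mxE; apply: eq_bigr => c _.
  by rewrite linearZ evZ mulrC; congr (_ * _); exact: ev_der_repE.
move=> h Gh; rewrite ev_rtr ev_sum; have /matrixP/(_ a b) := rrM rpi Gh Gi.
rewrite [X in X = _]mxE => ->; rewrite mxE; apply: eq_bigr => c _.
by rewrite evZ mulrC; congr (_ * _); rewrite mxE.
Qed.

Lemma ev_iter_der X g j : lieG G X -> G g -> forall a b,
  ev g (iter j (der X) (pi a b)) = (rep_at g *m iter j (mulmx (drep X)) 1%:M) a b.
Proof.
move=> lX; elim: j g => [|j IH] g Gg a b; first by rewrite /= mulmx1 mxE.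
rewrite iterS (@ev_eq_der _ _ (\sum_c (iter j (mulmx (drep X)) 1%:M) c b *: pi a c) _ lX Gg).
  rewrite linear_sum ev_sum iterS mulmxA [RHS]mxE; apply: eq_bigr => c _.
  by rewrite linearZ evZ mulrC; congr (_ * _); exact: ev_der_repE.
move=> h Gh; rewrite IH // ev_sum mxE; apply: eq_bigr => c _.
by rewrite evZ mulrC; congr (_ * _); rewrite mxE.
Qed.

Lemma rep_trivial : zariski_connected G -> (forall X, lieG G X -> drep X = 0) ->
  forall g, G g -> rep_at g = 1%:M.
Proof.
move=> conn d0 g Gg; apply/matrixP => a b.
have : vanishes G (pi a b - ((1%:M : 'M[K]_k) a b)%:MP).
  apply: (flat_vanishes lgG conn) => [X lX h Gh|].
    rewrite linearB /= derC subr0; apply: (etrans (ev_der_repE _ _ lX Gh)).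
    by rewrite d0 // mulmx0 mxE.
  have /matrixP/(_ a b) := rr1 rpi; rewrite mxE evB evC => ->; exact: subrr.
by move=> /(_ g Gg)/eqP; rewrite evB evC subr_eq0 => /eqP <-; rewrite mxE.
Qed.

Lemma drep_inv X : lieG G X ->
  map_mx (ev I1) (map_mx (der X) (map_mx inv_poly pi)) = - drep X.
Proof.
move=> lX; apply/eqP; rewrite -addr_eq0 addrC; apply/eqP.
have inv1 : map_mx (ev I1) (map_mx inv_poly pi) = 1%:M.
  rewrite -(rr1 rpi); apply/matrixP => a b; rewrite !mxE ev_inv_poly ?invmx1 //.
  exact: (lg1 lgG).
have : map_mx (ev I1) (map_mx (der X) (pi *m map_mx inv_poly pi)) = 0.
  apply/matrixP => a b; rewrite [RHS]mxE [LHS]mxE [X in ev _ X]mxE.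
  rewrite (@ev_eq_der _ _ ((1%:M : 'M[K]_k) a b)%:MP _ lX (lg1 lgG)).
    by rewrite derC ev0.
  move=> h Gh; rewrite evC -(rr_invr Gh) mxE ev_sum mxE; apply: eq_bigr => c _.
  by rewrite evM !mxE ev_inv_poly.
have r1 : map_mx (ev I1) pi = 1%:M := rr1 rpi.
by rewrite der_mul map_mxD !ev_mul inv1 mulmx1 r1 mul1mx; exact.
Qed.

(* The function g |-> pi(g) M pi(g)^-1 has zero derivative along G. *)
Lemma comm_drep_comm_rep (M : 'M[K]_k) : zariski_connected G ->
  (forall X, lieG G X -> M *m drep X = drep X *m M) ->
  forall g, G g -> M *m rep_at g = rep_at g *m M.
Proof.
move=> conn cM.
pose cst (A : 'M[K]_k) : 'M[MP]_k := map_mx (@mpolyC _ K) A.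
have ev_cst g A : map_mx (ev g) (cst A) = A.
  by apply/matrixP => i j; rewrite !mxE evC.
have der_cst X A : map_mx (der X) (cst A) = 0.
  by apply/matrixP => i j; rewrite !mxE derC.
have [f fD] : exists f : 'M[MP]_k, f = pi *m cst M *m map_mx inv_poly pi.
  by exists (pi *m cst M *m map_mx inv_poly pi).
have fE g : G g -> map_mx (ev g) f = rep_at g *m M *m rep_at (invmx g).
  move=> Gg; rewrite fD !ev_mul ev_cst; congr (_ *m _).
  by apply/matrixP => i j; rewrite !mxE ev_inv_poly.
have vf a b : vanishes G (f a b - (M a b)%:MP).
  apply: (flat_vanishes lgG conn) => [X lX g Gg|]; last first.
    have /matrixP/(_ a b) := fE _ (lg1 lgG); rewrite invmx1 (rr1 rpi) mul1mx mulmx1 mxE.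
    by rewrite evB evC => ->; rewrite subrr.
  rewrite linearB /= derC subr0.
  have <- : ev I1 (ltr g (der X (f a b))) = ev g (der X (f a b)).
    by rewrite ev_ltr mulmx1.
  rewrite -der_ltr (@ev_eq_der _ _ ((cst (rep_at g) *m f *m cst (rep_at (invmx g))) a b) _ lX (lg1 lgG)).
    have -> : ev I1 (der X ((cst (rep_at g) *m f *m cst (rep_at (invmx g))) a b)) =
      (map_mx (ev I1) (map_mx (der X) (cst (rep_at g) *m f *m cst (rep_at (invmx g))))) a b.
      by rewrite [RHS]mxE [X in _ = ev _ X]mxE.
    rewrite !der_mul !der_cst mul0mx add0r mulmx0 addr0 !ev_mul !ev_cst.
    rewrite fD !der_mul der_cst mulmx0 addr0 map_mxD !ev_mul ev_cst drep_inv //.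
    have inv1 : map_mx (ev I1) (map_mx inv_poly pi) = 1%:M.
      rewrite -(rr1 rpi); apply/matrixP => i j; rewrite !mxE ev_inv_poly ?invmx1 //.
      exact: (lg1 lgG).
    have r1 : map_mx (ev I1) pi = 1%:M := rr1 rpi.
    rewrite inv1 mulmx1 r1 mul1mx.
    have -> : map_mx (ev I1) (map_mx (der X) pi) *m M + M *m - drep X = 0.
      by rewrite mulmxN cM // subrr.
    by rewrite mulmx0 mul0mx mxE.
  move=> h Gh; have Ggh := lgM lgG Gg Gh; rewrite ev_ltr.
  have -> : ev (g *m h) (f a b) = map_mx (ev (g *m h)) f a b by rewrite mxE.
  have -> : ev h ((cst (rep_at g) *m f *m cst (rep_at (invmx g))) a b) =
    map_mx (ev h) (cst (rep_at g) *m f *m cst (rep_at (invmx g))) a b by rewrite [RHS]mxE.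
  rewrite !ev_mul !ev_cst !fE // (rrM rpi) //.
  have -> : invmx (g *m h) = invmx h *m invmx g.
    have ug := lg_unit lgG Gg; have uh := lg_unit lgG Gh; have ugh := lg_unit lgG Ggh.
    apply: (can_inj (mulKmx ugh)); rewrite mulmxV // -mulmxA mulKVmx //.
    by rewrite mulmxV.
  rewrite (rrM rpi); [|exact: (lgV lgG)|exact: (lgV lgG)].
  by rewrite !mulmxA.
move=> g Gg; have e : rep_at g *m M *m rep_at (invmx g) = M.
  rewrite -fE //; apply/matrixP => a b; rewrite mxE.
  by have /eqP := vf a b g Gg; rewrite evB evC subr_eq0 => /eqP.
by rewrite -[in LHS]e -[LHS]mulmxA rr_invl // mulmx1.
Qed.
End OneRepresentation.
End Representations.

Section LinearReductivity.
Variables (K : numClosedFieldType) (m' : nat).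
Local Notation m := m'.+1.
Local Notation N := (m * m)%N.
Local Notation MP := {mpoly K[N]}.
Local Notation I1 := (1%:M : 'M[K]_m).
Variables (G : 'M[K]_m -> Prop) (lgG : lin_group G).
Hypothesis traceG : forall u, G u -> (forall h, G h -> \tr (u *m h) = \tr h) -> u = 1%:M.
Hypothesis conn : zariski_connected G.

Lemma drep_fixed k (pi : 'M[MP]_k) (l : 'cV[K]_k) X :
  regular_rep G pi -> (forall g, G g -> rep_at pi g *m l = l) -> lieG G X ->
  drep pi X *m l = 0.
Proof.
move=> rpi lfix lX; apply/matrixP => a b; rewrite mxE [RHS]mxE.
have -> : \sum_j drep pi X a j * l j b = ev I1 (der X (\sum_j l j b *: pi a j)).
  rewrite linear_sum ev_sum; apply: eq_bigr => j _; rewrite linearZ evZ mulrC.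
  by congr (_ * _); exact: drepE.
rewrite (@ev_eq_der _ _ G X _ (l a b)%:MP I1 lX (lg1 lgG)) ?derC ?ev0 // => h Gh.
rewrite evC -[in RHS](lfix h Gh) mxE ev_sum; apply: eq_bigr => j _.
by rewrite evZ mulrC; congr (_ * _); rewrite mxE.
Qed.

(** The coefficients of [pi] are finite sums of eigenvectors of [der S], so some X R with R(0) <> 0
    annihilates [drep pi S]. A power of X does so too and is coprime to R, hence X itself
    annihilates it. *)
Lemma drep_semisimple0 k (pi : 'M[MP]_k.+1) (rs : seq K) (E : K -> 'M[K]_m) S :
  regular_rep G pi -> lieG G S ->
  \sum_(a <- rs) E a = 1%:M -> (forall a, a \in rs -> S *m E a = a *: E a) ->
  forall n, drep pi S ^+ n = 0 -> drep pi S = 0.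
Proof.
move=> rpi lS sE SE n Dn; set D := drep pi S in Dn *.
have [s sP] := boolp.choice (fun ab : 'I_k.+1 * 'I_k.+1 =>
  der_semisimple sE SE (pi ab.1 ab.2)).
pose all := flatten [seq [seq t.1 | t <- s ab] | ab <- enum {: 'I_k.+1 * 'I_k.+1}].
pose R := \prod_(c <- undup all | c != 0) ('X - c%:P).
have Q0 : horner_mx D ('X * R) = 0.
  have hE (Q : {poly K}) a b : ev I1 (poly_act (der S) Q (pi a b)) = horner_mx D Q a b.
    rewrite -[in RHS](coefK Q) poly_def [horner_mx _ _]rmorph_sum /= summxE /poly_act ev_sum.
    apply: eq_bigr => j _; rewrite evZ linearZ mxE; congr (_ * _).
    rewrite (ev_iter_der lgG rpi _ lS (lg1 lgG)) (rr1 rpi) mul1mx rmorphXn /= horner_mx_X.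
    by elim: (nat_of_ord j) a b => [|i IH] a b; rewrite ?iterS ?exprS //; congr (fun_of_matrix (_ *m _) a b); apply/matrixP.
  apply/matrixP => a b; rewrite -hE [RHS]mxE.
  have [piE tP] := sP (a, b); rewrite /= in piE; rewrite piE.
  have pa_sum (s' : seq (K * MP)) : poly_act (der S) ('X * R) (\sum_(t <- s') t.2) =
      \sum_(t <- s') poly_act (der S) ('X * R) t.2.
    elim: s' => [|t s' IH]; first by rewrite !big_nil poly_act0r.
    by rewrite !big_cons poly_actDr IH.
  rewrite pa_sum big1_seq ?ev0 // => t /andP[_ ts].
  rewrite (poly_act_eigen _ (tP t ts)) hornerM hornerX.
  have [->|t0] := eqVneq t.1 0; first by rewrite mul0r scale0r.
  rewrite /R horner_prod (big_rem t.1) /=; last first.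
    rewrite mem_undup; apply/flattenP; exists [seq t.1 | t <- s (a, b)].
      by apply/map_f; rewrite mem_enum.
    exact: map_f.
  by rewrite t0 hornerXsubC subrr mul0r mulr0 scale0r.
have cop : coprimep R ('X ^+ n).
  apply: coprimep_expr; rewrite -[X in coprimep _ X]subr0 -polyC0 coprimep_XsubC.
  rewrite /R; apply: (big_ind (fun p => ~~ root p (0 : K))).
  - by rewrite root1.
  - by move=> p q p0 q0; rewrite rootM negb_or p0.
  by move=> c c0; rewrite root_XsubC eq_sym.
case/Bezout_eq1_coprimepP: cop => -[u v] /= uv.
have := congr1 (fun p => horner_mx D ('X * p)) uv.
have -> : 'X * (u * R + v * 'X^n) = u * ('X * R) + 'X * v * 'X^n by ring.
rewrite rmorphD [X in X + _]rmorphM /= Q0 mulr0 add0r rmorphM rmorphXn /= horner_mx_X Dn.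
by rewrite mulr0 mulr1 horner_mx_X.
Qed.

(** The component [Yc c] of Y of eigenvalue c under ad S is a polynomial in ad S applied to Y, hence
    in the Lie algebra. If c <> 0 it is nilpotent: c tr (Yc^(j+1)) = tr ([S, Yc] Yc^j) = 0. The
    component with c = 0 is killed by ad S. *)
Lemma lie_semisimple_nilpotent r (B : 'M[K]_(r, N)) (rs : seq K) (E : K -> 'M[K]_m) S :
  (forall X, lieG G X -> X ^+ m = 0 -> (X \in B)%MS) -> lieG G S ->
  \sum_(a <- rs) E a = 1%:M ->
  (forall a b, a \in rs -> b \in rs -> E a *m E b = E a *+ (a == b)) -> uniq rs ->
  S = \sum_(a <- rs) a *: E a ->
  forall Y, lieG G Y -> (lie S Y \in B)%MS.
Proof.
move=> Bnil lS sE EE urs SE Y lY.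
have SEl a : a \in rs -> S *m E a = a *: E a.
  move=> ars; rewrite SE mulmx_suml (bigD1_seq a) //= -scalemxAl EE // eqxx.
  rewrite big1_seq ?addr0 // => b /andP[ba brs].
  by rewrite -scalemxAl EE // (negPf ba) scaler0.
have SEr a : a \in rs -> E a *m S = a *: E a.
  move=> ars; rewrite SE mulmx_sumr (bigD1_seq a) //= -scalemxAr EE // eqxx.
  rewrite big1_seq ?addr0 // => b /andP[ba brs].
  by rewrite -scalemxAr EE // eq_sym (negPf ba) scaler0.
pose ds := undup [seq a - b | a <- rs, b <- rs].
pose Yc c := \sum_(a <- rs) \sum_(b <- rs) (c == a - b)%:R *: (E a *m Y *m E b).
have lieE a b : a \in rs -> b \in rs ->
    lie S (E a *m Y *m E b) = (a - b) *: (E a *m Y *m E b).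
  move=> ars brs; rewrite /lie !mulmxA SEl // -!mulmxA SEr // -!scalemxAl -!scalemxAr.
  by rewrite scalerBl.
have lieS_sum (F : K -> 'M[K]_m) : lie S (\sum_(a <- rs) F a) = \sum_(a <- rs) lie S (F a).
  by rewrite /lie mulmx_sumr mulmx_suml sumrB.
have YE : Y = \sum_(a <- rs) \sum_(b <- rs) E a *m Y *m E b.
  rewrite -[LHS]mul1mx -[LHS]mulmx1 -[in LHS]sE !mulmx_suml.
  by apply: eq_bigr => a _; rewrite mulmx_sumr.
have iterE j : iter j (lie S) Y =
    \sum_(a <- rs) \sum_(b <- rs) (a - b) ^+ j *: (E a *m Y *m E b).
  elim: j => [|j IH].
    by rewrite {1}YE; apply: eq_bigr => a _; apply: eq_bigr => b _; rewrite expr0 scale1r.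
  rewrite iterS IH lieS_sum; apply: eq_big_seq => a ars; rewrite lieS_sum.
  by apply: eq_big_seq => b brs; rewrite lieZr lieE // scalerA exprSr.
have lYc c : lieG G (Yc c).
  have [Q QP] := poly_crt ds 1 (fun d => (c == d)%:R).
  have -> : Yc c = \sum_(j < size Q) Q`_j *: iter j (lie S) Y.
    have -> : \sum_(j < size Q) Q`_j *: iter j (lie S) Y =
        \sum_(a <- rs) \sum_(b <- rs) Q.[a - b] *: (E a *m Y *m E b).
      under eq_bigr => j _ do rewrite iterE scaler_sumr.
      rewrite exchange_big; apply: eq_bigr => a _ /=.
      under eq_bigr => j _ do rewrite scaler_sumr.
      rewrite exchange_big; apply: eq_bigr => b _ /=.
      by rewrite horner_coef scaler_suml; apply: eq_bigr => j _; rewrite scalerA.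
    apply: eq_big_seq => a ars; apply: eq_big_seq => b brs; congr (_ *: _).
    have := QP (a - b); rewrite expr1 dvdp_XsubCl => /(_ _)/rootP.
    rewrite hornerD hornerN hornerC => h; apply/esym/eqP; rewrite -subr_eq0 h //.
    by rewrite mem_undup; apply/allpairsP; exists (a, b).
  have l0 : lieG G 0 by have := lieGZ 0 lS; rewrite scale0r.
  apply: (big_ind (lieG G)) => [//|x y|j _]; first exact: lieGD.
  apply: lieGZ; elim: (nat_of_ord j) => [|i IH]; first exact: lY.
  by rewrite iterS; exact: lieG_lie lS IH.
have SYc c : lie S (Yc c) = c *: Yc c.
  rewrite /Yc lieS_sum scaler_sumr; apply: eq_big_seq => a ars.
  rewrite lieS_sum scaler_sumr; apply: eq_big_seq => b brs.
  by rewrite lieZr lieE // !scalerA; case: eqP => [->|_]; rewrite ?mulr0 ?mul0r // mulrC.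
have nYc c : c != 0 -> Yc c ^+ m = 0.
  move=> c0; apply: tr0_nilpotent => j; apply: (mulfI c0); rewrite mulr0.
  rewrite exprS -mulmxE -linearZ scalemxAl -SYc /lie mulmxBl raddfB /= -mulmxA.
  have -> : Yc c *m Yc c ^+ j = Yc c ^+ j *m Yc c by exact: (commrX j (erefl (Yc c * Yc c))).
  by rewrite mulmxA mxtrace_mulC mulmxA subrr.
have -> : lie S Y = \sum_(c <- ds | c != 0) c *: Yc c.
  have -> : lie S Y = iter 1 (lie S) Y by [].
  rewrite iterE /Yc; apply/esym.
  under eq_bigr => c _ do rewrite scaler_sumr.
  rewrite exchange_big; apply: eq_big_seq => a ars /=.
  under eq_bigr => c _ do rewrite scaler_sumr.
  rewrite exchange_big; apply: eq_big_seq => b brs /=.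
  have abds : a - b \in ds by rewrite mem_undup; apply/allpairsP; exists (a, b).
  rewrite big_mkcond (bigD1_seq (a - b)) ?undup_uniq //= eqxx scale1r expr1.
  rewrite big1 ?addr0; first by case: eqP => [->|_]; rewrite ?scale0r.
  by move=> c /negPf ->; rewrite scale0r scaler0; case: ifP.
apply: memmx_sum => c c0; apply: memmxZ; apply: Bnil; [exact: lYc | exact: nYc].
Qed.

(** The representation on the image of the idempotent E, in the coordinates of the rank
    factorization E = C R. An invariant form on the image is extended by 0 on the kernel of E, by
    composition with R. *)
Lemma restrict_rep k r (pi : 'M[MP]_k) (E : 'M[K]_k) (R : 'M[K]_(r, k))
    (C : 'M[K]_(k, r)) (l : 'cV[K]_k) :
  regular_rep G pi -> C *m R = E -> R *m C = 1%:M ->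
  (forall g, G g -> E *m rep_at pi g = rep_at pi g *m E) ->
  (forall g, G g -> rep_at pi g *m l = l) -> E *m l = l -> l != 0 ->
  exists (pi' : 'M[MP]_r) (l' : 'cV[K]_r),
    [/\ regular_rep G pi', forall g, G g -> rep_at pi' g *m l' = l', l' != 0 &
     (exists v : 'rV[K]_r, (forall g, G g -> v *m rep_at pi' g = v) /\ v *m l' != 0) ->
     exists v : 'rV[K]_k, (forall g, G g -> v *m rep_at pi g = v) /\ v *m l != 0].
Proof.
move=> rpi CR RC cE lfix El l0.
have RE : R *m E = R by rewrite -CR mulmxA RC mul1mx.
have EC : E *m C = C by rewrite -CR -mulmxA RC mulmx1.
pose pi' := map_mx (@mpolyC _ K) R *m pi *m map_mx (@mpolyC _ K) C.
have pi'E g : rep_at pi' g = R *m rep_at pi g *m C.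
  have evc a b (A : 'M[K]_(a, b)) : map_mx (ev g) (map_mx (@mpolyC N K) A) = A.
    by apply/matrixP => i j; rewrite !mxE evC.
  by rewrite /rep_at !ev_mul !evc.
exists pi', (R *m l); split.
- split=> [|g h Gg Gh]; first by rewrite pi'E (rr1 rpi) mulmx1.
  rewrite !pi'E (rrM rpi) // -!mulmxA; congr (_ *m _).
  by rewrite (mulmxA C R) CR (mulmxA E) cE // -(mulmxA _ E) EC.
- move=> g Gg; rewrite pi'E -!mulmxA (mulmxA C R) CR El lfix //.
- apply: contra l0 => /eqP Rl0; by rewrite -El -CR -mulmxA Rl0 mulmx0.
case=> v [vfix vl]; exists (v *m R); split; last by rewrite -mulmxA.
move=> g Gg; have := vfix g Gg; rewrite pi'E => e.
have := congr1 (mulmx^~ R) e; rewrite -!mulmxA CR -cE // (mulmxA R E) RE.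
by rewrite mulmxA.
Qed.

(** The projection to the generalized kernel of [Om] is a polynomial in [Om], so commutes with G; it
    fixes l because the other projections are multiples of [Om] and kill l. Either it is the
    identity and [Om] is nilpotent, or its image is a proper summand that contains l. *)
Lemma fitting k (pi : 'M[MP]_k.+1) (l : 'cV[K]_k.+1) (Om : 'M[K]_k.+1) :
  regular_rep G pi -> (forall g, G g -> rep_at pi g *m l = l) -> l != 0 ->
  (forall g, G g -> Om *m rep_at pi g = rep_at pi g *m Om) -> Om *m l = 0 ->
  Om ^+ k.+1 = 0 \/
  exists (E : 'M[K]_k.+1), [/\ E *m E = E, (\rank E < k.+1)%N, E *m l = l &
    forall g, G g -> E *m rep_at pi g = rep_at pi g *m E].
Proof.
move=> rpi lfix l0 cO Ol; have [rs [P [urs sE EE OE P0]]] := spectralP Om.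
pose E a : 'M[K]_k.+1 := horner_mx Om (P a).
have El a : a \in rs -> a != 0 -> E a *m l = 0.
  move=> ars a0; have : 'X %| P a.
    by rewrite -[X in X %| _]subr0 -polyC0 dvdp_XsubCl; apply/rootP/P0.
  case/dvdpP => Q QE; rewrite /E QE rmorphM /= horner_mx_X -mulmxE -mulmxA Ol.
  by rewrite mulmx0.
have rs0 : 0 \in rs.
  apply: contraT => rs0; case/negP: l0; rewrite -[l]mul1mx -[1%:M]sE mulmx_suml.
  rewrite big1_seq // => a /andP[_ ars]; apply: El => //.
  by apply: contraNneq rs0 => <-.
have E0l : E 0 *m l = l.
  rewrite -[RHS]mul1mx -[1%:M in RHS]sE mulmx_suml (bigD1_seq 0) //=.
  by rewrite big1_seq ?addr0 // => a /andP[a0 ars]; exact: El.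
have E00 : E 0 *m E 0 = E 0 by have := EE 0 0 rs0 rs0; rewrite eqxx.
have [rE|rE] := ltnP (\rank (E 0)) k.+1.
  right; exists (E 0); split=> // g Gg.
  apply/esym/comm_mx_horner; exact: (esym (cO g Gg)).
left; have fE : row_free (E 0) by rewrite /row_free eqn_leq rank_leq_row rE.
have E1 : E 0 = 1%:M by apply: (row_free_inj fE); rewrite mul1mx.
by have := OE 0 rs0; rewrite -[horner_mx _ _]/(E 0) E1 raddf0 subr0 mulr1.
Qed.
End LinearReductivity.

(** * Gram matrices and Casimir operators *)

Section LinearCombinations.
Variables (K : fieldType) (r k : nat).
Implicit Types (c : 'I_r -> 'M[K]_k) (u v : 'rV[K]_r).

Definition lincomb c u : 'M[K]_k := \sum_i u 0 i *: c i.
Definition gram c : 'M[K]_r := \matrix_(i, j) \tr (c i *m c j).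
Definition quad c (C : 'M[K]_r) : 'M[K]_k := \sum_i \sum_j C i j *: (c i *m c j).

Lemma tr_lincomb c u v : \tr (lincomb c u *m lincomb c v) = (u *m gram c *m v^T) 0 0.
Proof.
rewrite /lincomb mulmx_suml raddf_sum -mulmxA mxE; apply: eq_bigr => i _ /=.
rewrite mulmx_sumr raddf_sum mxE big_distrr; apply: eq_bigr => j _ /=.
rewrite -scalemxAl -scalemxAr !linearZ /= !mxE; ring.
Qed.

Lemma gram_sym c : (gram c)^T = gram c.
Proof. by apply/matrixP => i j; rewrite !mxE mxtrace_mulC. Qed.

Lemma quad_lincomb c (a C : 'M[K]_r) :
  quad (fun p => lincomb c (row p a)) C = quad c (a^T *m C *m a).
Proof.
have -> : quad (fun p => lincomb c (row p a)) C =
    \sum_p \sum_q \sum_i \sum_j (a p i * C p q * a q j) *: (c i *m c j).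
  apply: eq_bigr => p _; apply: eq_bigr => q _.
  rewrite /lincomb mulmx_suml scaler_sumr; apply: eq_bigr => i _.
  rewrite mulmx_sumr scaler_sumr; apply: eq_bigr => j _.
  rewrite -scalemxAl -scalemxAr !scalerA; congr (_ *: _); rewrite !mxE.
  by rewrite [a p i * _]mulrC.
transitivity (\sum_i \sum_j \sum_p \sum_q (a p i * C p q * a q j) *: (c i *m c j)).
  under eq_bigr => p _ do rewrite exchange_big /=.
  rewrite exchange_big; apply: eq_bigr => i _ /=.
  under eq_bigr => p _ do rewrite exchange_big /=.
  by rewrite exchange_big.
apply: eq_bigr => i _; apply: eq_bigr => j _; rewrite exchange_big /=.
rewrite mxE scaler_suml; apply: eq_bigr => q _; rewrite mxE big_distrl /= scaler_suml.
by apply: eq_bigr => p _; rewrite !mxE.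
Qed.

Lemma tr_quad c C : \tr (quad c C) = \tr (C *m gram c).
Proof.
rewrite raddf_sum; apply: eq_bigr => i _ /=; rewrite raddf_sum mxE.
by apply: eq_bigr => j _ /=; rewrite linearZ /= mxE mxtrace_mulC.
Qed.

Lemma gram_invariant c (a : 'M[K]_r) :
  (forall p q, \tr (lincomb c (row p a) *m lincomb c (row q a)) = gram c p q) ->
  a *m gram c *m a^T = gram c.
Proof.
move=> h; apply/matrixP => p q; rewrite -h tr_lincomb -row_mul [LHS]mxE [RHS]mxE.
by apply: eq_bigr => i _; rewrite [a^T _ _]mxE [(row q a)^T _ _]mxE [row q a _ _]mxE [row _ _ _ _]mxE.
Qed.
Lemma quad_conj (Rg Ri : 'M[K]_k) c C : Ri *m Rg = 1%:M ->
  Rg *m quad c C *m Ri = quad (fun p => Rg *m c p *m Ri) C.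
Proof.
move=> RR; rewrite /quad mulmx_sumr mulmx_suml; apply: eq_bigr => p _.
rewrite mulmx_sumr mulmx_suml; apply: eq_bigr => q _.
rewrite -scalemxAr -scalemxAl; congr (_ *: _).
have -> : Rg *m c p *m Ri *m (Rg *m c q *m Ri) = Rg *m c p *m (Ri *m Rg) *m c q *m Ri.
  by rewrite !mulmxA.
by rewrite RR mulmx1 !mulmxA.
Qed.

Lemma quad_kernel c C (l : 'cV[K]_k) : (forall i, c i *m l = 0) -> quad c C *m l = 0.
Proof.
move=> cl; rewrite /quad mulmx_suml big1 // => p _; rewrite mulmx_suml big1 // => q _.
by move: (C p q) => a; rewrite -scalemxAl -mulmxA cl mulmx0 scaler0.
Qed.

(** D C^-1 is the operator that relates two bilinear forms invariant under a. *)
Lemma gram_quotient_comm (a C D : 'M[K]_r) : a \in unitmx -> C \in unitmx ->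
  a *m C *m a^T = C -> a *m D *m a^T = D ->
  a *m (D *m invmx C) = D *m invmx C *m a.
Proof.
move=> ua uC aC aD; have uat : a^T \in unitmx by rewrite unitmx_tr.
apply: (can_inj (mulmxK uC)); apply: (can_inj (mulmxK uat)).
rewrite mulmxA mulmxKV // aD.
have -> : D *m invmx C *m a *m C *m a^T = D *m invmx C *m (a *m C *m a^T).
  by rewrite !mulmxA.
by rewrite aC mulmxKV.
Qed.
End LinearCombinations.

Lemma mulmx_commX (F : fieldType) r (a T : 'M[F]_r.+1) i :
  a *m T = T *m a -> a *m T ^+ i = T ^+ i *m a.
Proof.
move=> aT; elim: i => [|i IH]; first by rewrite expr0 mulmx1 mul1mx.
by rewrite exprS -mulmxE mulmxA aT -!mulmxA IH.
Qed.

Section LinearReductivity.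
Variables (K : numClosedFieldType) (m' : nat).
Local Notation m := m'.+1.
Local Notation N := (m * m)%N.
Local Notation MP := {mpoly K[N]}.
Variables (G : 'M[K]_m -> Prop) (lgG : lin_group G).
Hypothesis traceG : forall u, G u -> (forall h, G h -> \tr (u *m h) = \tr h) -> u = 1%:M.
Hypothesis conn : zariski_connected G.

Section Casimir.
Variables (r' : nat).
Local Notation r := r'.+1.
Variable B : 'M[K]_(r, N).
Hypothesis fB : row_free B.
Hypothesis nilB : forall i, lieG G (vec_mx (row i B)) /\ (vec_mx (row i B)) ^+ m = 0.
Hypothesis Bnil : forall X, lieG G X -> X ^+ m = 0 -> (X \in B)%MS.
Variables (k : nat) (pi : 'M[MP]_k.+1) (l : 'cV[K]_k.+1).
Hypotheses (rpi : regular_rep G pi) (lfix : forall g, G g -> rep_at pi g *m l = l).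

Let b (i : 'I_r) : 'M[K]_m := vec_mx (row i B).
Let W (i : 'I_r) : 'M[K]_k.+1 := drep pi (b i).
(** The operator on n that expresses the trace form of [pi] through the trace form of G. *)
Let T : 'M[K]_r := gram W *m invmx (gram b).

Lemma lincomb_b u : mxvec (lincomb b u) = u *m B.
Proof.
rewrite /lincomb linear_sum mulmx_sum_row; apply: eq_bigr => i _.
by rewrite linearZ /= /b vec_mxK.
Qed.

Lemma lincomb_bB u : (lincomb b u \in B)%MS.
Proof. by rewrite lincomb_b submxMl. Qed.

Lemma drep_lincomb u : drep pi (lincomb b u) = lincomb W u.
Proof. by rewrite drep_sum; apply: eq_bigr => i _; rewrite drepZ. Qed.

Lemma in_B x : (x \in B)%MS -> exists u, x = lincomb b u.
Proof. by case/submxP=> u xu; exists u; apply: (can_inj mxvecK); rewrite lincomb_b. Qed.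

Lemma b_in i : (b i \in B)%MS.
Proof. by rewrite /b vec_mxK row_sub. Qed.

Lemma lie_b i : lieG G (b i).
Proof. by case: (nilB i). Qed.

Lemma conj_matrix g : G g -> exists a : 'M[K]_r, a \in unitmx /\
  [/\ forall u, g *m lincomb b u *m invmx g = lincomb b (u *m a),
      a *m gram b *m a^T = gram b & a *m gram W *m a^T = gram W].
Proof.
move=> Gg; have ug := lg_unit lgG Gg.
have cB i : exists u, g *m b i *m invmx g = lincomb b u.
  by apply: in_B; apply: (ad_stable_B lgG nilB Bnil) => //; exact: b_in.
have [f fE] := boolp.choice cB.
pose a : 'M[K]_r := \matrix_(i, j) f i 0 j.
have aE i : g *m b i *m invmx g = lincomb b (row i a).
  rewrite fE; congr lincomb; apply/rowP => j; by rewrite !mxE.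
have conjE u : g *m lincomb b u *m invmx g = lincomb b (u *m a).
  apply: (can_inj mxvecK); rewrite lincomb_b /lincomb mulmx_sumr mulmx_suml linear_sum /=.
  rewrite -mulmxA mulmx_sum_row; apply: eq_bigr => i _.
  by rewrite -scalemxAr -scalemxAl aE linearZ /= lincomb_b row_mul.
have gb : a *m gram b *m a^T = gram b.
  apply: gram_invariant => p q; rewrite -!aE !mulmxA mulmxKV //.
  by rewrite -(mulmxA g) tr_conj // mxE.
have gW : a *m gram W *m a^T = gram W.
  apply: gram_invariant => p q; rewrite -!drep_lincomb -!aE.
  rewrite -(drep_conj lgG rpi (lie_b p) Gg) -(drep_conj lgG rpi (lie_b q) Gg).
  rewrite [RHS]mxE -/(W p) -/(W q); move: (rr_invl lgG rpi Gg).
  move: (W p) (W q) (rep_at pi g) (rep_at pi (invmx g)) => Wp Wq Rg Ri RR.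
  have -> : Rg *m Wp *m Ri *m (Rg *m Wq *m Ri) = Rg *m Wp *m (Ri *m Rg) *m Wq *m Ri.
    by rewrite !mulmxA.
  by rewrite RR mulmx1 mxtrace_mulC !mulmxA RR mul1mx.
exists a; split => //; rewrite -row_free_unit; apply: inj_row_free => u ua.
have : lincomb b u = 0.
  have := conjE u; rewrite ua => /(congr1 (fun y => invmx g *m y *m g)).
  rewrite !mulmxA mulVmx // mul1mx mulmxKV // => ->.
  by rewrite /lincomb big1 ?mulmx0 ?mul0mx // => i _; rewrite mxE scale0r.
move=> /(congr1 mxvec); rewrite lincomb_b linear0 => uB.
by apply: (row_free_inj fB); rewrite uB mul0mx.
Qed.

Lemma gram_b_unit : gram b \in unitmx.
Proof.
rewrite -row_free_unit; apply: inj_row_free => u u0.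
have : lincomb b u = 0.
  apply: (trace_form_nondegenerate lgG traceG nilB Bnil (lincomb_bB u)).
  by move=> y /in_B[v ->]; rewrite tr_lincomb u0 mul0mx mxE.
move=> /(congr1 mxvec); rewrite lincomb_b linear0 => uB.
by apply: (row_free_inj fB); rewrite uB mul0mx.
Qed.

(** For j = 0, the quadratic Casimir operator of the trace form of G. The powers of T, which commute
    with the adjoint action, give further operators commuting with G; their traces are all the power
    sums of T. *)
Definition casimir j : 'M[K]_k.+1 := quad W (invmx (gram b) *m T ^+ j).

Lemma casimir_fixed j : casimir j *m l = 0.
Proof.
have Wl q : W q *m l = 0 by exact: (drep_fixed lgG rpi lfix (lie_b q)).
exact: quad_kernel.
Qed.

Lemma casimir_comm j g : G g -> casimir j *m rep_at pi g = rep_at pi g *m casimir j.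
Proof.
move=> Gg; have [a [ua [aE ab aW]]] := conj_matrix Gg.
have RR := rr_invl lgG rpi Gg.
suff e : rep_at pi g *m casimir j *m rep_at pi (invmx g) = casimir j.
  by rewrite -{1}e -mulmxA RR mulmx1.
have aTb : a^T *m invmx (gram b) *m a = invmx (gram b).
  have ug := gram_b_unit; apply: (can_inj (mulKmx ug)); rewrite mulmxV //.
  apply: (can_inj (mulKmx ua)); rewrite mulmx1 !mulmxA ab mulmxV //.
  by rewrite mul1mx.
have aT : a *m T = T *m a by exact: gram_quotient_comm ua gram_b_unit ab aW.
have aTj : a *m T ^+ j = T ^+ j *m a by exact: mulmx_commX.
rewrite /casimir quad_conj //.
have -> : (fun p => rep_at pi g *m W p *m rep_at pi (invmx g)) =
    fun p => lincomb W (row p a).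
  apply: funext => p; apply: (etrans (drep_conj lgG rpi (lie_b p) Gg)).
  rewrite -drep_lincomb; congr (drep _ _).
  have -> : row p a = row p 1%:M *m a by rewrite -row_mul mul1mx.
  rewrite -aE; congr (_ *m _ *m _).
  by apply: (can_inj mxvecK); rewrite lincomb_b -row_mul mul1mx /b vec_mxK.
rewrite quad_lincomb; congr (quad W _).
by rewrite -!mulmxA -aTj !mulmxA aTb.
Qed.

Lemma tr_casimir j : \tr (casimir j) = \tr (T ^+ j.+1).
Proof.
rewrite /casimir tr_quad -!mulmxA mxtrace_mulC -!mulmxA.
by rewrite -[gram W *m _]/T mulmxE -exprSr.
Qed.

(** Nilpotent Casimir operators have trace 0, so T is nilpotent. T is self-adjoint for the trace
    form of G: if S is a power of T with S S = 0, the image of S is isotropic, and it is stable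
    under G, hence 0 by [isotropic_ideal0]. So T = 0 by descent on the exponent. *)
Lemma gram_W0 : (forall j, casimir j ^+ k.+1 = 0) -> gram W = 0.
Proof.
move=> nC; have ub := gram_b_unit.
have Tn : T ^+ r = 0.
  by apply: tr0_nilpotent => j; rewrite -tr_casimir; exact: nilpotent_tr0 (nC j).
have Tb i : T ^+ i *m gram b = gram b *m (T ^+ i)^T.
  elim: i => [|i IH]; first by rewrite expr0 trmx1 mulmx1 mul1mx.
  rewrite {1}exprSr exprS -!mulmxE trmx_mul.
  have Tb1 : T *m gram b = gram W by rewrite /T mulmxKV.
  have Tb2 : gram b *m T^T = gram W.
    by rewrite -{1}(gram_sym b) -trmx_mul Tb1 gram_sym.
  by rewrite -mulmxA Tb1 -Tb2 mulmxA IH mulmxA.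
suff T1 : T = 0 by rewrite -(mulmxKV ub (gram W)) -/T T1 mul0mx.
suff h i : T ^+ i.+1 = 0 -> T = 0 by apply: (h r'); exact: Tn.
elim: i => [|i IH Ti]; first by rewrite expr1.
apply: IH; set S := T ^+ i.+1.
pose A := S *m B.
have AE x : (x \in A)%MS -> exists u, x = lincomb b (u *m S).
  by case/submxP=> u xu; exists u; apply: (can_inj mxvecK); rewrite lincomb_b xu mulmxA.
have A0 x : (x \in A)%MS -> x = 0.
  apply: (isotropic_ideal0 lgG traceG nilB Bnil).
  - exact: submxMl.
  - move=> g y Gg /AE[u ->]; have [a [ua [aE ab aW]]] := conj_matrix Gg.
    rewrite aE lincomb_b; apply/submxP; exists (u *m a).
    rewrite /A !mulmxA; congr (_ *m _); rewrite -!mulmxA; congr (_ *m _).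
    have aT : a *m T = T *m a by exact: gram_quotient_comm ua gram_b_unit ab aW.
    exact/esym/mulmx_commX.
  - move=> y z /AE[u ->] /AE[v ->]; rewrite tr_lincomb trmx_mul.
    have -> : u *m S *m gram b *m (S^T *m v^T) = u *m (S *m (gram b *m S^T)) *m v^T.
      by rewrite !mulmxA.
    rewrite -(Tb i.+1) -/S (mulmxA S); have -> : S *m S = 0.
      by rewrite /S mulmxE -exprD addnS -addSn exprD Ti mul0r.
    by rewrite mul0mx mulmx0 mul0mx mxE.
apply: (row_free_inj fB); rewrite mul0mx; apply/row_matrixP => j; rewrite row0.
rewrite -[LHS]vec_mxK (A0 (vec_mx _)) ?linear0 // vec_mxK; exact: row_sub.
Qed.
End Casimir.
End LinearReductivity.

(** * From nilpotent operators to invariant linear forms *)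

Section LinearReductivity.
Variables (K : numClosedFieldType) (m' : nat).
Local Notation m := m'.+1.
Local Notation N := (m * m)%N.
Local Notation MP := {mpoly K[N]}.
Variables (G : 'M[K]_m -> Prop) (lgG : lin_group G).
Hypothesis traceG : forall u, G u -> (forall h, G h -> \tr (u *m h) = \tr h) -> u = 1%:M.
Hypothesis conn : zariski_connected G.

(** The image L of n is perfect, so Cartan's criterion makes each of its elements nilpotent and
    Engel's theorem makes long products in L vanish. Expanding brackets repeatedly, perfectness
    writes each element of L as a sum of products of arbitrary length. *)
Lemma drep_nilpotent_span0 r (B : 'M[K]_(r, N)) k (pi : 'M[MP]_k.+1) :
  row_free B -> (forall i, lieG G (vec_mx (row i B)) /\ (vec_mx (row i B)) ^+ m = 0) ->
  (forall X, lieG G X -> X ^+ m = 0 -> (X \in B)%MS) ->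
  regular_rep G pi ->
  (forall x y, (x \in B)%MS -> (y \in B)%MS -> \tr (drep pi x *m drep pi y) = 0) ->
  forall x, (x \in B)%MS -> drep pi x = 0.
Proof.
move=> fB nilB Bnil rpi tr0.
have lB x : (x \in B)%MS -> lieG G x by exact: lieG_B.
have [|x y [x' xB ->] [y' yB ->]|c x [x' xB ->]|q [L LP]] :=
  @predicate_space K k (fun y : 'M[K]_k.+1 => exists2 x, (x \in B)%MS & y = drep pi x).
- exists 0; first by rewrite linear0 sub0mx.
  by have := drepZ pi 0 0; rewrite !scale0r => ->.
- by exists (x' + y'); [exact: memmxD | rewrite drepD].
- by exists (c *: x'); [exact: memmxZ | rewrite drepZ].
have lieB y z : (y \in B)%MS -> (z \in B)%MS -> (lie y z \in B)%MS.
  by move=> yB zB; apply: (lieG_stabilizes lgG (ad_stable_B lgG nilB Bnil)) => //; exact: lB.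
have lieL x y : (x \in L)%MS -> (y \in L)%MS -> (lie x y \in L)%MS.
  move=> /LP[x' xB ->] /LP[y' yB ->]; rewrite -(drep_lie lgG rpi (lB _ xB) (lB _ yB)).
  by apply/LP; exists (lie x' y') => //; exact: lieB.
have perf x : (x \in L)%MS -> exists s (a b : 'I_s -> 'M[K]_k.+1),
    [/\ forall i, (a i \in L)%MS, forall i, (b i \in L)%MS & x = \sum_i lie (a i) (b i)].
  move=> /LP[x' xB ->]; have [s [a [b [aB bB ->]]]] := nilpotent_span_perfect lgG traceG fB nilB Bnil xB.
  exists s, (fun i => drep pi (a i)), (fun i => drep pi (b i)); split=> [i|i|].
  - by apply/LP; exists (a i).
  - by apply/LP; exists (b i).
  rewrite drep_sum; apply: eq_bigr => i _.
  by rewrite (drep_lie lgG rpi (lB _ (aB i)) (lB _ (bB i))).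
have nilL x : (x \in L)%MS -> x ^+ k.+1 = 0.
  move=> /perf[s [a [b [aL bL ->]]]]; apply: (cartan_nilpotent lieL) => // y z.
  by move=> /LP[y' yB ->] /LP[z' zB ->]; exact: tr0.
have [n Ln] := engel lieL nilL.
have chain j : forall x, (x \in L)%MS -> (x \in left_chain L j)%MS.
  elim: j => [|j IH] x xL; first by rewrite submx1.
  have [s [a [b [aL bL ->]]]] := perf x xL.
  apply: memmx_sum => i _; apply: memmxB; apply: mem_mulsmx; try exact: aL; try exact: bL.
  - by apply: IH; exact: bL.
  by apply: IH; exact: aL.
move=> x xB; have /(chain n) : (drep pi x \in L)%MS by apply/LP; exists x.
by rewrite Ln => /memmx0.
Qed.

Lemma rep_trivial_of_nilpotent k (pi : 'M[MP]_k.+1) (l : 'cV[K]_k.+1) :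
  regular_rep G pi -> (forall g, G g -> rep_at pi g *m l = l) ->
  (forall Om : 'M[K]_k.+1, (forall g, G g -> Om *m rep_at pi g = rep_at pi g *m Om) ->
     Om *m l = 0 -> Om ^+ k.+1 = 0) ->
  forall g, G g -> rep_at pi g = 1%:M.
Proof.
move=> rpi lfix nil; apply: (rep_trivial lgG rpi conn) => X lX.
have [r [B [fB nilB Bnil]]] := nilpotent_basis G.
have B0 x : (x \in B)%MS -> drep pi x = 0.
  apply: (drep_nilpotent_span0 fB nilB Bnil rpi) => {}x y.
  case: r B fB nilB Bnil => [|r] B fB nilB Bnil.
    move=> xB _; have -> : x = 0.
      move: xB => /submxP[u]; rewrite (flatmx0 B) mulmx0 => /eqP.
      by rewrite mxvec_eq0 => /eqP.
    by have := drepZ pi 0 0; rewrite !scale0r => ->; rewrite mul0mx raddf0.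
  move=> /in_B[u ->] /in_B[v ->]; rewrite !drep_lincomb tr_lincomb.
  rewrite (gram_W0 lgG traceG fB nilB Bnil rpi) ?mulmx0 ?mul0mx ?mxE // => j.
  apply: nil => [g Gg|]; first exact: (casimir_comm lgG traceG fB nilB Bnil rpi).
  exact: (casimir_fixed lgG nilB rpi lfix).
have [rs [E [S [urs sE EE SE [lS lN nN]]]]] := lieG_jordan lX.
have SEl a : a \in rs -> S *m E a = a *: E a.
  move=> ars; rewrite SE mulmx_suml (bigD1_seq a) //= -scalemxAl EE // eqxx.
  rewrite big1_seq ?addr0 // => b /andP[ba brs].
  by rewrite -scalemxAl EE // (negPf ba) scaler0.
have -> : drep pi X = drep pi S.
  have : drep pi (S + (X - S)) = drep pi X by rewrite addrC subrK.
  by rewrite drepD (B0 (X - S) (Bnil _ lN nN)) addr0 => ->.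
apply: (drep_semisimple0 lgG rpi lS sE SEl (n := k.+1)).
(* [drep pi S] commutes with the whole Lie algebra, since [S, Y] lies in n, where [drep pi]
   vanishes; by connectedness it commutes with G. *)
apply: nil; last exact: (drep_fixed lgG rpi lfix lS).
apply: (comm_drep_comm_rep lgG rpi conn) => Y lY.
apply/eqP; rewrite -subr_eq0; apply/eqP; have := drep_lie lgG rpi lS lY.
rewrite (B0 (lie S Y)); first by move=> e; rewrite -[LHS]/(lie _ _) -e.
exact: (lie_semisimple_nilpotent Bnil lS sE EE urs SE).
Qed.

Theorem linearly_reductive k (pi : 'M[MP]_k) (l : 'cV[K]_k) :
  regular_rep G pi -> (forall g, G g -> rep_at pi g *m l = l) -> l != 0 ->
  exists v : 'rV[K]_k, (forall g, G g -> v *m rep_at pi g = v) /\ v *m l != 0.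
Proof.
elim/ltn_ind: k => -[|k] IH in pi l *.
  by move=> _ _; rewrite (flatmx0 l) eqxx.
move=> rpi lfix l0.
have [[E [EE rE El cE]]|noE] := EM (exists E : 'M[K]_k.+1,
  [/\ E *m E = E, (\rank E < k.+1)%N, E *m l = l &
    forall g, G g -> E *m rep_at pi g = rep_at pi g *m E]).
  have RC : row_base E *m col_base E = 1%:M.
    have fr : row_free (row_base E) by exact: row_base_free.
    have fc : row_full (col_base E) by exact: col_base_full.
    have e : col_base E *m row_base E *m col_base E *m row_base E = col_base E *m row_base E.
      by rewrite mulmx_base -mulmxA mulmx_base.
    have := row_free_inj fr e => {}e.
    by apply: (row_full_inj fc); rewrite mulmx1 mulmxA.
  have [pi' [l' [rpi' lfix' l'0 back]]] := restrict_rep rpi (mulmx_base E) RC cE lfix El l0.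
  by apply: back; exact: (IH _ rE pi' l').
have triv := rep_trivial_of_nilpotent rpi lfix _.
have [i li] : exists i, l i 0 != 0.
  apply: contrapT => h; case/negP: l0; apply/eqP/colP => i; rewrite mxE.
  by apply/eqP; apply: contraT => li; case: h; exists i.
(* The representation is trivial, so every coordinate form is invariant; i is a nonzero coordinate
   of l. *)
exists (delta_mx 0 i); split=> [g Gg|].
  rewrite triv ?mulmx1 // => Om cOm Oml.
  by have [|[E EP]] := fitting rpi lfix l0 cOm Oml; last by case: noE; exists E.
apply: contra li => /eqP/(congr1 (fun x : 'M_1 => x 0 0)).
by rewrite -rowE !mxE => ->.
Qed.
End LinearReductivity.

(** * Nullstellensatz *)

Lemma avoid_point (F : realFieldType) (a b x : F) : a < b ->
  exists a' b', [/\ a <= a', a' < b', b' <= b & ~~ (a' <= x <= b')].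
Proof.
move=> ab; have am := midf_lt ab; set c := (a + b) / 2 in am; case: am => ac cb.
have acm := midf_lt ac; set e := (a + c) / 2 in acm; case: acm => ae ec.
have [xe|ex] := leP x e.
  by exists c, b; split; rewrite // ?(ltW ac) // negb_and -!ltNge (le_lt_trans xe ec).
by exists a, e; split; rewrite // ?(ltW (lt_trans ec cb)) // negb_and -!ltNge ex orbT.
Qed.

Lemma avoid_points (F : realFieldType) (s : seq F) (a b : F) : a < b ->
  exists a' b', [/\ a <= a', a' < b', b' <= b & forall x, x \in s -> ~~ (a' <= x <= b')].
Proof.
elim: s a b => [|x s IH] a b ab; first by exists a, b.
have [a1 [b1 [aa1 ab1 bb1 x1]]] := avoid_point x ab.
have [a2 [b2 [aa2 ab2 bb2 s2]]] := IH _ _ ab1.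
exists a2, b2; split=> //; try exact: le_trans aa2; try exact: le_trans bb1.
move=> y; rewrite inE => /orP[/eqP ->|]; last exact: s2.
apply: contra x1 => /andP[h1 h2]; by rewrite (le_trans aa2) //= (le_trans h2).
Qed.

(** Nested intervals: if all sets f <= d were finite, the interval of index d + 1 could avoid the
    d-th one, and the supremum of the left ends, which lies in all the intervals, would contradict
    its own value under f. *)
Lemma real_not_sigma_finite (R : realType) (f : R -> nat) :
  exists d, forall s : seq R, exists x, (f x <= d)%N /\ x \notin s.
Proof.
apply: contrapT => nd.
have cover d : exists s : seq R, forall x, (f x <= d)%N -> x \in s.
  apply: contrapT => h; apply: nd; exists d => s; apply: contrapT => h'.
  by apply: h; exists s => x fx; apply: contrapT => xs; apply: h'; exists x; split=> //; apply/negP.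
have [s sP] := boolp.choice cover.
pose T := {ab : R * R | ab.1 < ab.2}.
have next (dt : nat * T) : exists t : T,
    [/\ (proj1_sig dt.2).1 <= (proj1_sig t).1, (proj1_sig t).2 <= (proj1_sig dt.2).2 &
      forall x, x \in s dt.1 -> ~~ ((proj1_sig t).1 <= x <= (proj1_sig t).2)].
  case: dt => d [[a b] /= ab]; have [a' [b' [aa' ab' bb' h]]] := avoid_points (s d) ab.
  by exists (exist _ (a', b') ab').
have [g gP] := boolp.choice next.
pose t0 : T := exist _ (0, 1) ltr01.
pose t := fix t d : T := if d is d'.+1 then g (d', t d') else t0.
pose a d := (proj1_sig (t d)).1; pose b d := (proj1_sig (t d)).2.
have ab d : a d < b d := proj2_sig (t d).
have aS d : a d <= a d.+1 by have [] := gP (d, t d).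
have bS d : b d.+1 <= b d by have [] := gP (d, t d).
have aM d e : a d <= a (d + e)%N.
  by elim: e => [|e IH]; rewrite ?addn0 // addnS (le_trans IH).
have bM d e : b (d + e)%N <= b d.
  by elim: e => [|e IH]; rewrite ?addn0 // addnS (le_trans _ IH).
have ltab d e : a d <= b e.
  by apply: (le_trans (aM d e)); rewrite (le_trans (ltW (ab _))) // addnC bM.
pose A : set R := [set x | exists d, x = a d]%classic.
have supA : has_sup A by split; [exists (a 0); exists 0%N | exists (b 0) => _ [d ->]].
have ax d : a d <= sup A by apply: ub_le_sup; [case: supA | exists d].
have xb d : sup A <= b d by apply: ge_sup; [case: supA | move=> _ [e ->]].
have [_ _ /(_ _ (sP _ _ (leqnn (f (sup A)))))] := gP (f (sup A), t (f (sup A))).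
by rewrite -[proj1_sig _]/(proj1_sig (t (f (sup A)).+1)) (ax (f (sup A)).+1) (xb (f (sup A)).+1).
Qed.

Section Nullstellensatz.
Variable R : realType.
Local Notation C := R[i].

Lemma mpoly_dependent (K : fieldType) n d s (q : 'I_s -> {mpoly K[n]}) :
  (forall j, (msize (q j) <= d)%N) -> (#|{: 'X_{1..n < d}}| < s)%N ->
  exists2 u : 'I_s -> K, \sum_j u j *: q j = 0 & exists j, u j != 0.
Proof.
move=> qd ds.
pose A : 'M[K]_(s, #|{: 'X_{1..n < d}}|) := \matrix_(j, i) (q j)@_(bmnm (enum_val i : 'X_{1..n < d})).
have [u uA u0] : exists2 u : 'rV[K]_s, u *m A = 0 & u != 0.
  have kA : kermx A != 0.
    by rewrite kermx_eq0 /row_free neq_ltn (leq_ltn_trans (rank_leq_col A)).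
  have [i ki] : exists i, row i (kermx A) != 0.
    apply: contrapT => h; case/negP: kA; apply/eqP/row_matrixP => i; rewrite row0.
    by apply/eqP; apply: contraT => ki; case: h; exists i.
  by exists (row i (kermx A)) => //; rewrite -row_mul mulmx_ker row0.
exists (u 0).
  apply/mpolyP => m; rewrite mcoeff0 raddf_sum /=.
  have [md|md] := ltnP (mdeg m) d.
    have := congr1 (fun v : 'rV__ => v 0 (enum_rank (BMultinom md))) uA.
    rewrite [LHS]mxE [RHS]mxE; apply: etrans; apply: eq_bigr => j _.
    by rewrite mxE enum_rankK mcoeffZ.
  rewrite big1 // => j _; rewrite mcoeffZ memN_msupp_eq0 ?mulr0 //.
  by apply: msize_mdeg_ge; exact: leq_trans (qd j) md.
apply: contrapT => h; case/negP: u0; apply/eqP/rowP => j; rewrite mxE.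
by apply/eqP; apply: contraT => uj; case: h; exists j.
Qed.

Definition mideal n (J : {mpoly C[n]} -> Prop) :=
  [/\ J 0, forall x y, J x -> J y -> J (x + y) & forall x y, J y -> J (x * y)].

(* If no X_i - c lies in the maximal ideal J, inverses of uncountably many of them modulo J
   have bounded degree, hence are dependent, so a nonzero polynomial in X_i lies in J. *)
Lemma maximal_ideal_point n (J : {mpoly C[n]} -> Prop) (i : 'I_n) :
  mideal J -> ~ J 1 ->
  (forall J', mideal J' -> ~ J' 1 -> (forall x, J x -> J' x) -> forall x, J' x -> J x) ->
  exists c : C, J ('X_i - c%:MP).
Proof.
move=> [J0 JD JM] J1 Jmax; apply: contrapT => nJ.
have JN x : J x -> J (- x) by rewrite -mulN1r; exact: JM.
have JB x y : J x -> J y -> J (x - y) by move=> Jx Jy; apply: JD => //; exact: JN.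
have Jsum (I : Type) (r : seq I) (F : I -> {mpoly C[n]}) :
  (forall k, J (F k)) -> J (\sum_(k <- r) F k) by move=> JF; apply: (big_ind J).
have Jinv x : ~ J x -> exists q, J (q * x - 1).
  move=> nJx; apply: contrapT => h; apply: nJx.
  apply: (Jmax (fun y => exists q, J (q * x - y))).
  - split=> [|y z [p pJ] [q qJ]|y z [q qJ]].
    + by exists 0; rewrite mul0r subrr.
    + by exists (p + q); have := JD _ _ pJ qJ; congr J; ring.
    + by exists (y * q); have := JM y _ qJ; congr J; ring.
  - by move=> h1; apply: h.
  - by move=> y Jy; exists 0; rewrite mul0r sub0r; exact: JN.
  by exists 1; rewrite mul1r subrr.
have Jc c : exists q, J (q * ('X_i - c%:MP) - 1).
  by apply: Jinv => Jc; apply: nJ; exists c.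
have [q qP] := boolp.choice Jc.
have [d dP] := real_not_sigma_finite (fun x : R => msize (q x%:C%C)).
have [s [us sd ss]] : exists s : seq R, [/\ uniq s,
    forall x, x \in s -> (msize (q x%:C%C) <= d)%N & (#|{: 'X_{1..n < d}}| < size s)%N].
  elim: (#|_|) => [|k [s [us sd sk]]].
    by have [x [xd _]] := dP [::]; exists [:: x]; split=> // y; rewrite inE => /eqP ->.
  have [x [xd xs]] := dP s; exists (x :: s); split; rewrite /= ?xs // => y.
  by rewrite inE => /orP[/eqP ->|/sd].
pose c (j : 'I_(size s)) : C := (nth 0 s j)%:C%C.
have c_inj j k : c j = c k -> j = k.
  move=> /complexI h; apply/val_inj/eqP.
  by rewrite -(nth_uniq 0 (ltn_ord j) (ltn_ord k) us) h.
have [j|u uq [j0 u0]] := @mpoly_dependent C n d (size s) (fun j => q (c j)) _ ss.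
  by apply: sd; exact: mem_nth.
(* Multiplying the relation sum_j u_j q_j = 0 by all the factors X_i - c_k, and using q_j (X_i -
   c_j) = 1 modulo J, yields P(X_i) in J. P is nonzero: at c_j0 only the term of index j0
   survives. *)
pose P : {poly C} := \sum_j u j *: \prod_(k | k != j) ('X - (c k)%:P).
have P0 : P != 0.
  apply: contraNneq u0 => /(congr1 (fun p => p.[c j0])); rewrite horner0 horner_sum.
  have -> : \sum_j (u j *: \prod_(k | k != j) ('X - (c k)%:P)).[c j0] =
      (u j0 *: \prod_(k | k != j0) ('X - (c k)%:P)).[c j0].
    rewrite (bigD1 j0) //= [X in _ + X]big1 ?addr0 // => j jj0; rewrite hornerZ horner_prod (bigD1 j0) 1?eq_sym //=.
    by rewrite hornerXsubC subrr mul0r mulr0.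
  rewrite hornerZ horner_prod => /eqP; rewrite mulf_eq0 => /orP[//|/eqP h].
  have : \prod_(k | k != j0) ('X - (c k)%:P).[c j0] != 0.
    apply/prodf_neq0 => k kj; rewrite hornerXsubC subr_eq0.
    by apply: contraNneq kj => /c_inj ->.
  by rewrite h eqxx.
pose phi (p : {poly C}) : {mpoly C[n]} := (map_poly (@mpolyC n C) p).['X_i].
have phiM p p' : phi (p * p') = phi p * phi p' by rewrite /phi rmorphM hornerM.
have phiX a : phi ('X - a%:P) = 'X_i - a%:MP.
  by rewrite /phi rmorphB /= map_polyX map_polyC hornerXsubC.
have phiC a : phi a%:P = a%:MP by rewrite /phi map_polyC hornerC.
have phi_prod (I : Type) (r : seq I) (Q : pred I) F :
    phi (\prod_(k <- r | Q k) F k) = \prod_(k <- r | Q k) phi (F k).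
  by rewrite /phi rmorph_prod horner_prod.
have JP : J (phi P).
  have e j : J (\prod_(k | k != j) ('X_i - (c k)%:MP) -
      q (c j) * \prod_k ('X_i - (c k)%:MP)).
    have -> : \prod_k ('X_i - (c k)%:MP) =
      ('X_i - (c j)%:MP) * \prod_(k | k != j) ('X_i - (c k)%:MP) by rewrite (bigD1 j).
    have := JM (- \prod_(k | k != j) ('X_i - (c k)%:MP)) _ (qP (c j)).
    by congr J; ring.
  have -> : phi P = \sum_j (u j)%:MP * (\prod_(k | k != j) ('X_i - (c k)%:MP) -
      q (c j) * \prod_k ('X_i - (c k)%:MP)).
    under [RHS]eq_bigr => j _ do rewrite mulrBr mulrA.
    rewrite sumrB -mulr_suml.
    have -> : \sum_j (u j)%:MP * q (c j) = 0.
      by rewrite -[RHS]uq; apply: eq_bigr => j _; rewrite mul_mpolyC.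
    rewrite mul0r subr0 /phi /P rmorph_sum horner_sum; apply: eq_bigr => j _ /=.
    rewrite map_polyZ hornerZ; congr (_ * _).
    by rewrite -/(phi _) phi_prod; apply: eq_bigr => k _; rewrite phiX.
  by apply: Jsum => j; exact: JM.
(* P splits into linear factors, none of which goes into J, while J, being maximal, is prime. *)
have [rs Prs] := closed_field_poly_normal P.
have Jprod (I : Type) (r : seq I) (F : I -> {mpoly C[n]}) :
    (forall k, ~ J (F k)) -> ~ J (\prod_(k <- r) F k).
  move=> nF; elim: r => [|k r IH]; first by rewrite big_nil.
  rewrite big_cons => h; apply: IH; have [p pJ] := Jinv _ (nF k).
  have := JB _ _ (JM p _ h) (JM (\prod_(k <- r) F k) _ pJ).
  by congr J; ring.
move: JP; rewrite Prs -mul_polyC phiM phiC phi_prod => JP.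
have : J (\prod_(z <- rs) phi ('X - z%:P)).
  have := JM (lead_coef P)^-1%:MP _ JP; rewrite mulrA -mpolyCM mulVf ?mul1r //.
  by rewrite lead_coef_eq0.
by apply: Jprod => z; rewrite phiX => Jz; apply: nJ; exists z.
Qed.

Theorem weak_nullstellensatz n (J : {mpoly C[n]} -> Prop) :
  mideal J -> (forall x : 'I_n -> C, ~ forall p, J p -> p.@[x] = 0) -> J 1.
Proof.
move=> idJ noz; apply: contrapT => J1.
have [|J' [[idJ' J'1] JJ' Jmax]] := @noetherian_maximal _ (fun J => mideal J /\ ~ J 1) J
  (@noetherian_mpoly C n) _ (conj idJ J1).
  by move=> J' [].
have pt i : exists c, J' ('X_i - c%:MP).
  by apply: (@maximal_ideal_point n J' i idJ' J'1) => J2 h2 h3; exact: Jmax (conj h2 h3).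
have [x xP] := boolp.choice pt.
case: idJ' => J0 JD JM; apply: (noz x) => p /JJ' Jp.
have hp : J' (p - (p.@[x])%:MP).
  elim/mpoly_ring_ind: p {Jp} => [c|i|p q hp hq|p q hp hq].
  - by rewrite mevalC subrr.
  - by rewrite mevalXU.
  - by rewrite mevalD mpolyCD; have := JD _ _ hp hq; congr J'; ring.
  rewrite mevalM mpolyCM; have := JD _ _ (JM p _ hq) (JM (q.@[x])%:MP _ hp).
  by congr J'; ring.
have Jc : J' (p.@[x])%:MP.
  by have := JD _ _ Jp (JM (-1) _ hp); congr J'; ring.
apply/eqP; apply: contraT => px; case: J'1.
by have := JM (p.@[x])^-1%:MP _ Jc; rewrite -mpolyCM mulVf.
Qed.
End Nullstellensatz.

(** * Reductive groups *)

Local Open Scope classical_set_scope.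

Section UnimodularEmbedding.
Variables (R : realType) (n : nat).
Local Notation C := R[i].
Local Notation MP := {mpoly C[n.+1 * n.+1]}.

(* g |-> diag (1 / det g, g) embeds GL_n as a closed subgroup of SL_(n+1). *)
Definition tl (g : 'M[C]_n) : 'M[C]_n.+1 :=
  block_mx (\det g)^-1%:M 0 0 g : 'M[C]_(1 + n).

Lemma tl1 : tl 1%:M = 1%:M.
Proof. by rewrite /tl det1 invr1 -scalar_mx_block. Qed.

Lemma tlM g h : tl (g *m h) = tl g *m tl h.
Proof.
apply/esym/(etrans (@mulmx_block _ 1 n 1 n 1 n _ _ _ _ _ _ _ _)).
by rewrite !mulmx0 !mul0mx !addr0 !add0r /tl det_mulmx invfM -scalar_mxM.
Qed.

Lemma det_tl g : g \in unitmx -> \det (tl g) = 1.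
Proof.
by move=> ug; rewrite [LHS](@det_ublock _ 1 n) det_scalar1 mulVf //.
Qed.

Lemma tl_inv g : g \in unitmx -> tl (invmx g) = invmx (tl g).
Proof.
move=> ug; have ut : tl g \in unitmx by rewrite unitmxE det_tl ?unitr1.
by rewrite -[LHS](mulKmx ut) -tlM mulmxV // tl1 mulmx1.
Qed.

Definition tl_coord (h : 'M[C]_(1 + n)) : 'rV[C]_(n * n + 1) :=
  row_mx (mxvec (drsubmx h)) (ulsubmx h).

Lemma tl_coordE g : tl_coord (tl g) = glcoord g.
Proof.
rewrite /tl_coord /tl block_mxKdr block_mxKul /glcoord; congr row_mx.
by apply/matrixP => i j; rewrite !ord1 !mxE eqxx mulr1n.
Qed.

Lemma ulsub_in (h : 'M[C]_(1 + n)) : ulsubmx h 0 0 = (h : 'M_n.+1) ord0 ord0.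
Proof. by rewrite !mxE; congr (fun_of_matrix h); apply: val_inj. Qed.

Lemma tl_coord_poly (p : {mpoly C[n * n + 1]}) :
  exists q : MP, forall h : 'M[C]_n.+1, ev h q = p.@[tl_coord h 0].
Proof.
have h k : exists q : MP, forall h : 'M[C]_n.+1, ev h q = tl_coord h 0 k.
  rewrite -(splitK k); case: (fintype.split k) => l /=.
    case/mxvec_indexP: l => i j.
    exists (genmx_var C n (rshift 1 i : 'I_(1 + n)) (rshift 1 j : 'I_(1 + n))) => h.
    by rewrite evX /tl_coord row_mxEl mxvecE !mxE.
  exists (genmx_var C n (lshift n (0 : 'I_1) : 'I_(1 + n)) (lshift n l : 'I_(1 + n))) => h.
  by rewrite evX /tl_coord row_mxEr !mxE.
have [f fP] := boolp.choice h; exists (p \mPo [tuple f k | k < n * n + 1]) => g.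
rewrite /ev comp_mpoly_meval; apply: meval_eq => k; rewrite tnth_mktuple; exact: fP.
Qed.

Lemma glcoord_poly (p : {mpoly C[n * n + 1]}) :
  exists q : MP, forall g, ev (tl g) q = p.@[glcoord g 0].
Proof.
have [q qP] := tl_coord_poly p; exists q => g.
by rewrite qP; congr (p.@[_]); congr (fun_of_matrix _); exact: tl_coordE.
Qed.

Lemma tl_entry_regular (X : set 'M[C]_n) i j :
  regular_on (@glcoord R n) X (fun g => tl g i j).
Proof.
rewrite -(@splitK 1 n i) -(@splitK 1 n j).
case: (@fintype.split 1 n i) => a; case: (@fintype.split 1 n j) => b /=.
- apply: regular_ext (regular_coord _ _ (rshift (n * n) 0)) => g _.
  by rewrite /tl (@block_mxEul _ 1 n 1 n) /glcoord row_mxEr !ord1 !mxE eqxx.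
- by apply: regular_ext (regular_cst _ _ 0) => g _; rewrite /tl (@block_mxEur _ 1 n 1 n) mxE.
- by apply: regular_ext (regular_cst _ _ 0) => g _; rewrite /tl (@block_mxEdl _ 1 n 1 n) mxE.
by apply: regular_ext (regular_entry _ a b) => g _; rewrite /tl (@block_mxEdr _ 1 n 1 n).
Qed.

Lemma tl_regular (X : set 'M[C]_n) (q : MP) :
  regular_on (@glcoord R n) X (fun g => ev (tl g) q).
Proof.
apply: regular_comp => k; case/mxvec_indexP: k => i j.
by apply: regular_ext (tl_entry_regular X i j) => g _; rewrite mxvecE.
Qed.

Variable G : algGroup R n.
Definition tlG (h : 'M[C]_n.+1) : Prop := exists2 g, G g & h = tl g.

(** For closedness, the equations of the image force the block diagonal shape and corner times det g
    = 1, so h is [tl g]; the equations of G on g are polynomial in the entries of [tl g], the corner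
    supplying 1 / det g. *)
Lemma tlG_lin_group : lin_group tlG.
Proof.
split.
- by exists 1%:M; [exact: ag_1 | rewrite tl1].
- by move=> _ _ [g Gg ->] [h Gh ->]; exists (g *m h); [exact: ag_mul | rewrite tlM].
- move=> _ [g Gg ->]; exists (invmx g); first exact: ag_inv.
  by rewrite tl_inv //; exact: ag_unit Gg.
- by move=> _ [g Gg ->]; rewrite det_tl //; exact: ag_unit Gg.
move=> h hP.
pose a := ulsubmx (h : 'M[C]_(1 + n)) 0 0; pose g : 'M[C]_n := drsubmx (h : 'M[C]_(1 + n)).
have zero i j : (forall g, G g -> tl g i j = 0) -> h i j = 0.
  by move=> z; rewrite -evX; apply: hP => _ [g' Gg' ->]; rewrite evX z.
have hE : h = block_mx (a%:M : 'M_1) 0 0 g.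
  have e1 : ulsubmx (h : 'M_(1 + n)) = a%:M.
    by apply/matrixP => i j; rewrite !ord1 [RHS]mxE eqxx mulr1n.
  have e2 : ursubmx (h : 'M_(1 + n)) = 0.
    apply/matrixP => i j; rewrite [RHS]mxE [LHS]mxE [LHS]mxE; apply: zero => g' _.
    by rewrite /tl (@block_mxEur _ 1 n 1 n) mxE.
  have e3 : dlsubmx (h : 'M_(1 + n)) = 0.
    apply/matrixP => i j; rewrite [RHS]mxE [LHS]mxE [LHS]mxE; apply: zero => g' _.
    by rewrite /tl (@block_mxEdl _ 1 n 1 n) mxE.
  by apply: (etrans (esym (@submxK _ 1 n 1 n h))); rewrite e1 e2 e3.
have adet : a * \det g = 1.
  pose q : MP := genmx_var C n ord0 ord0 *
    \det (drsubmx (genmx_var C n : 'M_(1 + n))) - 1%:MP.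
  have qE k : ev k q = k ord0 ord0 * \det (drsubmx (k : 'M_(1 + n))) - 1.
    rewrite evB evM evX evC; congr (_ * _ - _).
    have -> : drsubmx (k : 'M_(1 + n)) = map_mx (ev k) (drsubmx (genmx_var C n : 'M_(1 + n))).
      by apply/matrixP => i j; rewrite [RHS]mxE [in RHS]mxE [in RHS]mxE evX !mxE.
    by rewrite det_map_mx.
  have : ev h q = 0.
    apply: hP => _ [k Gk ->]; rewrite qE -ulsub_in /tl block_mxKdr block_mxKul mxE eqxx mulVf ?subrr //.
    by rewrite -unitfE -unitmxE; exact: ag_unit Gk.
  by rewrite qE => /eqP; rewrite subr_eq0 -ulsub_in => /eqP.
have ug : g \in unitmx.
  by rewrite unitmxE unitfE; apply: contra_eqN adet => /eqP ->; rewrite mulr0 eq_sym oner_eq0.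
have aE : a = (\det g)^-1.
  have d0 : \det g != 0 by rewrite -unitfE -unitmxE.
  by rewrite -[LHS](mulfK d0) adet mul1r.
have htl : h = tl g by rewrite hE aE.
exists g => //; have [S SE] := ag_closed G; rewrite SE; split=> // p Sp.
have [q qP] := glcoord_poly p; rewrite -qP -htl; apply: hP => _ [k Gk ->].
by rewrite qP; move: Gk; rewrite SE => -[_ /(_ p Sp)].
Qed.

Lemma tlG_connected : ag_connected G -> zariski_connected tlG.
Proof.
move=> conn S1 S2 cov dis.
pose Y (S : MP -> Prop) : set 'M[C]_n := [set g | G g /\ forall p, S p -> ev (tl g) p = 0].
have clY S : closed_in (@glcoord R n) (ag_set G) (Y S).
  exists [set p | exists2 q, S q & forall g, G g -> ev (tl g) q = p.@[glcoord g 0]].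
  apply/seteqP; split=> g /= [Gg h]; split=> // p.
    by case=> q Sq qE; rewrite -qE // h.
  by have [p' p'E] := tl_regular (ag_set G) p; move=> Sp; rewrite p'E // h //; exists p.
have [||Y0|Y0] := conn _ _ (clY S1) (clY S2).
- apply/seteqP; split=> g; first by case=> -[].
  move=> Gg; have [|h|h] := cov (tl g); first by exists g.
    by left.
  by right.
- rewrite -subset0 => g [[Gg h1] [_ h2]].
  by apply: (dis (tl g)) => //; exists g.
- right=> _ p [g Gg ->] Sp; have [|h|h] := cov (tl g); first by exists g.
    by have : Y S1 g by []; rewrite Y0.
  exact: h.
left=> _ p [g Gg ->] Sp; have [|h|h] := cov (tl g); first by exists g.
  exact: h.
by have : Y S2 g by []; rewrite Y0.
Qed.
End UnimodularEmbedding.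

(** * Unipotent paths and the radical of the trace form *)

Section PowersOfUnipotents.
Variable K : numClosedFieldType.

Lemma bin_poly j : exists P : {poly K}, forall t : nat, P.[t%:R] = 'C(t, j)%:R.
Proof.
have [Q QE] : exists Q : {poly K}, forall t : nat, Q.[t%:R] = (t ^_ j)%:R.
  elim: j => [|j [Q QE]]; first by exists 1 => t; rewrite hornerC ffactn0.
  exists (Q * ('X - j%:R%:P)) => t; rewrite hornerM QE hornerXsubC ffactnSr natrM.
  have [tj|jt] := ltnP t j; first by rewrite ffact_small // !mul0r.
  by rewrite natrB.
exists ((j`!)%:R^-1 *: Q) => t; rewrite hornerZ QE -bin_ffact natrM mulrC mulfK //.
by rewrite pnatr_eq0 -lt0n fact_gt0.
Qed.

Variable m' : nat.
Local Notation m := m'.+1.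

Lemma unipotent_power_poly (w : 'M[K]_m) k i j : (w - 1%:M) ^+ k = 0 ->
  exists P : {poly K}, forall t : nat, (w ^+ t) i j = P.[t%:R].
Proof.
move=> wk; have [b bE] := boolp.choice bin_poly.
exists (\sum_(l < k) (((w - 1%:M) ^+ l) i j) *: b l) => t.
have -> : w ^+ t = \sum_(l < k) 'C(t, l)%:R *: (w - 1%:M) ^+ l.
  have -> : w ^+ t = ((w - 1%:M) + 1) ^+ t by rewrite subrK.
  rewrite exprD1n.
  have -> : \sum_(l < t.+1) (w - 1%:M) ^+ l *+ 'C(t, l) =
      \sum_(l < t.+1 + k) 'C(t, l)%:R *: (w - 1%:M) ^+ l.
    rewrite [RHS]big_split_ord /= [X in _ = _ + X]big1 ?addr0 => [|l _].
      by apply: eq_bigr => l _; rewrite scaler_nat.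
    by rewrite bin_small ?scale0r // ltnS leq_addr.
  rewrite [RHS](big_ord_widen_cond (t.+1 + k) predT (fun l => 'C(t, l)%:R *: (w - 1%:M) ^+ l)) ?leq_addl //.
  rewrite [RHS]big_mkcond; apply: eq_bigr => l _ /=; case: ltnP => // kl.
  by rewrite -(subnK kl) exprD wk mulr0 scaler0.
rewrite horner_sum summxE; apply: eq_bigr => l _.
by rewrite mxE hornerZ bE mulrC.
Qed.

Lemma unipotent_path_poly (y w : 'M[K]_m) k (q : {mpoly K[m * m]}) :
  (w - 1%:M) ^+ k = 0 ->
  exists P : {poly K}, forall t : nat, ev (y *m w ^+ t) q = P.[t%:R].
Proof.
move=> wk; elim/mpoly_entry_ind: q => [c|i j|p q [P PE] [Q QE]|p q [P PE] [Q QE]].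
- by exists c%:P => t; rewrite evC hornerC.
- have [P PE] := boolp.choice (fun l => unipotent_power_poly l j wk).
  exists (\sum_l y i l *: P l) => t; rewrite evX mxE horner_sum.
  by apply: eq_bigr => l _; rewrite hornerZ PE.
- by exists (P + Q) => t; rewrite evD hornerD PE QE.
by exists (P * Q) => t; rewrite evM hornerM PE QE.
Qed.

(** By the binomial formula, a polynomial function of y w^t is a polynomial in t. If each condition
    failed somewhere, two nonzero polynomials in t would have a product vanishing at every natural
    number. The discrete path t |-> y w^t thus plays the part of an irreducible curve. *)
Lemma unipotent_path_dichotomy (y w : 'M[K]_m) k (S1 S2 : {mpoly K[m * m]} -> Prop) :
  (w - 1%:M) ^+ k = 0 ->
  (forall t, (forall p, S1 p -> ev (y *m w ^+ t) p = 0) \/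
             (forall p, S2 p -> ev (y *m w ^+ t) p = 0)) ->
  (forall t p, S1 p -> ev (y *m w ^+ t) p = 0) \/
  (forall t p, S2 p -> ev (y *m w ^+ t) p = 0).
Proof.
move=> wk cov; apply: contrapT => /not_orP[n1 n2].
have wit S : ~ (forall t p, S p -> ev (y *m w ^+ t) p = 0) ->
    exists2 P : {poly K}, P != 0 &
      forall t, (forall p, S p -> ev (y *m w ^+ t) p = 0) -> P.[t%:R] = 0.
  move=> /existsNP[t /existsNP[p /not_implyP[Sp pt]]].
  have [P PE] := unipotent_path_poly y p wk; exists P.
    by apply/eqP => P0; apply: pt; rewrite PE P0 horner0.
  by move=> u h; rewrite -PE h.
have [P P0 PE] := wit _ n1; have [Q Q0 QE] := wit _ n2.
have PQ : P * Q != 0 by rewrite mulf_neq0.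
have /(_ (mkseq (fun t => t%:R) (size (P * Q)))) := max_poly_roots PQ.
rewrite size_mkseq ltnn => h; suff : false by []; apply: h.
  apply/allP => _ /mapP[t _ ->]; rewrite rootM; apply/orP.
  by have [h|h] := cov t; [left; apply/eqP; exact: PE | right; apply/eqP; exact: QE].
by rewrite mkseq_uniq // => a b /eqP; rewrite eqr_nat => /eqP.
Qed.
End PowersOfUnipotents.

Section TraceRadical.
Variables (R : realType) (n : nat) (G : algGroup R n).
Local Notation C := R[i].
Local Notation tlt g h := (\tr (tl g *m tl h)).

Definition trace_radical : set 'M[C]_n :=
  [set u | G u /\ forall h, G h -> \tr (tl u *m tl h) = \tr (tl h)].

Lemma tr_conj_tl g u : G g -> \tr (tl g *m u *m tl (invmx g)) = \tr u.
Proof.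
move=> Gg; rewrite mxtrace_mulC mulmxA -tlM mulVmx ?tl1 ?mul1mx //; exact: ag_unit Gg.
Qed.

Fact trace_radical_1 : trace_radical 1%:M.
Proof. by split=> [|h Gh]; [exact: ag_1 | rewrite tl1 mul1mx]. Qed.

Fact trace_radical_mul u v : trace_radical u -> trace_radical v -> trace_radical (u *m v).
Proof.
move=> [Gu hu] [Gv hv]; split=> [|h Gh]; first exact: ag_mul.
rewrite tlM -mulmxA -tlM hu ?tlM ?hv //; exact: ag_mul.
Qed.

Fact trace_radical_inv u : trace_radical u -> trace_radical (invmx u).
Proof.
move=> [Gu hu]; have Gi := ag_inv Gu; split=> // h Gh.
have Gih : G (invmx u *m h) by exact: ag_mul.
have := hu _ Gih; rewrite -!tlM mulKVmx; last exact: ag_unit Gu.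
by move=> ->.
Qed.

Fact trace_radical_closed : closed_in (@glcoord R n) (@GL R n) trace_radical.
Proof.
have [S SE] := ag_closed G.
exists (S `|` [set p | exists h, G h /\
  forall g, G g -> p.@[glcoord g 0] = \tr (tl g *m tl h) - \tr (tl h)]).
apply/seteqP; split=> g /=.
  move=> [Gg hg]; split; first exact: ag_unit Gg.
  move=> p [Sp|[h [Gh ->]]] //; last by rewrite hg ?subrr.
  by move: Gg; rewrite SE => -[_]; exact.
move=> [ug hg]; have Gg : G g by rewrite SE; split=> // p Sp; apply: hg; left.
split=> // h Gh.
have [p pE] : regular_on (@glcoord R n) (ag_set G)
    (fun g => \tr (tl g *m tl h) - \tr (tl h)).
  have [q qE] : exists q : {mpoly C[n.+1 * n.+1]}, forall g : 'M_n.+1,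
      ev g q = \tr (g *m tl h) - \tr (tl h).
    exists (\tr (genmx_var C n *m cmx (tl h)) - (\tr (tl h))%:MP) => k.
    rewrite evB evC; congr (_ - _).
    have -> : k *m tl h = map_mx (ev k) (genmx_var C n *m cmx (tl h)).
      by rewrite ev_mul ev_Gx ev_cmx.
    by rewrite [RHS]trace_map_mx.
  by apply: regular_ext (tl_regular _ q) => k _; rewrite qE.
apply/eqP; rewrite -subr_eq0 pE // hg //; right; exists h; split=> // k Gk.
by rewrite pE.
Qed.

Definition trace_radical_group : algGroup R n :=
  AlgGroup trace_radical_closed trace_radical_1 trace_radical_mul trace_radical_inv.

Lemma trace_radical_normal : normal_in G trace_radical_group.
Proof.
split=> [u []//|g u Gg [Gu hu]]; have Gi := ag_inv Gg.
split=> [|h Gh]; first by apply: ag_mul => //; exact: ag_mul.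
rewrite !tlM.
have -> : tl g *m tl u *m tl (invmx g) *m tl h =
    tl g *m (tl u *m tl (invmx g *m h *m g)) *m tl (invmx g).
  have e : tl g *m tl (invmx g) = 1%:M.
    by rewrite -tlM mulmxV ?tl1 //; exact: ag_unit Gg.
  by rewrite !tlM !mulmxA -[RHS]mulmxA e mulmx1.
rewrite tr_conj_tl // hu; last by apply: ag_mul => //; exact: ag_mul.
rewrite -[LHS](tr_conj_tl _ Gg) -!tlM !mulmxA mulmxV ?mul1mx; last exact: ag_unit Gg.
by rewrite mulmxK //; exact: ag_unit Gg.
Qed.

(** Testing against the powers of u gives tr ((u - 1) p(u)) = 0 for every polynomial p, in
    particular for the powers of u - 1. *)
Lemma trace_radical_nilpotent u : trace_radical u -> (tl u - 1%:M) ^+ n.+1 = 0.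
Proof.
move=> [Gu hu]; apply: tr0_nilpotent => j.
have Gk k : exists2 g, G g & tl u ^+ k = tl g.
  elim: k => [|k [g Gg e]]; first by exists 1%:M; [exact: ag_1 | rewrite expr0 tl1].
  by exists (u *m g); [exact: ag_mul | rewrite exprS e tlM].
have h k : \tr ((tl u - 1%:M) *m tl u ^+ k) = 0.
  have [g Gg ->] := Gk k; by rewrite mulmxBl mul1mx raddfB /= hu // subrr.
have hp (p : {poly C}) : \tr ((tl u - 1%:M) *m horner_mx (tl u) p) = 0.
  rewrite -(coefK p) poly_def rmorph_sum /= mulmx_sumr raddf_sum big1 // => k _ /=.
  by rewrite linearZ /= rmorphXn /= horner_mx_X -scalemxAr linearZ /= h mulr0.
rewrite exprS -mulmxE; have := hp (('X - 1) ^+ j).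
by rewrite rmorphXn rmorphB /= horner_mx_X [horner_mx (tl u) 1]rmorph1.
Qed.

Lemma trace_radical_unipotent : ag_unipotent trace_radical_group.
Proof.
move=> u Uu; exists n.+1; have := trace_radical_nilpotent Uu.
have tb : tl u - 1%:M = block_mx ((\det u)^-1%:M - 1%:M : 'M_1) 0 0 (u - 1%:M).
  have e : (1%:M : 'M[C]_n.+1) = block_mx (1%:M : 'M_1) 0 0 (1%:M : 'M_n).
    exact: (@scalar_mx_block _ 1 n).
  rewrite e /tl; apply: (etrans (congr1 (fun x => _ + x) (@opp_block_mx _ 1 n 1 n _ _ _ _))).
  by rewrite (@add_block_mx _ 1 n 1 n) !oppr0 !addr0.
have pw k : exists a : 'M_1, (tl u - 1%:M) ^+ k = block_mx a 0 0 ((u - 1%:M) ^+ k).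
  elim: k => [|k [a e]].
    by exists 1%:M; rewrite !expr0; exact: (@scalar_mx_block _ 1 n).
  exists (((\det u)^-1%:M - 1%:M : 'M_1) *m a); rewrite !exprS e {1}tb -mulmxE.
  apply: (etrans (@mulmx_block _ 1 n 1 n 1 n _ _ _ _ _ _ _ _)).
  by rewrite !mulmx0 !mul0mx !addr0 !add0r.
have [a ->] := pw n.+1 => /(congr1 (fun x : 'M_(1 + n) => drsubmx x)).
rewrite block_mxKdr => ->; apply/matrixP => i j; by rewrite !mxE.
Qed.

(** The path y (y^-1 z)^t stays in the radical, with y at t = 0 and z at t = 1. Two disjoint closed
    sets that cover the radical cannot share it. *)
Lemma trace_radical_connected : ag_connected trace_radical_group.
Proof.
move=> Y Z [SY YE] [SZ ZE] YZ dis; apply: contrapT => /not_orP[/eqP/set0P[y Yy] /eqP/set0P[z Zz]].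
have UY u : Y u -> trace_radical u by rewrite YE => -[].
have UZ u : Z u -> trace_radical u by rewrite ZE => -[].
pose T (S : set {mpoly C[n * n + 1]}) : {mpoly C[n.+1 * n.+1]} -> Prop :=
  fun q => exists2 p, S p & forall g, ev (tl g) q = p.@[glcoord g 0].
have TP S u : (forall q, T S q -> ev (tl u) q = 0) <-> (forall p, S p -> p.@[glcoord u 0] = 0).
  split=> h p; first by have [q qE] := glcoord_poly p; move=> Sp; rewrite -qE h //; exists p.
  by case=> p' Sp qE; rewrite qE h.
pose w := invmx y *m z; have Uy := UY _ Yy; have Uw : trace_radical w.
  by apply: trace_radical_mul; [exact: trace_radical_inv | exact: UZ].
have path t : exists2 u, trace_radical u & tl y *m tl w ^+ t = tl u.
  elim: t => [|t [u Uu e]]; first by exists y; rewrite // expr0 mulmx1.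
  exists (u *m w); first exact: trace_radical_mul.
  by rewrite exprSr -mulmxE mulmxA e tlM.
have e1 : tl y *m tl w ^+ 1 = tl z.
  by rewrite expr1 -tlM mulmxA mulmxV ?mul1mx //; exact: ag_unit Uy.1.
have e0 : tl y *m tl w ^+ 0 = tl y by rewrite expr0 mulmx1.
have inY u : trace_radical u -> (forall q, T SY q -> ev (tl u) q = 0) -> Y u.
  by rewrite YE => Uu /TP h; split.
have inZ u : trace_radical u -> (forall q, T SZ q -> ev (tl u) q = 0) -> Z u.
  by rewrite ZE => Uu /TP h; split.
have no u : Y u -> Z u -> False by move=> Yu Zu; have : (Y `&` Z) u by []; rewrite dis.
have [t|h|h] := unipotent_path_dichotomy (y := tl y) (S1 := T SY) (S2 := T SZ) (trace_radical_nilpotent Uw).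
- have [u Uu ->] := path t; have : (Y `|` Z) u by rewrite YZ.
  by case=> [|]; [rewrite YE => -[_ h]; left | rewrite ZE => -[_ h]; right]; apply/TP.
- by apply: (no z) => //; apply: inY => [|q /(h 1%N)]; [exact: UZ | rewrite e1].
by apply: (no y) => //; apply: inZ => // q /(h 0%N); rewrite e0.
Qed.

Lemma tlG_trace : reductive G -> forall u, tlG G u ->
  (forall h, tlG G h -> \tr (u *m h) = \tr h) -> u = 1%:M.
Proof.
move=> red _ [u Gu ->] hu.
have := red _ trace_radical_normal trace_radical_connected trace_radical_unipotent.
move=> /seteqP[/(_ u) h _]; rewrite h ?tl1 //; split=> // k Gk.
by apply: hu; exists k.
Qed.
End TraceRadical.

(** * Separation of closed orbits *)

Section Expansions.
Variable K : fieldType.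

Definition lin_closed (A : Type) (P : (A -> K) -> Prop) :=
  forall c d a, P c -> P d -> P (fun x => c x + a * d x).

Definition expands (A B : Type) (PA : (A -> K) -> Prop) (PB : (B -> K) -> Prop)
    (f : A -> B -> K) (I : finType) (c : I -> A -> K) (F : I -> B -> K) :=
  [/\ forall j, PA (c j), forall j, PB (F j) & forall h r, f h r = \sum_j c j h * F j r].

Definition independent (A : Type) (I : finType) (c : I -> A -> K) :=
  forall a : I -> K, (forall x, \sum_j a j * c j x = 0) -> forall j, a j = 0.

Lemma expands_sym A B PA PB f (I : finType) (c : I -> A -> K) (F : I -> B -> K) :
  expands PA PB f c F -> expands PB PA (fun r h => f h r) F c.
Proof.
by move=> [h1 h2 h3]; split=> // r h; rewrite h3; apply: eq_bigr => j _; rewrite mulrC.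
Qed.

Lemma expands_drop A B PA PB f s (c : 'I_s.+1 -> A -> K) (F : 'I_s.+1 -> B -> K) :
  lin_closed PA -> expands PA PB f c F -> ~ independent F ->
  exists (c' : 'I_s -> A -> K) (F' : 'I_s -> B -> K), expands PA PB f c' F'.
Proof.
move=> lA [cA FB fE] /existsNP[a /not_implyP[aF /existsNP[j0 /eqP aj]]].
exists (fun j x => c (lift j0 j) x + - (a (lift j0 j) / a j0) * c j0 x), (fun j => F (lift j0 j)).
split=> [j|j|h r] //; first exact: lA.
rewrite fE (bigD1_ord j0) //=.
have -> : F j0 r = - \sum_j a (lift j0 j) / a j0 * F (lift j0 j) r.
  apply: (mulfI aj); have := aF r; rewrite (bigD1_ord j0) //= => /eqP.
  rewrite addr_eq0 => /eqP ->; rewrite mulrN mulr_sumr; congr (- _).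
  by apply: eq_bigr => j _; rewrite mulrA [a j0 * _]mulrC divfK.
rewrite mulrN mulr_sumr -sumrN -big_split /=; apply: eq_bigr => j _.
by rewrite mulrDl mulNr mulNr [in RHS]addrC mulrA [c j0 h * _]mulrC.
Qed.

(** In an expansion with the least number of terms both families are independent, as a relation in
    either one would eliminate a term. *)
Lemma minimal_expansion A B PA PB f (I : finType) (c : I -> A -> K) (F : I -> B -> K) :
  lin_closed PA -> lin_closed PB -> expands PA PB f c F ->
  exists s (c' : 'I_s -> A -> K) (F' : 'I_s -> B -> K),
    [/\ expands PA PB f c' F', independent c' & independent F'].
Proof.
move=> lA lB [cA FB fE].
pose Q s := `[< exists (c : 'I_s -> A -> K) (F : 'I_s -> B -> K), expands PA PB f c F >].
have exQ : exists s, Q s.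
  exists #|I|; apply/asboolP; exists (fun j => c (enum_val j)), (fun j => F (enum_val j)).
  split=> // h r; rewrite fE (reindex (@enum_val I predT)) //=.
  exact/onW_bij/enum_val_bij.
have [s /asboolP[c' [F' e]] smin] := ex_minnP exQ; exists s, c', F'; split=> //.
  apply: contrapT => dep; case: s c' F' e smin dep => [|s] c' F' e smin dep.
    by apply: dep => a _ [].
  have [F'' [c'' e']] := expands_drop lB (expands_sym e) dep.
  suff : Q s by move/smin; rewrite ltnn.
  by apply/asboolP; exists c'', F''; have := expands_sym e'.
apply: contrapT => dep; case: s c' F' e smin dep => [|s] c' F' e smin dep.
  by apply: dep => a _ [].
have [c'' [F'' e']] := expands_drop lA e dep.
suff : Q s by move/smin; rewrite ltnn.
by apply/asboolP; exists c'', F''.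
Qed.

(** The vectors of values (c_j x)_j span, since a form killing them all is a relation between the
    c_j. Finitely many points x therefore suffice, and a left inverse L recovers coefficients from
    the values at these points. *)
Lemma independent_sample A s (c : 'I_s -> A -> K) : independent c ->
  exists q (h : 'I_q -> A) (L : 'M[K]_(s, q)), L *m \matrix_(i, j) c j (h i) = 1%:M.
Proof.
move=> indc; have [q [B [_ PB BP]]] :=
  basis_from_predicate (fun v : 'rV_s => exists h, v = \row_j c j h).
have [h hE] := boolp.choice PB.
have fullB : row_full B.
  rewrite /row_full -mxrank_tr -/(row_free B^T); apply: inj_row_free => v vB.
  apply/rowP => j; rewrite mxE; apply: indc => x.
  have /submxP[u uE] : (\row_j c j x <= B)%MS by apply: BP; exists x.
  have : (\row_j c j x) *m v^T = 0 by rewrite uE -mulmxA -[B]trmxK -trmx_mul vB trmx0 mulmx0.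
  move=> /(congr1 (fun y : 'M_1 => y 0 0)); rewrite mxE [RHS]mxE; apply: etrans.
  by apply: eq_bigr => i _; rewrite !mxE mulrC.
have /row_fullP[L LB] := fullB; exists q, h, L.
rewrite -[RHS]LB; congr (_ *m _); apply/row_matrixP => i; rewrite hE.
by apply/rowP => j; rewrite !mxE.
Qed.
End Expansions.

Section ConjugationAction.
Variables (R : realType) (Gam : groupType) (n : nat) (G : algGroup R n).
Variables (s : nat) (gen : 'I_s -> Gam).
Local Notation C := R[i].
Local Notation MP := {mpoly C[n.+1 * n.+1]}.
Local Notation rep := (rep Gam G).
Local Notation elt := {g | ag_set G g}.

Lemma rep_ext (r r' : rep) : (forall x, r x = r' x) -> r = r'.
Proof.
case: r r' => [f f1 f2] [g g1 g2] /= /funext e; case: _ / e in g1 g2 *.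
by congr Rep; exact: Prop_irrelevance.
Qed.

Fact act_in (a : elt) (r : rep) x : G (sval a *m r x *m invmx (sval a)).
Proof.
case: a => g Gg /=; apply: ag_mul; last exact: ag_inv.
by apply: ag_mul => //; exact: rep_in.
Qed.

Fact act_mul (a : elt) (r : rep) x y : sval a *m r (x * y)%g *m invmx (sval a) =
  (sval a *m r x *m invmx (sval a)) *m (sval a *m r y *m invmx (sval a)).
Proof.
case: a => g Gg /=; rewrite rep_mul !mulmxA mulmxKV //; exact: ag_unit Gg.
Qed.

Definition act (a : elt) (r : rep) : rep := Rep (act_in a r) (act_mul a r).

Definition elt_mul (a b : elt) : elt := exist _ _ (ag_mul (proj2_sig a) (proj2_sig b)).
Definition elt1 : elt := exist _ _ (ag_1 G).

Lemma act1 r : act elt1 r = r.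
Proof. by apply: rep_ext => x /=; rewrite invmx1 mulmx1 mul1mx. Qed.

Lemma actM a b r : act (elt_mul a b) r = act a (act b r).
Proof.
apply: rep_ext => x; case: a b => [g Gg] [h Gh] /=.
have ug := ag_unit Gg; have uh := ag_unit Gh.
suff -> : invmx (g *m h) = invmx h *m invmx g by rewrite !mulmxA.
have ugh : g *m h \in unitmx by rewrite unitmx_mul ug.
by apply: (can_inj (mulKmx ugh)); rewrite mulmxV // mulmxA mulmxK // mulmxV.
Qed.

Lemma orbit_act r r' : Defs.orbit r r' <-> exists a, r' = act a r.
Proof.
split=> [[g Gg e]|[[g Gg] ->]]; last by exists g.
by exists (exist _ g Gg); apply: rep_ext => x; rewrite e.
Qed.

Definition elt_regular (c : elt -> C) := exists p : MP, forall a, c a = ev (tl (sval a)) p.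
Definition rep_regular (F : rep -> C) := regular_on (homcoord gen) [set: rep] F.

Lemma elt_regular_lin : lin_closed elt_regular.
Proof.
by move=> c d k [p pE] [q qE]; exists (p + k *: q) => a; rewrite evD evZ pE qE.
Qed.

Lemma rep_regular_lin : lin_closed rep_regular.
Proof.
move=> c d k [p pE] [q qE]; exists (p + k *: q) => a _.
by rewrite mevalD mevalZ pE // qE.
Qed.

Definition expandable (f : rep -> C) := exists (I : finType) c F,
  expands elt_regular rep_regular (fun a r => f (act a r)) (c : I -> elt -> C) F.

Lemma expandable_monomial f c F : elt_regular c -> rep_regular F ->
  (forall a r, f (act a r) = c a * F r) -> expandable f.
Proof.
move=> rc rF fE; exists unit, (fun=> c), (fun=> F); split=> // a r.
by rewrite fE (bigD1 tt) //= big1 ?addr0 // => -[].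
Qed.

Lemma expandableD f g : expandable f -> expandable g -> expandable (fun r => f r + g r).
Proof.
move=> [I [c [F [c1 F1 fE]]]] [J [d [H [d1 H1 gE]]]].
exists (I + J)%type, (fun t => match t with inl i => c i | inr j => d j end),
  (fun t => match t with inl i => F i | inr j => H j end).
split=> [[]|[]|a r] //=.
by rewrite fE gE big_sumType.
Qed.

Lemma elt_regularM c d : elt_regular c -> elt_regular d -> elt_regular (fun a => c a * d a).
Proof. by move=> [p pE] [q qE]; exists (p * q) => a; rewrite evM pE qE. Qed.

Lemma elt_regular1 : elt_regular (fun=> 1).
Proof. by exists 1%:MP => a; rewrite evC. Qed.

Lemma expandableM f g : expandable f -> expandable g -> expandable (fun r => f r * g r).
Proof.
move=> [I [c [F [c1 F1 fE]]]] [J [d [H [d1 H1 gE]]]].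
exists (I * J)%type, (fun t a => c t.1 a * d t.2 a), (fun t r => F t.1 r * H t.2 r).
split=> [[i j]|[i j]|a r] /=; [exact: elt_regularM (c1 i) (d1 j)|exact: regular_mul (F1 i) (H1 j)|].
rewrite fE gE big_distrlr pair_bigA; apply: eq_bigr => -[i j] _ /=.
by rewrite mulrACA.
Qed.

Lemma elt_regular_entry i j : elt_regular (fun a => sval a i j).
Proof.
exists (genmx_var C n (rshift 1 i : 'I_(1 + n)) (rshift 1 j : 'I_(1 + n))) => a.
by rewrite evX /tl (@block_mxEdr _ 1 n 1 n).
Qed.

Lemma elt_regular_inv i j : elt_regular (fun a => invmx (sval a) i j).
Proof.
pose X := drsubmx (genmx_var C n : 'M_(1 + n)).
exists (genmx_var C n ord0 ord0 * (\adj X) i j) => -[g Gg] /=.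
have eX : map_mx (ev (tl g)) X = g.
  apply/matrixP => a b; rewrite [LHS]mxE [X in ev _ X]mxE [X in ev _ X]mxE evX.
  by rewrite /tl (@block_mxEdr _ 1 n 1 n).
have -> : invmx g = (\det g)^-1 *: \adj g by rewrite /invmx (ag_unit Gg).
have t0 : tl g ord0 ord0 = (\det g)^-1.
  by rewrite -ulsub_in /tl block_mxKul mxE eqxx mulr1n.
rewrite [LHS]mxE evM evX t0; congr (_ * _).
have := map_mx_adj (ev (tl g)) X; rewrite eX => /matrixP/(_ i j) <-.
by rewrite mxE.
Qed.

(** Local finiteness of the action on regular functions. The expandable functions form an algebra
    that contains the coordinates: entries of g r g^-1 are bilinear in those of g, g^-1 and r, and
    determinants are invariant. *)
Lemma regular_expandable f : rep_regular f -> expandable f.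
Proof.
case=> p; move: f; elim/mpoly_ring_ind: p => [k|l|p q hp hq|p q hp hq] f fE.
- apply: (@expandable_monomial _ _ (fun=> k) elt_regular1); first exact: regular_cst.
  by move=> a r; rewrite fE // mevalC mul1r.
- have {}fE r : f r = homcoord gen r 0 l by rewrite fE // mevalXU.
  case/mxvec_indexP: l fE => i l; rewrite -(splitK l); case: (fintype.split l) => k /= fE.
    case/mxvec_indexP: k fE => x y fE.
    have fE' r : f r = r (gen i) x y.
      by rewrite fE /homcoord mxvecE mxE /glcoord row_mxEl mxvecE.
    exists ('I_n * 'I_n)%type, (fun (t : 'I_n * 'I_n) (a : elt) => (sval a) x t.1 * invmx (sval a) t.2 y),
      (fun (t : 'I_n * 'I_n) (r : rep) => r (gen i) t.1 t.2); split=> [t|t|a r].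
    - by apply: elt_regularM; [exact: elt_regular_entry | exact: elt_regular_inv].
    - apply: (regular_gen gen i (f := fun g => g t.1 t.2)); exact: regular_entry.
    rewrite fE' /= mxE.
    transitivity (\sum_v \sum_u sval a x u * r (gen i) u v * invmx (sval a) v y).
      by apply: eq_bigr => v _; rewrite mxE big_distrl.
    rewrite exchange_big pair_bigA; apply: eq_bigr => -[u v] _ /=.
    by rewrite mulrAC.
  apply: (@expandable_monomial _ (fun=> 1) f elt_regular1).
    apply: (regular_ext (f := fun r => homcoord gen r 0 (mxvec_index i (rshift (n * n) k)))) => [r _|].
      by rewrite fE.
    exact: regular_coord.
  have fE' r : f r = (\det (r (gen i)))^-1.
    by rewrite fE /homcoord mxvecE mxE /glcoord row_mxEr mxE.
  move=> [g Gg] r; rewrite mul1r !fE' /= !det_mulmx mulrAC -det_mulmx.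
  by rewrite mulmxV ?det1 ?mul1r //; exact: ag_unit Gg.
- have [I [c [F [h1 h2 h3]]]] := expandableD (hp _ (fun _ _ => erefl)) (hq _ (fun _ _ => erefl)).
  by exists I, c, F; split=> // a r; rewrite fE // mevalD h3.
have [I [c [F [h1 h2 h3]]]] := expandableM (hp _ (fun _ _ => erefl)) (hq _ (fun _ _ => erefl)).
by exists I, c, F; split=> // a r; rewrite fE // mevalM h3.
Qed.
End ConjugationAction.

Section InvariantSeparation.
Variables (R : realType) (Gam : groupType) (n : nat) (G : algGroup R n).
Hypotheses (hconn : ag_connected G) (hred : reductive G).
Variables (s : nat) (gen : 'I_s -> Gam).
Local Notation C := R[i].
Local Notation MP := {mpoly C[n.+1 * n.+1]}.
Local Notation rep := (rep Gam G).
Local Notation elt := {g | ag_set G g}.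

(** A minimal expansion of f yields an equivariant map [Fv] to a finite dimensional representation.
    It sends y to 0 and z to a nonzero fixed vector, because f is constant on both orbits. An
    invariant linear form that does not vanish at this vector, composed with [Fv], is the invariant
    sought. *)
Lemma invariant_separation (f : rep -> C) (y z : rep) : rep_regular gen f ->
  (forall a, f (act a y) = 0) -> (forall a, f (act a z) = 1) ->
  exists F : invfun G gen, F y = 0 /\ F z != 0.
Proof.
move=> /regular_expandable[I [c0 [F0 e0]]] fy fz.
have [k [c [F [[cA FB fE] ic iF]]]] :=
  minimal_expansion (@elt_regular_lin _ _ G) (@rep_regular_lin _ _ _ G _ gen) e0.
have [q [h [L LC]]] := independent_sample ic.
have [p pE] := boolp.choice cA.
pose Fv r : 'cV[C]_k := \col_j F j r.
have FvE r : Fv r = L *m \col_i f (act (h i) r).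
  rewrite -[LHS]mul1mx -LC -mulmxA; congr (_ *m _); apply/colP => i.
  by rewrite [RHS]mxE fE mxE; apply: eq_bigr => j _; rewrite !mxE.
(* The values f(h_i a r) = sum_l c_l(h_i a) F_l(r) determine [Fv (act a r)] through L, so the matrix
   that carries [Fv r] to it is polynomial in a. *)
pose pi : 'M[MP]_k := \matrix_(j, l) \sum_i L j i *: ltr (tl (sval (h i))) (p l).
have piE (a : elt) j l : rep_at pi (tl (sval a)) j l = \sum_i L j i * c l (elt_mul (h i) a).
  rewrite /rep_at [LHS]mxE [X in ev _ X]mxE ev_sum; apply: eq_bigr => i _.
  by rewrite evZ ev_ltr -tlM pE.
have act_Fv a r : Fv (act a r) = rep_at pi (tl (sval a)) *m Fv r.
  apply/colP => j; rewrite FvE !mxE.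
  transitivity (\sum_i \sum_l L j i * c l (elt_mul (h i) a) * F l r).
    apply: eq_bigr => i _; rewrite mxE -actM fE mulr_sumr.
    by apply: eq_bigr => l _; rewrite mulrA.
  rewrite exchange_big; apply: eq_bigr => l _; rewrite piE [Fv r _ _]mxE mulr_suml.
  by [].
(* Independence of the F_j means that the vectors [Fv r] span, so [pi] inherits its multiplicativity
   from the action. *)
have Fv_ext (A B : 'M[C]_k) : (forall r, A *m Fv r = B *m Fv r) -> A = B.
  move=> AB; apply/matrixP => i j; apply/eqP; rewrite -subr_eq0; apply/eqP.
  apply: (iF (fun j => A i j - B i j)) => r.
  have := congr1 (fun x : 'cV_k => x i 0) (AB r); rewrite !mxE => e.
  under eq_bigr => l _ do rewrite mulrBl.
  rewrite sumrB; apply/eqP; rewrite subr_eq0; apply/eqP.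
  have e' (X : 'M[C]_k) : \sum_l X i l * F l r = \sum_l X i l * Fv r l 0.
    by apply: eq_bigr => l _; rewrite mxE.
  by rewrite !e'.
have rpi : regular_rep (tlG G) pi.
  split=> [|_ _ [g Gg ->] [g' Gg' ->]]; apply: Fv_ext => r.
    have := act_Fv (elt1 G) r; rewrite act1 /= tl1 => <-; by rewrite mul1mx.
  have := actM (exist _ g Gg) (exist _ g' Gg') r => /(congr1 Fv).
  by rewrite !act_Fv /= tlM mulmxA.
have Fz a : Fv (act a z) = Fv z.
  by rewrite !FvE; congr (_ *m _); apply/colP => i; rewrite !mxE -actM !fz.
have lfix g : tlG G g -> rep_at pi g *m Fv z = Fv z.
  by move=> [g' Gg' ->]; rewrite -[RHS](Fz (exist _ g' Gg')) act_Fv.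
have l0 : Fv z != 0.
  apply/eqP => Fz0; have := fz (elt1 G); rewrite fE big1 => [/eqP|j _].
    by rewrite eq_sym oner_eq0.
  by have := congr1 (fun x : 'cV_k => x j 0) Fz0; rewrite !mxE => ->; rewrite mulr0.
have Fy : Fv y = 0.
  by rewrite FvE; apply/colP => j; rewrite !mxE big1 // => i _; rewrite mxE fy mulr0.
have [v [vfix vl]] := linearly_reductive (tlG_lin_group G) (tlG_trace hred)
  (tlG_connected hconn) rpi lfix l0.
pose H r := (v *m Fv r) 0 0.
have HE r : H r = \sum_j v 0 j * F j r by rewrite /H mxE; apply: eq_bigr => j _; rewrite mxE.
have Hreg : regular_on (homcoord gen) [set: rep] H.
  apply: (regular_ext (f := fun r => \sum_j v 0 j * F j r)) => [r _|]; first exact: HE.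
  apply: regular_sum => j; apply: regular_mul (FB j); exact: regular_cst.
have Hinv r r' : Defs.orbit r r' -> H r' = H r.
  move=> /orbit_act[[g Gg] ->]; rewrite /H act_Fv mulmxA vfix //; by exists g.
exists (InvFun Hreg Hinv) => /=; split; first by rewrite /H Fy mulmx0 mxE.
apply: contraNneq vl => e; apply/eqP/matrixP => i j; by rewrite !ord1 [RHS]mxE.
Qed.
End InvariantSeparation.

(** * Polynomial separation of closed sets of representations *)

Section PolynomialPoints.
Variables (R : realType) (Gam : groupType) (n : nat) (G : algGroup R n).
Variables (s : nat) (gen : 'I_s -> Gam).
Hypothesis hgen : generates gen.
Local Notation C := R[i].
Local Notation M := (s * (n * n + 1))%N.
Local Notation MP := {mpoly C[M]}.
Local Notation rep := (rep Gam G).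

Lemma rep1 (r : rep) : r 1%g = 1%:M.
Proof.
have U := ag_unit (rep_in r 1%g).
have E : r 1%g *m r 1%g = r 1%g by rewrite -rep_mul mulg1.
by rewrite -[LHS](mulKmx U) E mulVmx.
Qed.

Lemma rep_inv (r : rep) x : r (x^-1)%g = invmx (r x).
Proof.
have U := ag_unit (rep_in r x).
by rewrite -[LHS](mulKmx U) -rep_mul mulgV rep1 mulmx1.
Qed.

Definition at_point (a b : nat) (x : 'I_M -> C) (W : 'M[MP]_(a, b)) : 'M[C]_(a, b) :=
  map_mx (meval x) W.

(** The induction on words carries a polynomial matrix for the inverse as well; for a generator it
    is the adjugate times the coordinate 1 / det. *)
Lemma word_poly x : exists W : 'M[MP]_n, forall r : rep, at_point (homcoord gen r 0) W = r x.
Proof.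
suff : exists W W' : 'M[MP]_n, forall r : rep,
    at_point (homcoord gen r 0) W = r x /\ at_point (homcoord gen r 0) W' = invmx (r x).
  by case=> W [W' h]; exists W => r; case: (h r).
move: x; apply: (hgen (P := fun x => exists W W' : 'M[MP]_n, forall r : rep,
    at_point (homcoord gen r 0) W = r x /\ at_point (homcoord gen r 0) W' = invmx (r x))).
- exists 1%:M, 1%:M => r; by rewrite /at_point map_mx1 rep1 invmx1.
- move=> x y [W [W' Wx]] [V [V' Vy]]; exists (W *m V), (V' *m W') => r.
  have [e1 e2] := Wx r; have [e3 e4] := Vy r.
  rewrite /at_point !map_mxM -![map_mx _ _]/(at_point _ _) e1 e2 e3 e4 rep_mul; split=> //.
  by rewrite -rep_mul -!rep_inv -rep_mul invgM.
- move=> x [W [W' Wx]]; exists W', W => r; have [e1 e2] := Wx r.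
  by rewrite e1 e2 -!rep_inv invgK.
move=> i; pose X : 'M[MP]_n := \matrix_(a, b) 'X_(mxvec_index i (lshift 1 (mxvec_index a b))).
pose t : MP := 'X_(mxvec_index i (rshift (n * n) ord0)).
exists X, (t *: \adj X) => r.
have eX : at_point (homcoord gen r 0) X = r (gen i).
  apply/matrixP => a b; rewrite [LHS]mxE [X in meval _ X]mxE mevalXU /homcoord mxvecE mxE.
  by rewrite /glcoord row_mxEl mxvecE.
split=> //; rewrite /at_point map_mxZ map_mx_adj -[map_mx _ X]/(at_point _ X) eX.
have et : meval (homcoord gen r 0) t = (\det (r (gen i)))^-1.
  by rewrite /t mevalXU /homcoord mxvecE mxE /glcoord row_mxEr mxE.
by rewrite /= et /invmx (ag_unit (rep_in r _)).
Qed.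

(** Hom is closed in affine space, not merely in the product of copies of G. Multiplicativity and
    the equations of G are identities between polynomials in the coordinates of the generators;
    holding at all representations, they hold at x. *)
Lemma rep_of_point (x : 'I_M -> C) :
  (forall p : MP, (forall r : rep, p.@[homcoord gen r 0] = 0) -> p.@[x] = 0) ->
  exists r : rep, forall k, homcoord gen r 0 k = x k.
Proof.
move=> hx; have [W WE] := boolp.choice word_poly.
pose rho g := at_point x (W g).
have ent a b (A B : 'M[MP]_(a, b)) :
    (forall r : rep, at_point (homcoord gen r 0) A = at_point (homcoord gen r 0) B) ->
    at_point x A = at_point x B.
  move=> AB; apply/matrixP => i j; rewrite [LHS]mxE [RHS]mxE; apply/eqP.
  rewrite -subr_eq0 -mevalB; apply/eqP/hx => r; rewrite mevalB.
  have := congr1 (fun X : 'M_(_, _) => X i j) (AB r); rewrite /= [LHS]mxE [RHS]mxE => ->.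
  by rewrite subrr.
have rho_mul g h : rho (g * h)%g = rho g *m rho h.
  rewrite /rho /at_point -map_mxM; apply: ent => r.
  by rewrite WE rep_mul /at_point map_mxM -![map_mx _ _]/(at_point _ _) !WE.
have rho1 : rho 1%g = 1%:M.
  rewrite -[RHS](map_mx1 (meval x)); apply: ent => r.
  by rewrite WE rep1 /at_point map_mx1.
pose Q g : 'rV[MP]_(n * n + 1) := row_mx (mxvec (W g)) (const_mx (\det (W g^-1)%g)).
have QE (r : rep) g : at_point (homcoord gen r 0) (Q g) = glcoord (r g).
  rewrite /at_point /Q map_row_mx map_mxvec map_const_mx -det_map_mx.
  rewrite -![map_mx _ _]/(at_point _ _) !WE rep_inv det_inv.
  by [].
have rho_unit g : rho g *m rho (g^-1)%g = 1%:M by rewrite -rho_mul mulgV.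
have rhoQ g : at_point x (Q g) = glcoord (rho g).
  rewrite /at_point /Q map_row_mx map_mxvec map_const_mx -det_map_mx.
  rewrite -![map_mx _ _]/(at_point _ _) -![at_point _ _]/(rho _) /glcoord; congr (row_mx _ (const_mx _)).
  have := congr1 determinant (rho_unit g); rewrite det_mulmx det1 => e.
  have d0 : \det (rho g) != 0.
    by apply: contra_eqN e => /eqP ->; rewrite mul0r eq_sym oner_eq0.
  by apply: (mulfI d0); rewrite e mulfV.
have rho_in g : G (rho g).
  have [S SE] := ag_closed G; rewrite SE; split; first by case/mulmx1_unit: (rho_unit g).
  move=> p Sp; pose P : MP := p \mPo [tuple Q g 0 k | k < n * n + 1].
  have PE y : P.@[y] = p.@[at_point y (Q g) 0].
    rewrite comp_mpoly_meval; apply: meval_eq => k; by rewrite tnth_mktuple [RHS]mxE.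
  rewrite -rhoQ -PE; apply: hx => r; rewrite PE QE.
  by have := rep_in r g; rewrite {1}SE => -[_]; exact.
exists (Rep rho_in rho_mul) => k; case/mxvec_indexP: k => i k.
rewrite /homcoord mxvecE mxE /= -rhoQ mxE; apply/eqP; rewrite -subr_eq0.
rewrite -[x _](@mevalXU _ _ x) -mevalB; apply/eqP/hx => r; rewrite mevalB mevalXU.
have := congr1 (fun X : 'rV__ => X 0 k) (QE r (gen i)); rewrite /= [LHS]mxE => ->.
by rewrite /homcoord mxvecE mxE subrr.
Qed.

(** The ideals of Y and Z have no common zero, since by [rep_of_point] it would be a representation
    in both sets. By the Nullstellensatz 1 = u + v with u vanishing on Y and v on Z. *)
Lemma separating_polynomial (Y Z : set rep) :
  closed_in (homcoord gen) [set: rep] Y -> closed_in (homcoord gen) [set: rep] Z ->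
  Y `&` Z = set0 -> exists p : MP,
    (forall r, Y r -> p.@[homcoord gen r 0] = 0) /\
    (forall r, Z r -> p.@[homcoord gen r 0] = 1).
Proof.
move=> [SY YE] [SZ ZE] YZ.
pose I (X : set rep) (p : MP) := forall r, X r -> p.@[homcoord gen r 0] = 0.
pose J p := exists u v, [/\ I Y u, I Z v & p = u + v].
have IM X p q : I X q -> I X (p * q) by move=> h r Xr; rewrite mevalM h ?mulr0.
have ID X p q : I X p -> I X q -> I X (p + q).
  by move=> h h' r Xr; rewrite mevalD h ?h' ?addr0.
have I0 X : I X 0 by move=> r _; rewrite meval0.
have idJ : mideal J.
  split=> [|p q [u [v [uY vZ ->]]] [u' [v' [uY' vZ' ->]]]|p q [u [v [uY vZ ->]]]].
  - by exists 0, 0; rewrite addr0; split.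
  - by exists (u + u'), (v + v'); rewrite addrACA; split=> //; exact: ID.
  by exists (p * u), (p * v); rewrite mulrDr; split=> //; exact: IM.
have [|u [v [uY vZ e]]] := weak_nullstellensatz idJ.
  move=> x zx; have [|r rx] := @rep_of_point x.
    move=> p p0; apply: zx; exists p, 0; rewrite addr0; split=> // r _; exact: p0.
  have xE p : p.@[homcoord gen r 0] = p.@[x] by apply: meval_eq.
  suff : (Y `&` Z) r by rewrite YZ.
  split.
    rewrite YE; split=> // p Sp; rewrite xE; apply: zx; exists p, 0; rewrite addr0.
    by split=> // r' ; rewrite YE => -[_]; exact.
  rewrite ZE; split=> // p Sp; rewrite xE; apply: zx; exists 0, p; rewrite add0r.
  by split=> // r' ; rewrite ZE => -[_]; exact.
exists u; split=> // r Zr; have := congr1 (meval (homcoord gen r 0)) e.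
by rewrite mevalC mevalD (vZ r Zr) addr0 => <-.
Qed.
End PolynomialPoints.

(** * Real forms *)

Section ConjugatePolynomials.
Variable R : realType.
Local Notation C := R[i].
Local Notation cj := (map_mx (@conjc R)).
Local Notation cplx := (map_mpoly (real_complex R)).

Lemma conjc_i : (('i : C)^*)%C = - 'i%C.
Proof. by apply/eqP; rewrite eq_complex /= oppr0 !eqxx. Qed.

Lemma i_mul_i : 'i%C * 'i%C = -1 :> C.
Proof. by apply/eqP; rewrite eq_complex /= !mulr0 !mul0r mulr1 addr0 sub0r oppr0 !eqxx. Qed.

Lemma cplx_conj N (p : {mpoly R[N]}) (v : 'I_N -> C) :
  (cplx p).@[fun k => ((v k)^*)%C] = (((cplx p).@[v])^*)%C.
Proof.
elim/mpoly_ring_ind: p => [c|i|p q hp hq|p q hp hq].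
- by rewrite map_mpolyC !mevalC; apply/eqP; rewrite eq_complex /= oppr0 !eqxx.
- by rewrite map_mpolyX !mevalXU.
- have -> : cplx (p + q) = cplx p + cplx q by exact: rmorphD.
  move: (cplx p) (cplx q) hp hq => a b hp hq.
  by rewrite [LHS]mevalD [in RHS]mevalD hp hq; apply/esym; exact: (rmorphD (@conjc R)).
have -> : cplx (p * q) = cplx p * cplx q by exact: rmorphM.
move: (cplx p) (cplx q) hp hq => a b hp hq.
by rewrite [LHS]mevalM [in RHS]mevalM hp hq; apply/esym; exact: (rmorphM (@conjc R)).
Qed.

Lemma complex_poly_split N (q : {mpoly C[N]}) :
  exists q1 q2 : {mpoly R[N]}, q = cplx q1 + 'i%C *: cplx q2.
Proof.
elim/mpoly_ring_ind: q => [c|i|p q [p1 [p2 ->]] [q1 [q2 ->]]|p q [p1 [p2 ->]] [q1 [q2 ->]]].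
- exists (complex.Re c)%:MP, (complex.Im c)%:MP; rewrite !map_mpolyC -mul_mpolyC -mpolyCM -mpolyCD.
  by congr mpolyC; case: c => a b; apply/eqP; rewrite eq_complex /= !(mul0r, mul1r, mulr0, addr0, add0r, subr0) !eqxx.
- by exists 'X_i, 0; rewrite map_mpolyX rmorph0 scaler0 addr0.
- exists (p1 + q1), (p2 + q2).
  have e a b : cplx (a + b) = cplx a + cplx b :> {mpoly C[N]} by exact: rmorphD.
  by rewrite !e scalerDr addrACA.
exists (p1 * q1 - p2 * q2), (p1 * q2 + p2 * q1).
have eD a b : cplx (a + b) = cplx a + cplx b :> {mpoly C[N]} by exact: rmorphD.
have eB a b : cplx (a - b) = cplx a - cplx b :> {mpoly C[N]} by exact: rmorphB.
have eM a b : cplx (a * b) = cplx a * cplx b :> {mpoly C[N]} by exact: rmorphM.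
rewrite eB eD !eM.
have ii : ('i%C)%:MP * ('i%C)%:MP = -1 :> {mpoly C[N]} by rewrite -mpolyCM i_mul_i mpolyCN.
move: (cplx p1) (cplx p2) (cplx q1) (cplx q2) => a b c d; rewrite -!mul_mpolyC.
move: ('i%C)%:MP ii => e ii.
have -> : (a + e * b) * (c + e * d) = a * c + (e * e) * (b * d) + e * (a * d + b * c) by ring.
by rewrite ii mulN1r.
Qed.

Lemma conj_relation (x y : C) : (x^*)%C + 'i%C * (y^*)%C = 0 -> x - 'i%C * y = 0.
Proof.
case: x y => a b [c d] /eqP; rewrite eq_complex /= => /andP[/eqP h1 /eqP h2].
apply/eqP; rewrite eq_complex /=; apply/andP; split; apply/eqP.
  by rewrite -[RHS]h1; ring.
by apply: oppr_inj; rewrite oppr0 -[RHS]h2; ring.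
Qed.

Lemma split_zero (x y : C) : x + 'i%C * y = 0 -> x - 'i%C * y = 0 -> x = 0 /\ y = 0.
Proof.
have two0 : (2 : C) != 0 by rewrite pnatr_eq0.
have i0 : ('i%C : C) != 0.
  by apply/eqP => i0; have := i_mul_i; rewrite i0 mul0r => /eqP; rewrite eq_sym oppr_eq0 oner_eq0.
move: i0; move: ('i%C : C) => e i0 h h'; split.
  apply: (mulfI two0); rewrite mulr0 -[RHS]addr0 -{1}h -h'; ring.
apply: (mulfI i0); apply: (mulfI two0); rewrite !mulr0 -[RHS]subr0 -{1}h -h'; ring.
Qed.

Lemma glcoord_conj n (h : 'M[C]_n) : glcoord (cj h) = map_mx (@conjc R) (glcoord h).
Proof.
rewrite /glcoord map_row_mx map_mxvec map_const_mx det_map_mx; congr (row_mx _ (const_mx _)).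
by rewrite fmorphV.
Qed.

(** Write an equation as q1 + i q2 with q1 and q2 real. Its vanishing at the conjugate of a point
    gives, after conjugation, q1 - i q2 = 0 at the point itself, so q1 and q2 are equations of H. *)
Lemma conj_stable_defined_over_R n (H : algGroup R n) :
  (forall h, H h -> H (cj h)) -> defined_over_R H.
Proof.
move=> Hcj; exists [set p | forall h, H h -> (cplx p).@[glcoord h 0] = 0].
apply/seteqP; split=> h /=; first by move=> Hh; split; [exact: ag_unit Hh | move=> p; exact].
case=> uh hp; have [S SE] := ag_closed H; rewrite SE; split=> // q Sq.
have [q1 [q2 qE]] := complex_poly_split q.
have q0 k : H k -> (cplx q1).@[glcoord k 0] + 'i%C * (cplx q2).@[glcoord k 0] = 0.
  by move=> Hk; have := Hk; rewrite SE => -[_ /(_ q Sq)]; rewrite qE mevalD mevalZ.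
have q0' k : H k -> (cplx q1).@[glcoord k 0] - 'i%C * (cplx q2).@[glcoord k 0] = 0.
  move=> Hk; have qk := q0 _ (Hcj _ Hk).
  have e (p : {mpoly R[n * n + 1]}) :
      (cplx p).@[glcoord (cj k) 0] = (((cplx p).@[glcoord k 0])^*)%C.
    by rewrite -cplx_conj; apply: meval_eq => l; rewrite glcoord_conj mxE.
  apply: conj_relation; rewrite -[RHS]qk.
  by congr (_ + _ * _); apply/esym; [exact: (e q1) | exact: (e q2)].
have q12 k (Hk : H k) := split_zero (q0 k Hk) (q0' k Hk).
have h1 := hp q1 (fun k Hk => (q12 k Hk).1).
have h2 := hp q2 (fun k Hk => (q12 k Hk).2).
have qv v : q.@[v] = (cplx q1).@[v] + 'i%C * (cplx q2).@[v] by rewrite qE mevalD mevalZ.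
apply: (etrans (qv _)); apply: (etrans (congr2 (fun x y => x + 'i%C * y) h1 h2)).
by rewrite mulr0 addr0.
Qed.
End ConjugatePolynomials.

Section FixedPointsRealForm.
Variables (R : realType) (n : nat) (G : algGroup R n) (tau : antiInvolution G).
Local Notation C := R[i].
Local Notation cj := (map_mx (@conjc R)).

(** The change of coordinates (z, w) |-> (z + w, i z - i w). Conjugating P exchanges its block
    columns, so that entrywise conjugation of P diag(a, b) P^-1 conjugates a and b and exchanges
    them. *)
Definition realifier : 'M[C]_(n + n) := block_mx 1%:M 1%:M 'i%C%:M (- 'i%C)%:M.
Local Notation P := realifier.
Definition block_swap : 'M[C]_(n + n) := block_mx 0 1%:M 1%:M 0.

Lemma realifier_unit : P \in unitmx.
Proof.
pose c : C := 2^-1; pose Q : 'M[C]_(n + n) := block_mx c%:M (- 'i%C * c)%:M c%:M ('i%C * c)%:M.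
suff /mulmx1_unit[] : P *m Q = 1%:M by [].
have cc : c + c = 1.
  have two0 : (2 : C) != 0 by rewrite pnatr_eq0.
  by apply: (mulfI two0); rewrite mulrDr !mulfV // mulr1.
rewrite /P /Q mulmx_block !mul1mx -!scalar_mxM -!raddfD /= !mulrA !mulNr !mulrN !i_mul_i.
by rewrite !opprK !mul1r mulN1r opprK cc addNr subrr !raddf0 -scalar_mx_block.
Qed.

Lemma conj_realifier : cj P = P *m block_swap.
Proof.
rewrite map_block_mx !map_scalar_mx mulmx_block !mulmx0 !mulmx1 !add0r !addr0.
congr (block_mx _%:M _%:M _%:M _%:M); try exact: (rmorph1 (@conjc R)); first exact: conjc_i.
exact: (etrans (rmorphN (@conjc R) _) (etrans (congr1 -%R (conjc_i R)) (opprK _))).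
Qed.

Lemma block_swapK : block_swap *m block_swap = 1%:M.
Proof. by rewrite mulmx_block !mulmx0 !mul0mx !mulmx1 !add0r !addr0 -scalar_mx_block. Qed.

Definition rlf (a b : 'M[C]_n) : 'M[C]_(n + n) := P *m block_mx a 0 0 b *m invmx P.
Definition unrlf (h : 'M[C]_(n + n)) := invmx P *m h *m P.

Lemma rlfK a b : unrlf (rlf a b) = block_mx a 0 0 b.
Proof.
have uP := realifier_unit.
by rewrite /unrlf /rlf !mulmxA mulVmx // mul1mx mulmxKV.
Qed.

Lemma unrlfK h : P *m unrlf h *m invmx P = h.
Proof.
have uP := realifier_unit.
by rewrite /unrlf !mulmxA mulmxV // mul1mx mulmxK.
Qed.

Lemma rlfM a b a' b' : rlf a b *m rlf a' b' = rlf (a *m a') (b *m b').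
Proof.
have uP := realifier_unit; rewrite /rlf !mulmxA mulmxKV // -(mulmxA P) mulmx_block.
by rewrite !mulmx0 !mul0mx !addr0 !add0r.
Qed.

Lemma rlf1 : rlf 1%:M 1%:M = 1%:M.
Proof.
have uP := realifier_unit.
by rewrite /rlf -scalar_mx_block mulmx1 mulmxV.
Qed.

Lemma rlf_conj a b : cj (rlf a b) = rlf (cj b) (cj a).
Proof.
have uP := realifier_unit.
have iP : cj (invmx P) = block_swap *m invmx P.
  have uc : cj P \in unitmx by rewrite map_unitmx.
  apply: (can_inj (mulKmx uc)); rewrite -map_mxM mulmxV // map_mx1 conj_realifier.
  by rewrite mulmxA -(mulmxA P block_swap block_swap) block_swapK mulmx1 mulmxV.
rewrite /rlf !map_mxM iP conj_realifier map_block_mx !map_mx0 !mulmxA; congr (_ *m _).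
rewrite -!mulmxA; congr (_ *m _); rewrite /block_swap !mulmx_block.
by rewrite !mulmx0 !mul0mx !mulmx1 !mul1mx !addr0 !add0r.
Qed.

Definition ctau g : 'M[C]_n := cj (tau g).

Lemma ctauM g h : G g -> G h -> ctau (g *m h) = ctau g *m ctau h.
Proof. by move=> Gg Gh; rewrite /ctau ai_mul // map_mxM. Qed.

Lemma ctau1 : ctau 1%:M = 1%:M.
Proof.
have G1 := ag_1 G; have U := ag_unit (ai_in tau G1); rewrite /ctau.
have E : tau 1%:M *m tau 1%:M = tau 1%:M by rewrite -ai_mul // mul1mx.
by rewrite -[tau _](mulKmx U) E mulVmx // map_mx1.
Qed.

(** The graph of [ctau], which is regular because [tau] is antiregular. In these coordinates
    entrywise conjugation of the graph is [tau] on G. *)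
Definition realified : set 'M[C]_(n + n) := [set h | exists2 g, G g & h = rlf g (ctau g)].

Lemma rlf_inv g : G g -> invmx (rlf g (ctau g)) = rlf (invmx g) (ctau (invmx g)).
Proof.
move=> Gg; have Gi := ag_inv Gg.
have e : rlf g (ctau g) *m rlf (invmx g) (ctau (invmx g)) = 1%:M.
  by rewrite rlfM -ctauM // mulmxV ?ctau1 ?rlf1 //; exact: ag_unit Gg.
have [u _] := mulmx1_unit e.
by rewrite -[RHS](mulKmx u) e mulmx1.
Qed.

Fact realified_1 : realified 1%:M.
Proof. by exists 1%:M; [exact: ag_1 | rewrite ctau1 rlf1]. Qed.

Fact realified_mul g h : realified g -> realified h -> realified (g *m h).
Proof.
move=> [a Ga ->] [b Gb ->]; exists (a *m b); first exact: ag_mul.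
by rewrite rlfM ctauM.
Qed.

Fact realified_inv g : realified g -> realified (invmx g).
Proof. by move=> [a Ga ->]; exists (invmx a); [exact: ag_inv | exact: rlf_inv]. Qed.

Lemma realified_unit h : realified h -> h \in unitmx.
Proof.
move=> rh; have [a Ga e] := rh.
have : h *m invmx h = 1%:M.
  by rewrite e rlf_inv // rlfM -ctauM ?mulmxV ?ctau1 ?rlf1 //; [exact: ag_unit Ga | exact: ag_inv].
by case/mulmx1_unit.
Qed.

Lemma unrlf_regular (X : set 'M[C]_(n + n)) i j :
  regular_on (@glcoord R (n + n)) X (fun h => unrlf h i j).
Proof.
apply: (regular_ext (f := fun h : 'M[C]_(n + n) => \sum_k \sum_l (invmx P i l * (h l k * P k j)) : C)) => [h _|].
  rewrite /unrlf mxE; apply: eq_bigr => k _; rewrite mxE big_distrl.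
  by apply: eq_bigr => l _; rewrite /= mulrA.
apply: regular_sum => k; apply: regular_sum => l.
apply: regular_mul; first exact: regular_cst.
by apply: regular_mul; [exact: regular_entry | exact: regular_cst].
Qed.

(** The [glcoord] of the upper left block, with the inverse determinant read off [invmx h] so that
    the map is regular on all of GL and not only on the graph. *)
Definition rcoord (h : 'M[C]_(n + n)) : 'rV[C]_(n * n + 1) :=
  row_mx (mxvec (ulsubmx (unrlf h))) (const_mx (\det (ulsubmx (unrlf (invmx h))))).

Lemma rcoordE g : G g -> rcoord (rlf g (ctau g)) = glcoord g.
Proof.
move=> Gg; rewrite /rcoord rlf_inv // !rlfK !block_mxKul /glcoord det_inv.
by [].
Qed.

Lemma rcoord_regular (X : set 'M[C]_(n + n)) k : (forall h, X h -> h \in unitmx) ->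
  regular_on (@glcoord R (n + n)) X (fun h => rcoord h 0 k).
Proof.
move=> Xu; rewrite -(splitK k); case: (fintype.split k) => l /=.
  case/mxvec_indexP: l => i j.
  apply: (regular_ext (f := fun h => unrlf h (lshift n i) (lshift n j))) => [h _|].
    by rewrite /rcoord row_mxEl mxvecE !mxE.
  exact: unrlf_regular.
apply: (regular_ext (f := fun h => \det (ulsubmx (unrlf (invmx h))))) => [h _|].
  by rewrite /rcoord row_mxEr mxE.
apply: regular_det => i j.
have [p pE] := unrlf_regular setT (lshift n i) (lshift n j).
apply: (regular_ext (f := fun h => p.@[glcoord (invmx h) 0])) => [h _|].
  by rewrite -pE // !mxE.
by apply: regular_comp => m; exact: regular_glcoord_inv.
Qed.

(** Regular identities on the graph pass to h by [van]. They give the block diagonal shape, the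
    invertibility of the first block a and its membership in G, and the value [ctau a] of the second
    block. *)
Fact realified_closed : closed_in (@glcoord R (n + n)) (@GL R (n + n)) realified.
Proof.
exists [set p | forall h, realified h -> p.@[glcoord h 0] = 0].
apply/seteqP; split=> h /=.
  by move=> rh; split; [exact: realified_unit | move=> p; exact].
move=> [uh hp].
have van f : regular_on (@glcoord R (n + n)) (@GL R (n + n)) f ->
    (forall g, G g -> f (rlf g (ctau g)) = 0) -> f h = 0.
  move=> [p pE] f0; rewrite pE //; apply: hp => k rk; have := rk => -[g Gg e].
  by rewrite -pE; [rewrite e f0 | exact: realified_unit].
set a := ulsubmx (unrlf h); set b := drsubmx (unrlf h).
have zero i j : (forall a b, block_mx a 0 0 b i j = 0 :> C) -> unrlf h i j = 0.
  move=> z; apply: (van (fun h => unrlf h i j)); first exact: unrlf_regular.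
  by move=> g _; rewrite rlfK z.
have hE : unrlf h = block_mx a 0 0 b.
  rewrite -[LHS]submxK; congr (block_mx _ _ _ _).
    apply/matrixP => i j; rewrite [RHS]mxE [LHS]mxE [LHS]mxE; apply: zero => x y.
    by rewrite block_mxEur mxE.
  apply/matrixP => i j; rewrite [RHS]mxE [LHS]mxE [LHS]mxE; apply: zero => x y.
  by rewrite block_mxEdl mxE.
have rreg k : regular_on (@glcoord R (n + n)) (@GL R (n + n)) (fun h => rcoord h 0 k).
  exact: rcoord_regular.
have da : \det a * \det (ulsubmx (unrlf (invmx h))) = 1.
  apply/eqP; rewrite -subr_eq0; apply/eqP.
  apply: (van (fun h => \det (ulsubmx (unrlf h)) * \det (ulsubmx (unrlf (invmx h))) + -1)).
    have rdet : regular_on (@glcoord R (n + n)) (@GL R (n + n)) (fun h => \det (ulsubmx (unrlf h))).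
      apply: regular_det => i j; apply: regular_ext (unrlf_regular _ (lshift n i) (lshift n j)).
      by move=> k _; rewrite !mxE.
    have rdi := rreg (rshift (n * n) ord0).
    have [p pE] := regular_mul rdet rdi; exists (p - 1%:MP) => k uk.
    by rewrite mevalB mevalC -pE // /rcoord row_mxEr mxE.
  move=> g Gg; rewrite rlf_inv // !rlfK !block_mxKul -det_mulmx mulmxV ?det1 ?subrr //.
  exact: ag_unit Gg.
have rcE : rcoord h = glcoord a.
  rewrite /rcoord /glcoord; congr (row_mx _ (const_mx _)).
  have d0 : \det a != 0 by apply: contra_eqN da => /eqP ->; rewrite mul0r eq_sym oner_eq0.
  by apply: (mulfI d0); rewrite da mulfV.
have Ga : G a.
  have [S SE] := ag_closed G; rewrite SE; split.
    by rewrite /GL /= unitmxE unitfE; apply: contra_eqN da => /eqP ->; rewrite mul0r eq_sym oner_eq0.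
  move=> p Sp; rewrite -rcE; apply: (van (fun h => p.@[rcoord h 0])).
    exact: regular_comp.
  by move=> g Gg; rewrite rcoordE //; move: Gg; rewrite SE => -[_]; exact.
exists a => //; rewrite -[LHS]unrlfK hE /rlf; congr (_ *m block_mx _ _ _ _ *m _).
apply/matrixP => i j; have [q qE] := ai_antiregular tau i j.
have qE' g : G g -> ctau g i j = q.@[glcoord g 0] by move=> Gg; rewrite mxE qE.
rewrite (qE' _ Ga) -rcE; apply/eqP; rewrite -subr_eq0; apply/eqP.
apply: (van (fun h => drsubmx (unrlf h) i j - q.@[rcoord h 0])).
  have [p pE] := unrlf_regular (@GL R (n + n)) (rshift n i) (rshift n j).
  have [p' p'E] := regular_comp q rreg; exists (p - p') => k uk.
  by rewrite mevalB -pE // -p'E // !mxE.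
by move=> g Gg; rewrite rlfK block_mxKdr rcoordE // qE' // subrr.
Qed.

Definition realified_group : algGroup R (n + n) :=
  AlgGroup realified_closed realified_1 realified_mul realified_inv.

Lemma realified_conj g : G g -> cj (rlf g (ctau g)) = rlf (tau g) (ctau (tau g)).
Proof.
move=> Gg; rewrite rlf_conj /ctau ai_invol //; congr rlf.
by apply/matrixP => i j; rewrite !mxE conjcK.
Qed.

(** The graph is stable under entrywise conjugation, hence defined over R, and isomorphic to G by
    its first block. As conjugation acts through [tau], the real matrices of the graph correspond to
    the fixed points of [tau]. *)
Theorem fixed_points_real_form : real_form G (fixed_points tau).
Proof.
exists (n + n)%N, realified_group, (fun h => ulsubmx (unrlf h)); split.
- apply: conj_stable_defined_over_R => _ [g Gg ->]; exists (tau g); first exact: ai_in.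
  exact: realified_conj.
- split; first split.
  + by move=> _ [g Gg ->]; rewrite rlfK block_mxKul.
  + by move=> _ _ [g Gg ->] [h Gh ->]; rewrite rlfM !rlfK !block_mxKul.
  + move=> i j; apply: regular_ext (unrlf_regular _ (lshift n i) (lshift n j)) => h _.
    by rewrite !mxE.
  exists (fun g => rlf g (ctau g)); split; first split.
  + by move=> g Gg; exists g.
  + by move=> g h Gg Gh; rewrite rlfM ctauM.
  + move=> i j.
    have rb k l : regular_on (@glcoord R n) (ag_set G) (fun g => block_mx g 0 0 (ctau g) k l).
      rewrite -(splitK k) -(splitK l).
      case: (fintype.split k) => a; case: (fintype.split l) => b /=.
      * by apply: regular_ext (regular_entry _ a b) => g _; rewrite block_mxEul.
      * by apply: regular_ext (regular_cst _ _ 0) => g _; rewrite block_mxEur mxE.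
      * by apply: regular_ext (regular_cst _ _ 0) => g _; rewrite block_mxEdl mxE.
      by apply: regular_ext (ai_antiregular tau a b) => g _; rewrite block_mxEdr mxE.
    apply: (regular_ext (f := fun g : 'M[C]_n =>
        \sum_k \sum_l (P i l * (block_mx g 0 0 (ctau g) l k * invmx P k j)) : C)) => [g _|].
      rewrite /rlf mxE; apply: eq_bigr => k _; rewrite mxE big_distrl.
      by apply: eq_bigr => l _; rewrite /= mulrA.
    apply: regular_sum => k; apply: regular_sum => l.
    apply: regular_mul; first exact: regular_cst.
    by apply: regular_mul; [exact: rb | exact: regular_cst].
  + by move=> _ [g Gg ->]; rewrite rlfK block_mxKul.
  by move=> g Gg; rewrite rlfK block_mxKul.
apply/seteqP; split=> g /=.
  move=> [Gg tg]; exists (rlf g (ctau g)); last by rewrite rlfK block_mxKul.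
  split; first by exists g.
  exists (map_mx (@complex.Re R) (rlf g (ctau g))).
  have := realified_conj Gg; rewrite tg => /matrixP e.
  apply/matrixP => i j; rewrite [RHS]mxE [X in real_complex _ X]mxE.
  have := e i j; rewrite [LHS]mxE; case: (rlf _ _ i j) => x y /= [] h.
  apply/eqP; rewrite eq_complex /= eqxx /=.
  have : y *+ 2 == 0 by rewrite mulr2n -{1}h addNr.
  by rewrite mulrn_eq0.
move=> [_ [[h Gh ->] [a aE]] <-]; rewrite rlfK block_mxKul; split=> //.
have := realified_conj Gh; rewrite aE.
have -> : cj (map_mx (real_complex R) a) = map_mx (real_complex R) a.
  by apply/matrixP => i j; rewrite !mxE; apply/eqP; rewrite eq_complex /= oppr0 !eqxx.
by rewrite -aE => /(congr1 (fun x => ulsubmx (unrlf x))); rewrite !rlfK !block_mxKul.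
Qed.
End FixedPointsRealForm.

(** * The conjugate representation and the twisted involution *)

Section BarOrbit.
Variables (R : realType) (Gam : groupType) (n : nat) (G : algGroup R n).
Variables (s : nat) (gen : 'I_s -> Gam) (sigma : antiInvolution G).
Local Notation C := R[i].
Local Notation M := (s * (n * n + 1))%N.
Local Notation rep := (rep Gam G).

Lemma rep_barK (r : rep) : rep_bar sigma (rep_bar sigma r) = r.
Proof. by apply: rep_ext => x /=; rewrite ai_invol //; exact: rep_in. Qed.

Lemma conj_bar_regular (p : {mpoly C[M]}) : regular_on (homcoord gen) [set: rep]
  (fun r => ((p.@[homcoord gen (rep_bar sigma r) 0])^*)%C).
Proof.
pose d (r : rep) : 'rV[C]_M := map_mx (@conjc R) (homcoord gen (rep_bar sigma r)).
apply: (regular_ext (f := fun r : rep => (map_mpoly (@conjc R) p).@[d r 0])) => [r _|].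
  by rewrite -meval_map_conj; apply: meval_eq => k; rewrite mxE.
apply: regular_comp => k; case/mxvec_indexP: k => i k.
apply: (regular_ext
  (f := fun r : rep => ((glcoord (sigma (r (gen i))) 0 k)^*)%C)) => [r _|].
  by rewrite /d mxE /homcoord mxvecE mxE.
exact: (regular_gen gen i (sigma_glcoord_regular sigma k)).
Qed.

(** [rep_bar] is an antiregular involution of Hom that exchanges the two orbits: conjugating an
    equation of one and composing it with [rep_bar] gives an equation of the other. *)
Lemma closed_orbit_bar (r : rep) :
  closed_in (homcoord gen) [set: rep] (Defs.orbit r) ->
  closed_in (homcoord gen) [set: rep] (Defs.orbit (rep_bar sigma r)).
Proof.
move=> [S SE].
have barE r' : Defs.orbit (rep_bar sigma r) r' <-> Defs.orbit r (rep_bar sigma r').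
  by split=> /(@orbit_bar _ _ _ _ sigma); rewrite rep_barK.
exists [set q | exists2 p, S p & forall r' : rep,
  q.@[homcoord gen r' 0] = ((p.@[homcoord gen (rep_bar sigma r') 0])^*)%C].
apply/seteqP; split=> r' /=.
  move=> /barE; rewrite SE => -[_ h]; split=> // q [p Sp ->].
  by rewrite h // rmorph0.
move=> [_ h]; apply/barE; rewrite SE; split=> // p Sp.
have [q qE] := conj_bar_regular p.
have : q.@[homcoord gen r' 0] = 0 by apply: h; exists p => // r''; rewrite -qE.
rewrite -qE // => e; apply: (can_inj (@conjcK R)).
by apply: (etrans e); rewrite rmorph0.
Qed.

Section Twist.
Variables (g : 'M[C]_n) (Gg : G g).
Hypothesis central : forall h, G h -> sigma g *m g *m h = h *m (sigma g *m g).

Definition twist h : 'M[C]_n := invmx g *m sigma h *m g.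

Fact twist_in h : G h -> G (twist h).
Proof.
by move=> Gh; apply: ag_mul => //; apply: ag_mul; [exact: ag_inv | exact: ai_in].
Qed.

Fact twist_mul h k : G h -> G k -> twist (h *m k) = twist h *m twist k.
Proof.
move=> Gh Gk; have ug := ag_unit Gg.
by rewrite /twist ai_mul // !mulmxA mulmxK.
Qed.

Fact twist_invol h : G h -> twist (twist h) = h.
Proof.
move=> Gh; have ug := ag_unit Gg; have Gi := ag_inv Gg; have Gsg := ai_in sigma Gg.
have us := ag_unit Gsg; have Gsh := ai_in sigma Gh.
have e : sigma (invmx g *m sigma h *m g) = invmx (sigma g) *m h *m sigma g.
  rewrite (ai_mul sigma (ag_mul Gi Gsh) Gg) (ai_mul sigma Gi Gsh) (ai_invol sigma Gh).
  by rewrite (ai_invmx sigma Gg).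
rewrite /twist e; move: (sigma g) us (central Gh) => k uk ck.
have uc : k *m g \in unitmx by rewrite unitmx_mul uk.
apply: (can_inj (mulKmx uc)); rewrite ck.
by rewrite !mulmxA mulmxK // mulmxV // mul1mx.
Qed.

Fact twist_antiregular i j :
  regular_on (@glcoord R n) (ag_set G) (fun h => ((twist h i j)^*)%C).
Proof.
apply: (regular_ext (f := fun h => \sum_k \sum_l
  (((invmx g i l)^*)%C * (((sigma h l k)^*)%C * ((g k j)^*)%C)) : C)) => [h _|].
  rewrite /twist mxE rmorph_sum; apply: eq_bigr => k _; rewrite mxE big_distrl rmorph_sum.
  by apply: eq_bigr => l _; rewrite /= -mulrA !rmorphM.
apply: regular_sum => k; apply: regular_sum => l.
apply: regular_mul; first exact: regular_cst.
by apply: regular_mul; [exact: ai_antiregular | exact: regular_cst].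
Qed.

Definition twisted_involution : antiInvolution G :=
  AntiInvolution twist_in twist_mul twist_invol twist_antiregular.
End Twist.
End BarOrbit.

Theorem theorem3 (R : realType) (Gam : groupType) (s : nat) (gen : 'I_s -> Gam)
    (hgen : generates gen)
    (n : nat) (G : algGroup R n) (hconn : ag_connected G) (hred : reductive G)
    (G0 : set 'M[R[i]]_n) (hG0 : real_form G G0)
    (sigma : antiInvolution G) (hsigma : fixed_points sigma = G0)
    (rho : rep Gam G) (hgood : good gen rho)
    (hPhi : Phi sigma (chi gen rho) = chi gen rho) :
  exists G' : set 'M[R[i]]_n, real_form G G' /\ forall x : Gam, G' (rho x).
Proof.
case: hgood => clo stab.
have [g Gg gE] : Defs.orbit rho (rep_bar sigma rho).
  apply: contrapT => nconj.
  have dis : Defs.orbit rho `&` Defs.orbit (rep_bar sigma rho) = set0.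
    rewrite -subset0 => r [] /orbit_act[a ->] /orbit_act[b e].
    apply: nconj; apply/orbit_act; case: b e => h Gh e.
    exists (elt_mul (exist _ (invmx h) (ag_inv Gh)) a); rewrite actM e -actM.
    rewrite -[LHS]act1; congr act; apply: eq_exist => /=.
    by rewrite mulVmx //; exact: ag_unit Gh.
  have [p [p0 p1]] := separating_polynomial hgen clo (closed_orbit_bar sigma clo) dis.
  have [|a|a|F [Frho Fbar]] := @invariant_separation _ _ _ _ hconn hred _ gen
      (fun r => p.@[homcoord gen r 0]) rho (rep_bar sigma rho).
  - by exists p.
  - by apply: p0; apply/orbit_act; exists a.
  - by apply: p1; apply/orbit_act; exists a.
  (* By [Phi_chi], the hypothesis says that all invariants agree at [rho] and at its conjugate. *)
  case/negP: Fbar; move: hPhi; rewrite Phi_chi => /(congr1 (fun x => cv_eval x F)) /= ->.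
  by rewrite Frho.
have ug := ag_unit Gg; have Gsg := ai_in sigma Gg; have us := ag_unit Gsg.
have sE x : sigma (rho x) = g *m rho x *m invmx g := gE x.
(* Applying [sigma] twice to rho(x) conjugates it by sigma(g) g. *)
have sgg : stabilizer rho (sigma g *m g).
  split=> [|x]; first exact: ag_mul.
  have Gx := rep_in rho x; have Gi := ag_inv Gg.
  have := ai_invol sigma Gx; rewrite sE (ai_mul sigma (ag_mul Gg Gx) Gi) (ai_mul sigma Gg Gx).
  rewrite (ai_invmx sigma Gg) sE => e; rewrite -[RHS]e.
  have -> : invmx (sigma g *m g) = invmx g *m invmx (sigma g).
    have uc : sigma g *m g \in unitmx by rewrite unitmx_mul us.
    apply: (can_inj (mulKmx uc)); rewrite mulmxV // !mulmxA mulmxK // mulmxV //.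
  by rewrite !mulmxA.
have central h : G h -> sigma g *m g *m h = h *m (sigma g *m g).
  by move: sgg; rewrite stab => -[_]; exact.
exists (fixed_points (twisted_involution Gg central)); split.
  exact: fixed_points_real_form.
move=> x; split; first exact: rep_in.
rewrite /= /twist sE !mulmxA mulVmx // mul1mx mulmxKV //.
Qed.
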